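(* Let $0\le p\le 2$. Then there is a constant $C>0$ (depending only on $p$) such that for every $\varphi\in\mathcal{Z}$, $$\|\varphi\|_{L^{p+2}(\mathbb{R}^2)}^{p+2}\le C\,\|\varphi\|_{L^2(\mathbb{R}^2)}^{2-p}\,\big\|D_x^{-1/2}\varphi_y\big\|_{L^2(\mathbb{R}^2)}^{p/2}\,\big\|D_x^{1/2}\varphi\big\|_{L^2(\mathbb{R}^2)}^{3p/2}.$$ As a consequence, there is a constant $C>0$ such that $\|\varphi\|_{L^{p+2}(\mathbb{R}^2)}\le C\|\varphi\|_{\mathcal{Z}}$ for all $\varphi\in\mathcal{Z}$; that is, $\mathcal{Z}$ is continuously embedded in $L^{p+2}(\mathbb{R}^2)$.
   Context: For functions on $\mathbb{R}^2$ with variables $(x,y)$ and dual Fourier variables $(\xi,\eta)$, $D_x^{\pm1/2}$ is defined by $(D_x^{\pm1/2}u)^{\wedge}(\xi,\eta)=|\xi|^{\pm1/2}\widehat{u}(\xi,\eta)$. The space is $$\mathcal{Z}=\{u\in L^2(\mathbb{R}^2):\ D_x^{1/2}u\in L^2(\mathbb{R}^2),\ D_x^{-1/2}u_y\in L^2(\mathbb{R}^2)\},$$ with norm (the constant in front of $u^2$ being normalized to $1$) $$\|u\|_{\mathcal{Z}}=\Big(\int_{\mathbb{R}^2}\big(u^2+|D_x^{1/2}u|^2+|D_x^{-1/2}u_y|^2\big)\,dx\,dy\Big)^{1/2}.$$ Functions are real-valued. *)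

(* Defs.v *)
From mathcomp Require Import all_boot all_order all_algebra.
From mathcomp Require Import all_classical all_reals all_analysis.
From mathcomp Require Import complex.

Set Implicit Arguments.
Unset Strict Implicit.
Unset Printing Implicit Defensive.
Import Order.TTheory GRing.Theory Num.Theory.
Import numFieldNormedType.Exports.

Local Open Scope classical_set_scope.
Local Open Scope ring_scope.
Local Open Scope complex_scope.

Section defs.
Context {R : realType}.

Definition leb2 : {measure set (measurableTypeR R * measurableTypeR R) -> \bar R} :=
  (@lebesgue_measure R \x @lebesgue_measure R)%E.

Definition inLp (p : R) (u : R * R -> R) : Prop := u \in Lfun leb2 p%:E.

Definition normLp (p : R) (u : R * R -> R) : \bar R :=
  'N[leb2]_(p%:E)[EFin \o u]%E.

Definition inL2C (v : R * R -> R[i]) : Prop :=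
  inLp 2 (fun k => complex.Re (v k)) /\ inLp 2 (fun k => complex.Im (v k)).

Definition box (n : nat) : set (R * R) :=
  `[- n%:R, n%:R] `*` `[- n%:R, n%:R].

(* The integral of u(x,y) e^{-i(x xi + y eta)} over [-n, n]^2, at
   k = (xi, eta). *)
Definition fourier_box (n : nat) (u : R * R -> R) (k : R * R) : R[i] :=
  Rintegral leb2 (box n) (fun z => u z * cos (z.1 * k.1 + z.2 * k.2))
  -i* Rintegral leb2 (box n) (fun z => u z * sin (z.1 * k.1 + z.2 * k.2)).

(* v is (a representative of) the Fourier-Plancherel transform of u: the limit
   in L^2 of the Fourier integrals of the truncations of u.  By Plancherel's
   theorem every u in L^2 has such a v, unique almost everywhere. *)
Definition is_fourier (u : R * R -> R) (v : R * R -> R[i]) : Prop :=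
  [/\ inLp 2 u, inL2C v &
      normLp 2 (fun k => Normc.normc (fourier_box n u k - v k)) @[n --> \oo] --> 0%E].

(* w is a real-valued L^2 function whose transform is m times that of u. *)
Definition is_multiplier (m : R * R -> R[i]) (u w : R * R -> R) : Prop :=
  exists uhat what : R * R -> R[i],
    [/\ is_fourier u uhat, is_fourier w what &
        {ae leb2, forall k, what k = m k * uhat k}].

Definition symb_Dx (s : R) (k : R * R) : R[i] := (`|k.1| `^ s)%:C.

Definition symb_dy (k : R * R) : R[i] := 0 +i* k.2.

Definition is_Dxhalf (u w : R * R -> R) : Prop :=
  is_multiplier (symb_Dx (1 / 2)) u w.

(* u_y is in general only a tempered distribution, with transform
   i eta uhat(xi, eta); hence D_x^{-1/2} u_y has transform
   |xi|^{-1/2} (i eta) uhat. *)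
Definition is_Dxmhalf_dy (u w : R * R -> R) : Prop :=
  is_multiplier (fun k => symb_Dx (- (1 / 2)) k * symb_dy k) u w.

Definition Zspace : set (R * R -> R) :=
  [set u | [/\ inLp 2 u, exists w, is_Dxhalf u w & exists w, is_Dxmhalf_dy u w]].

(* The L^2 functions D_x^{1/2} u and D_x^{-1/2} u_y (determined almost
   everywhere); the default 0 is never used for u in Zspace. *)
Definition Dxhalf (u : R * R -> R) : R * R -> R :=
  xget (cst 0) [set w | is_Dxhalf u w].

Definition Dxmhalf_dy (u : R * R -> R) : R * R -> R :=
  xget (cst 0) [set w | is_Dxmhalf_dy u w].

Definition normZ (u : R * R -> R) : \bar R :=
  ((\int[leb2]_z (u z ^+ 2 + `|Dxhalf u z| ^+ 2 + `|Dxmhalf_dy u z| ^+ 2)%:E)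
    `^ (1 / 2))%E.

End defs.

(* Main.v *)
(** The endpoint p = 2 is proved in real space.  Regularising with e^(-e|xi|-e|eta|), whose
    transform is a product of Poisson kernels, gives Plancherel's identity, hence
    ||D_h u||_2^2 <= C int (2 - 2 cos(h.k)) |u^(k)|^2 dk for the increments D_h u(z) = u(z+h) - u(z).
    Since int (2 - 2 cos(t x)) / t^2 dt <= C |x|, and |eta| <= s |xi| + eta^2 / (s |xi|), the integrals
    int ||D_(te) u||_2^2 / t^2 dt along the two axes are bounded by B^2 and by s B^2 + A^2 / s, where
    A = ||D_x^(-1/2) u_y||_2 and B = ||D_x^(1/2) u||_2.
    Averaging u(z)^4 <= 4 u(z)^2 (D_h u(z))^2 + 4 u(z+h)^4 over h in a rectangle of sides r and r/m,
    with r depending on u(z), bounds ||u||_4^4 by C m (B^2 + A^2/m^2)^2; the choice m = A/B gives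
    ||u||_4^4 <= C A B^3.  Hoelder's inequality between L^2 and L^4 yields 0 <= p <= 2. *)
Require Import Defs.
From HB Require Import structures.
From mathcomp Require Import all_boot all_order all_algebra.
From mathcomp Require Import all_classical all_reals all_analysis.
From mathcomp Require Import measurable_realfun complex ring lra.
Import Order.TTheory GRing.Theory Num.Theory.
Import numFieldNormedType.Exports.
Local Open Scope ring_scope.

Set Implicit Arguments.
Unset Strict Implicit.
Unset Printing Implicit Defensive.

(** The side r of the averaging rectangle depends on the point z, whereas Tonelli needs a kernel
    that does not. The kernel |h.1|^-3 on a cone around h.1 = m h.2 resolves this: for every r it is
    at least 1/(8 r^3) on [r, 2r] x [r/m, 2r/m], so one integral against it serves all r at once,
    and its two marginals are bounded by multiples of t^-2, the weight of the one-dimensional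
    integrals of increments. The free parameter s is taken equal to m, so that both directions are
    bounded by multiples of (B^2 + A^2/m^2)/m. Averaging gives X <= C sqrt(m X) J, where X is the
    integral of u^4 and J the kernel integral. A factor sqrt X has to be cancelled, so X must be
    known to be finite: the argument runs on u clamped to [-n, n], and Fatou's lemma removes the
    clamp. Constants are free, so Plancherel is proved as an identity only for functions in both L^1
    and L^2; on L^2 it is used as inequalities that lose a factor 2. *)

Local Open Scope classical_set_scope.

(* [prodm] is [\x] with a sigma-finite instance, so that products can be iterated. *)
Section prodm.
Context d1 d2 (T1 : measurableType d1) (T2 : measurableType d2) {R : realType}.
Variables (m1 : {sigma_finite_measure set T1 -> \bar R}) (m2 : {sigma_finite_measure set T2 -> \bar R}).

Definition prodm : set (T1 * T2) -> \bar R := (m1 \x m2)%E.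

HB.instance Definition _ := Measure.on prodm.

Let prodm_sigma_finite : sigma_finite setT prodm.
Proof.
have [F TF Foo] := sigma_finiteT m1; have [G TG Goo] := sigma_finiteT m2.
(* Enumeration of all pairs of indices; the default pair, used for codes of no pair, merely repeats
   a rectangle. *)
pose f i : nat * nat := odflt (0%N, 0%N) (unpickle i).
exists (fun i => F (f i).1 `*` G (f i).2).
  apply/seteqP; split=> // -[x y] _.
  have [i _ Fx] : (\bigcup_i F i) x by rewrite -TF.
  have [j _ Gy] : (\bigcup_i G i) y by rewrite -TG.
  by exists (pickle (i, j)) => //; rewrite /f pickleK.
move=> i; have [mF Fi] := Foo (f i).1; have [mG Gi] := Goo (f i).2.
split; first exact: measurableX.
rewrite /prodm product_measure1E// lte_mul_pinfty// ge0_fin_numE//.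
Qed.

HB.instance Definition _ := Measure_isSigmaFinite.Build _ _ _ prodm prodm_sigma_finite.

End prodm.

(** * Translations in L^1 and L^2 *)

Section translation_line.
Context {R : realType}.
Local Notation mu := (@lebesgue_measure R).
Local Open Scope ereal_scope.

(** By uniqueness of Lebesgue measure it is enough to compare on half-open intervals. *)
Lemma lebesgue_measureD (t : R) (A : set R) : measurable A ->
  pushforward mu ((fun x => x + t)%R : _ -> measurableTypeR R) A = mu A.
Proof.
move=> mA.
have mt : measurable_fun setT ((fun x => x + t)%R : measurableTypeR R -> measurableTypeR R).
  exact: measurable_funD.
apply/esym/(@lebesgue_measure_unique _ (pushforward mu ((fun x => x + t)%R : _ -> measurableTypeR R))) => //= _ [[a b]] _ <-.
rewrite /pushforward.
have -> : (fun x : R => (x + t)%R) @^-1` `]a, b] = [set` `]a - t, b - t]%R].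
  by apply/seteqP; split=> x /=; rewrite !in_itv/= ltrBlDr lerBrDr.
rewrite /= !lebesgue_measure_itv/= !lte_fin ltrD2r.
by case: ifP => // _; rewrite -!EFinB; congr (_%:E); lra.
Qed.

Lemma ge0_integral_shift (t : R) (f : R -> \bar R) :
  measurable_fun setT f -> (forall x, 0 <= f x) ->
  \int[mu]_x f (x + t)%R = \int[mu]_x f x.
Proof.
move=> mf f0.
rewrite -[LHS]/(\int[mu]_(x in ((fun x => x + t)%R : _ -> measurableTypeR R) @^-1` setT) (f \o (fun x => x + t)%R) x).
have mt : measurable_fun setT ((fun x => x + t)%R : measurableTypeR R -> measurableTypeR R).
  exact: measurable_funD.
rewrite -ge0_integral_pushforward//=.
by apply: eq_measure_integral => A mA AS; exact/lebesgue_measureD.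
Qed.

End translation_line.

(** Unfolds to the measure [leb2] of the statement, but carries the sigma-finite structure that
    makes [prodm leb leb] and Tonelli on pairs of points available. *)
Notation leb := (prodm (@lebesgue_measure _) (@lebesgue_measure _)).

Section translation_plane.
Context {R : realType}.
Local Notation T := (measurableTypeR R * measurableTypeR R)%type.
Local Notation mu := (@lebesgue_measure R).
Local Open Scope ereal_scope.
Implicit Type f : T -> \bar R.

Lemma leb_tonelli f : measurable_fun [set: T] f -> (forall z, 0 <= f z) ->
  \int[leb]_z f z = \int[mu]_x \int[mu]_y f (x, y).
Proof. exact: fubini_tonelli1. Qed.

Lemma leb_tonelli' f : measurable_fun [set: T] f -> (forall z, 0 <= f z) ->
  \int[leb]_z f z = \int[mu]_y \int[mu]_x f (x, y).
Proof. exact: fubini_tonelli2. Qed.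

Lemma measurable_leb_int f : measurable_fun [set: T] f -> (forall z, 0 <= f z) ->
  measurable_fun [set: R] (fun x => \int[mu]_y f (x, y)).
Proof. by move=> mf f0; exact: (measurable_fun_fubini_tonelli_F f). Qed.

Lemma measurable_leb_int' f : measurable_fun [set: T] f -> (forall z, 0 <= f z) ->
  measurable_fun [set: R] (fun y => \int[mu]_x f (x, y)).
Proof. by move=> mf f0; exact: (measurable_fun_fubini_tonelli_G f). Qed.

Lemma measurable_shift2 (h : T) : measurable_fun [set: T] (fun z : T => (z + h)%R : T).
Proof.
by apply/measurable_fun_pairP; split; apply: measurable_funD.
Qed.

Lemma ge0_integral_shift2 (h : T) f :
  measurable_fun setT f -> (forall x, 0 <= f x) ->
  \int[leb]_z f (z + h)%R = \int[leb]_z f z.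
Proof.
move=> mf f0.
rewrite leb_tonelli; [|exact: (measurableT_comp mf (measurable_shift2 h))|by []].
rewrite leb_tonelli; [|by []|by []].
transitivity (\int[mu]_x \int[mu]_y f ((x + h.1)%R, y)).
  apply: eq_integral => x _.
  apply: (@ge0_integral_shift _ h.2 (fun y => f ((x + h.1)%R, y))) => //.
  exact: (measurableT_comp mf (measurable_pair1 _)).
apply: (@ge0_integral_shift _ h.1 (fun x => \int[mu]_y f (x, y))).
  exact: measurable_leb_int.
by move=> x; exact: integral_ge0.
Qed.

Lemma integral_shift2 (h : T) f : measurable_fun setT f ->
  \int[leb]_z f (z + h)%R = \int[leb]_z f z.
Proof.
move=> mf; rewrite integralE [RHS]integralE; congr (_ - _).
- transitivity (\int[leb]_z f^\+ (z + h)%R); first by apply: eq_integral => z _; rewrite !funeposE.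
  apply: ge0_integral_shift2; [exact: measurable_funepos|by move=> z; exact: funepos_ge0].
- transitivity (\int[leb]_z f^\- (z + h)%R); first by apply: eq_integral => z _; rewrite !funenegE.
  apply: ge0_integral_shift2; [exact: measurable_funeneg|by move=> z; exact: funeneg_ge0].
Qed.

End translation_plane.

(** * Convergence to 0 of nonnegative extended reals *)

Section ereal_limits.
Context {R : realType}.
Local Open Scope ereal_scope.

Lemma ge0_cvge0P (a : nat -> \bar R) : (forall n, 0 <= a n) ->
  (a @ \oo --> 0) <-> (forall e : R, (0 < e)%R -> exists N, forall n, (N <= n)%N -> a n <= e%:E).
Proof.
move=> a0; split=> [a_0 e e0|ae].
  have /fine_cvgP[fa a0'] := a_0.
  have : \forall n \near \oo, a n <= e%:E.
    move/cvgrPdist_le : a0' => /(_ e e0) h.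
    near=> n; have -> : a n = (fine (a n))%:E by rewrite fineK//; near: n.
    rewrite lee_fin -[X in (X <= _)%R]ger0_norm ?fine_ge0//.
    by near: n; apply: filterS h => n /=; rewrite sub0r normrN.
  by case=> N _ NN; exists N.
have fa : \forall n \near \oo, a n \is a fin_num.
  have [N NN] := ae 1%R ltr01; exists N => //= n /NN h.
  by rewrite ge0_fin_numE// (le_lt_trans h)// ltry.
apply/fine_cvgP; split => //; apply/cvgrPdist_le => e e0.
have [N NN] := ae e e0.
near=> n; rewrite sub0r normrN ger0_norm ?fine_ge0//= -lee_fin fineK.
  by apply: NN; near: n; exists N.
by near: n.
Unshelve. all: by end_near. Qed.

(** Dominated convergence only treats sequences, while the Poisson argument needs one radius d for
    all small shifts. If no d worked, picking a bad t within 1/(n+1) for each n would give a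
    sequence that contradicts the hypothesis. *)
Lemma seq_modulus (a : R -> \bar R) :
  (forall t_ : nat -> R, (forall n, `|t_ n| <= n.+1%:R^-1)%R -> a (t_ n) @[n --> \oo] --> 0) ->
  (forall t, 0 <= a t) ->
  forall e : R, (0 < e)%R -> exists2 d : R, (0 < d)%R & forall t, (`|t| <= d)%R -> a t <= e%:E.
Proof.
move=> h a0 e e0; apply: contrapT => /forall2NP nd.
have /choice[t_ ht] : forall n : nat, exists t : R, (`|t| <= n.+1%:R^-1)%R /\ ~~ (a t <= e%:E).
  move=> n; case: (nd n.+1%:R^-1%R) => [//|/existsNP[t /not_implyP[tn /negP nt]]].
  by exists t; split.
have /(ge0_cvge0P (fun n => a0 (t_ n)))/(_ e e0)[N /(_ N (leqnn _))] := h t_ (fun n => (ht n).1).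
by apply/negP; exact: (ht N).2.
Qed.

End ereal_limits.

Section translation_bounded.
Context {R : realType}.
Local Notation T := (measurableTypeR R * measurableTypeR R)%type.
Local Notation mu := (@lebesgue_measure R).
Local Open Scope ereal_scope.

Lemma measurable_shift (t : R) : measurable_fun [set: measurableTypeR R] ((fun x => x + t)%R : measurableTypeR R -> measurableTypeR R).
Proof. exact: measurable_funD. Qed.

Lemma cvg_harmonic_bound (t_ : nat -> R) :
  (forall n, `|t_ n| <= n.+1%:R^-1)%R -> (t_ @ \oo --> 0%R)%R.
Proof.
move=> ht; apply/norm_cvg0P; apply: (@squeeze_cvgr _ _ _ _ (fun=> 0%R) (fun n => n.+1%:R^-1%R)).
- by near=> n; rewrite normr_ge0 ht.
- exact: cvg_cst.
- exact: cvg_harmonic.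
Unshelve. all: by end_near. Qed.

(** The model case for the density argument: a continuous function cut off to a segment is bounded,
    has bounded support and jumps only at the two end points, so dominated convergence applies. *)
Lemma L1_shift_patch (g : R -> R) (N : R) (t_ : nat -> R) :
  continuous g -> (forall n, `|t_ n| <= n.+1%:R^-1)%R ->
  \int[mu]_x `|((g \_ [set` `[-N, N]%R]) (x + t_ n) - (g \_ [set` `[-N, N]%R]) x)%:E| @[n --> \oo] --> 0.
Proof.
move=> cg ht; pose v : R -> R := (g \_ [set` `[-N, N]%R]); rewrite -/v.
have mv : measurable_fun setT v.
  apply/measurable_restrict => //; apply: measurable_funTS.
  exact: continuous_measurable_fun.
have [K K0 vK] : exists2 K : R, (0 <= K)%R & forall x, (`|v x| <= K)%R.
  have := @segment_compact R (-N) N.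
  have /(@continuous_compact _ _ g [set` `[-N, N]%R]) : {within [set` `[-N, N]%R], continuous g} by exact: continuous_subspaceT.
  move=> /[apply] /compact_bounded[M [Mr MM]].
  exists (`|M| + 1)%R; first by rewrite addr_ge0.
  move=> x; rewrite /v patchE; case: ifPn => xN; last by rewrite normr0.
  apply: MM; first by rewrite (le_lt_trans (ler_norm _))// ltrDl.
  by exists x => //; rewrite inE in xN.
have t1 n : (`|t_ n| <= 1)%R by rewrite (le_trans (ht n))// invf_le1// ler1n.
have tc := cvg_harmonic_bound ht.
have vs x : (N < `|x|)%R -> v x = 0%R.
  move=> Nx; rewrite /v patchE; case: ifPn => //; rewrite inE/= in_itv/= -ler_norml.
  by rewrite leNgt Nx.
(* [K] bounds [v]; the support is enlarged by 1 because every shift satisfies [|t_ n| <= 1]. *)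
pose G (x : R) : R := ((K *+ 2) * \1_`[-(N + 1), N + 1] x)%R.
have := @dominated_convergence _ _ _ mu setT measurableT
  (fun n x => `|(v (x + t_ n) - v x)%:E|) (cst 0) (EFin \o G).
case.
- move=> n; apply/measurableT_comp => //; apply/measurable_EFinP; apply: measurable_funB => //.
  exact: (measurableT_comp mv (measurable_shift _)).
- exact: measurable_cst.
(* At the jumps N and -N pointwise convergence may fail; they form a null set. *)
- exists ([set N] `|` [set - N]%R); split.
  + exact: (measurableU _ _ (measurable_set1 _) (measurable_set1 _)).
  + by apply: countable_lebesgue_measure0; apply: finite_set_countable; rewrite finite_setU.
  + move=> x /=; apply: contra_notP => /not_orP[/eqP xN /eqP xN'] _.
    have xt : (x + t_ n @[n --> \oo] --> x)%R.
      by rewrite -[X in _ --> X]addr0; apply: cvgD => //; exact: cvg_cst.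
    have nxt : (`|x + t_ n| @[n --> \oo] --> `|x|)%R by exact: cvg_norm.
    have vv : (v (x + t_ n)%R @[n --> \oo] --> v x)%R.
      have [xin|xout|xN1] := ltgtP `|x|%R N.
      - have -> : v x = g x by rewrite /v patchE mem_set//= in_itv/= -ler_norml ltW.
        apply: (@cvg_trans _ (g (x + t_ n)%R @[n --> \oo])); last exact: (cvg_comp _ _ xt (cg x)).
        apply: near_eq_cvg; near=> n.
        rewrite /v patchE mem_set//= in_itv/= -ler_norml ltW//; near: n.
        by apply: (cvgr_lt `|x|%R).
      - rewrite (vs x)//.
        apply: (@cvg_trans _ ((0 : R)%R @[n --> \oo])); last exact: cvg_cst.
        apply: near_eq_cvg; near=> n; rewrite vs//; near: n.
        by apply: (cvgr_gt `|x|%R).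
      - by move: xN1 => /eqP; rewrite eqr_norml (negbTE xN) (negbTE xN').
    rewrite -[X in _ --> X]/((0 : R)%:E); apply: cvg_EFin; first by near=> n.
    rewrite /= -(@normr0 _ R) -(subrr (v x)); apply: cvg_norm.
    by apply: cvgB => //; exact: cvg_cst.
- rewrite (_ : EFin \o G = fun x => (K *+ 2)%:E * (\1_[set` `[-(N + 1), N + 1]%R] x)%:E)//.
  by apply: integrableZl => //; exact: integrable_indic_itv.
- apply: aeW => x n _; rewrite /= normr_id lee_fin /G indicE.
  have [xN|xN] := leP `|x|%R (N + 1)%R.
    rewrite mem_set ?mulr1//=; last by rewrite in_itv/= -ler_norml.
    by rewrite (le_trans (ler_normB _ _))// mulr2n lerD.
  rewrite !vs ?subr0 ?normr0 ?mulr_ge0 ?mulrn_wge0//.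
  + by rewrite (lt_trans _ xN)// ltrDl.
  + have : (`|x| <= `|x + t_ n| + `|t_ n|)%R by rewrite -{1}(addrK (t_ n) x) ler_normB.
    have := t1 n; lra.
- by move=> _ _; rewrite integral0.
Unshelve. all: by end_near. Qed.

End translation_bounded.

(** * Integrals of nonnegative real functions *)

Section int_real.
Context d {T : measurableType d} {R : realType} (mu : {measure set T -> \bar R}).
Implicit Types f g : T -> R.

Lemma le_int f g : measurable_fun setT f -> measurable_fun setT g ->
  (forall x, 0 <= f x) -> (forall x, f x <= g x) ->
  (\int[mu]_x (f x)%:E <= \int[mu]_x (g x)%:E)%E.
Proof.
move=> mf mg f0 fg; apply: ge0_le_integral => //.
- by move=> x _; rewrite lee_fin.
- exact/measurable_EFinP.
- exact/measurable_EFinP.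
- by move=> x _; rewrite lee_fin.
Qed.

Lemma intD f g : measurable_fun setT f -> measurable_fun setT g ->
  (forall x, 0 <= f x) -> (forall x, 0 <= g x) ->
  (\int[mu]_x (f x + g x)%:E = \int[mu]_x (f x)%:E + \int[mu]_x (g x)%:E)%E.
Proof.
move=> mf mg f0 g0; under eq_integral do rewrite EFinD.
rewrite ge0_integralD//.
- by move=> x _; rewrite lee_fin.
- exact/measurable_EFinP.
- by move=> x _; rewrite lee_fin.
- exact/measurable_EFinP.
Qed.

Lemma intZ k f : measurable_fun setT f -> 0 <= k -> (forall x, 0 <= f x) ->
  (\int[mu]_x (k * f x)%:E = k%:E * \int[mu]_x (f x)%:E)%E.
Proof.
move=> mf k0 f0; under eq_integral do rewrite EFinM.
rewrite ge0_integralZl//; first exact/measurable_EFinP.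
by move=> x _; rewrite lee_fin.
Qed.

Lemma int_ge0 f : (forall x, 0 <= f x) -> (0 <= \int[mu]_x (f x)%:E)%E.
Proof. by move=> f0; apply: integral_ge0 => x _; rewrite lee_fin. Qed.

End int_real.

Section translation_L1_line.
Context {R : realType}.
Local Notation mu := (@lebesgue_measure R).

Lemma cvg_patch (u : R -> R) (x : R) : \forall n \near \oo,
  (u \_ `[- (n%:R : R), n%:R]) x = u x.
Proof.
have [k xk] : exists k : nat, `|x| <= k%:R.
  by exists (Num.trunc `|x|).+1; rewrite ltW// truncnS_gt.
exists k => // n /= kn; have xn : x \in `[- (n%:R : R), n%:R]%R.
  by rewrite in_itv/= -ler_norml (le_trans xk)// ler_nat.
by rewrite patchE mem_set.
Qed.

(** Density: [u] is cut off to a segment and then replaced there by a continuous function, at a cost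
    of e/6 each. By translation invariance the error e/3 between [u] and [v] occurs twice, and the
    shift of [v] costs the remaining e/3. *)
Lemma L1_shift_cvg (u : R -> R) (t_ : nat -> R) :
  mu.-integrable setT (EFin \o u) -> (forall n, `|t_ n| <= n.+1%:R^-1) ->
  (\int[mu]_x `|u (x + t_ n) - u x|%:E @[n --> \oo] --> 0)%E.
Proof.
move=> iu ht.
have mu_ : measurable_fun setT u by apply/measurable_EFinP; exact: measurable_int iu.
have mE (N : R) : measurable `[-N, N] by exact: measurable_itv.
have mp (f : R -> R) N : measurable_fun setT f -> measurable_fun setT (f \_ `[-N, N]).
  by move=> mf; apply/measurable_restrict => //; exact: measurable_funTS.
apply/ge0_cvge0P; first by move=> n; exact: int_ge0.
move=> e e0.
have e6 : 0 < e / 6 by rewrite divr_gt0.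
have [N HN] : exists N : nat, (\int[mu]_x `|u x - (u \_ `[- (N%:R : R), N%:R]) x|%:E <= (e / 6)%:E)%E.
  suff : (\int[mu]_x `|u x - (u \_ `[- (n%:R : R), n%:R]) x|%:E @[n --> \oo] --> 0)%E.
    move/(ge0_cvge0P (fun n => int_ge0 mu (fun x => normr_ge0 (u x - (u \_ `[- (n%:R : R), n%:R]) x)))).
    by move=> /(_ _ e6)[N /(_ _ (leqnn _))] ?; exists N.
  rewrite -(integral0 mu [set: R]).
  apply: (@dominated_cvg _ _ _ mu setT measurableT _ _ (fun x => `|u x|%:E)).
  - move=> n; apply/measurable_EFinP; apply: measurableT_comp => //.
    by apply: measurable_funB => //; exact: mp.
  - move=> x _; apply: cvg_near_cst; apply: filterS (cvg_patch u x) => n ->.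
    by rewrite subrr normr0.
  - by [].
  - exact: (integrable_abse iu).
  - move=> n x _; rewrite /= normr_id lee_fin patchE; case: ifPn => _.
      by rewrite subrr normr0.
    by rewrite subr0.
pose E : set R := `[- (N%:R : R), N%:R]; rewrite -/E in HN.
have Efin : (mu E < +oo)%E.
  by rewrite lebesgue_measure_itv/=; case: ifPn => _; rewrite ?ltry// -EFinB ltry.
have iuE : mu.-integrable E (EFin \o u) by apply: integrableS iu => //; exact: mE.
have [g_ [cg ig]] := @approximation_continuous_integrable R E u (mE _) Efin iuE.
move/(ge0_cvge0P (fun n => integral_ge0 _ (fun x _ => abse_ge0 _))) => /(_ _ e6)[K /(_ _ (leqnn _)) HK].
have mg : measurable_fun setT (g_ K) by exact: continuous_measurable_fun.
pose v := g_ K \_ E.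
have mv : measurable_fun setT v by exact: mp.
have muv : measurable_fun setT (fun x => `|u x - v x|).
  by apply: measurableT_comp => //; exact: measurable_funB.
have uv : (\int[mu]_x `|u x - v x|%:E <= (e / 6 + e / 6)%:E)%E.
  rewrite EFinD; apply: (le_trans _ (leeD HN HK)).
  rewrite [X in (_ <= _ + X)%E]integral_mkcond.
  rewrite (_ : (fun z => `|(u z - g_ K z)%:E|%E) \_ E = fun x => `|(u \_ E) x - v x|%:E).
    rewrite -intD//; last 2 first.
    - by apply: measurableT_comp => //; apply: measurable_funB => //; exact: mp.
    - by apply: measurableT_comp => //; apply: measurable_funB => //; exact: mp.
    apply: le_int => //.
      by apply: measurable_funD; apply: measurableT_comp => //; apply: measurable_funB => //; exact: mp.
    by move=> x; exact: ler_distD.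
  by apply/funext => x; rewrite /v !patchE; case: ifPn => //; rewrite subrr normr0.
have /(ge0_cvge0P (fun n => int_ge0 mu (fun x => normr_ge0 (v (x + t_ n) - v x)))) := @L1_shift_patch R (g_ K) N%:R t_ (cg K) ht.
have e3 : 0 < e / 3 by rewrite divr_gt0.
move=> /(_ _ e3)[n0 Hn0]; exists n0 => n /Hn0 {}Hn0.
have msh (f : R -> R) : measurable_fun setT f -> measurable_fun setT (fun x : R => f (x + t_ n)).
  by move=> mf; exact: (measurableT_comp mf (measurable_shift _)).
apply: (@le_trans _ _ (\int[mu]_x (`|u (x + t_ n) - v (x + t_ n)| + (`|v (x + t_ n) - v x| + `|u x - v x|))%:E)%E).
  apply: le_int => //.
  - by apply: measurableT_comp => //; apply: measurable_funB => //; exact: msh.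
  - apply: measurable_funD; first exact: (msh (fun x : R => `|u x - v x|)).
    by apply: measurable_funD => //; apply: measurableT_comp => //; apply: measurable_funB => //; exact: msh.
  - move=> x; rewrite (distrC (u x) (v x)) (le_trans (ler_distD (v (x + t_ n)) _ _))// lerD2l.
    exact: ler_distD.
have m1 : measurable_fun setT (fun x : R => `|u (x + t_ n) - v (x + t_ n)|).
  exact: (msh (fun x : R => `|u x - v x|)).
have m2 : measurable_fun setT (fun x : R => `|v (x + t_ n) - v x|).
  by apply: measurableT_comp => //; apply: measurable_funB => //; exact: msh.
rewrite intD//; last exact: measurable_funD.
rewrite intD//.
rewrite (@ge0_integral_shift R (t_ n) (fun x : R => `|u x - v x|%:E)); last 2 first.
- exact/measurable_EFinP.
- by move=> x; rewrite lee_fin.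
rewrite (_ : e = (e / 6 + e / 6) + (e / 3 + (e / 6 + e / 6))); last by field.
by rewrite (EFinD (e / 6 + e / 6)) (EFinD (e / 3)); apply: leeD => //; exact: leeD.
Qed.

End translation_L1_line.

Section translation_L1_plane.
Context {R : realType}.
Local Notation T := (measurableTypeR R * measurableTypeR R)%type.
Local Notation mu := (@lebesgue_measure R).
Implicit Types (f g : T -> R) (h : T).

Lemma measurable_fun_shift2 f h : measurable_fun setT f -> measurable_fun setT (fun z : T => f (z + h)).
Proof. by move=> mf; exact: (measurableT_comp mf (measurable_shift2 h)). Qed.

Lemma measurable_dist_shift2 f h : measurable_fun setT f ->
  measurable_fun setT (fun z : T => `|f (z + h) - f z|).
Proof.
by move=> mf; apply: measurableT_comp => //; apply: measurable_funB => //; exact: measurable_fun_shift2.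
Qed.

Lemma int_shift2 f h : measurable_fun setT f -> (forall z, 0 <= f z) ->
  (\int[leb]_z (f (z + h))%:E = \int[leb]_z (f z)%:E)%E.
Proof.
move=> mf f0; apply: (@ge0_integral_shift2 R h (EFin \o f)).
  exact/measurable_EFinP.
by move=> z; rewrite lee_fin.
Qed.

Lemma int_tonelli f : measurable_fun setT f -> (forall z, 0 <= f z) ->
  (\int[leb]_z (f z)%:E = \int[mu]_x \int[mu]_y (f (x, y))%:E)%E.
Proof.
move=> mf f0; apply: leb_tonelli; first exact/measurable_EFinP.
by move=> z; rewrite lee_fin.
Qed.

Lemma int_tonelli' f : measurable_fun setT f -> (forall z, 0 <= f z) ->
  (\int[leb]_z (f z)%:E = \int[mu]_y \int[mu]_x (f (x, y))%:E)%E.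
Proof.
move=> mf f0; apply: leb_tonelli'; first exact/measurable_EFinP.
by move=> z; rewrite lee_fin.
Qed.

Lemma measurable_int_fst f : measurable_fun setT f -> (forall z, 0 <= f z) ->
  measurable_fun [set: R] (fun y => \int[mu]_x (f (x, y))%:E)%E.
Proof.
move=> mf f0; apply: (@measurable_leb_int' _ (EFin \o f)); first exact/measurable_EFinP.
by move=> z; rewrite lee_fin.
Qed.

(** Slice by slice: for almost every y the section of [g] is integrable on the line, so the
    one-dimensional result applies; twice the integral of [|g (x, y)|] in x dominates in y. *)
Lemma L1_shift_cvg_x g (t_ : nat -> R) :
  leb.-integrable setT (EFin \o g) -> (forall n, `|t_ n| <= n.+1%:R^-1) ->
  (\int[leb]_z `|g (z + (t_ n, 0)) - g z|%:E @[n --> \oo] --> 0)%E.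
Proof.
move=> ig ht.
have mg : measurable_fun setT g by apply/measurable_EFinP; exact: measurable_int ig.
have sE n x y : g ((x, y) + (t_ n, 0)) = g (x + t_ n, y).
  by rewrite -[(x, y) + (t_ n, 0)]/(x + t_ n, y + 0) addr0.
pose F n (z : T) : R := `|g (z + (t_ n, 0)) - g z|.
have mF n : measurable_fun setT (F n) by exact: measurable_dist_shift2.
have F0 n z : 0 <= F n z by rewrite /F.
have mabs : measurable_fun setT (fun z : T => `|g z|) by exact: measurableT_comp.
have mgx y : measurable_fun setT (fun x : R => g (x, y)).
  exact: (measurableT_comp mg (measurable_pair2 _)).
under eq_fun => n do rewrite (int_tonelli' (mF n) (F0 n)).
have F_ n y : (\int[mu]_x (F n (x, y))%:E <= 2%:E * \int[mu]_x `|g (x, y)|%:E)%E.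
  have msh : measurable_fun setT (fun x : R => `|g (x + t_ n, y)|).
    by apply: measurableT_comp => //; exact: (measurableT_comp (mgx y) (measurable_shift _)).
  have ma : measurable_fun setT (fun x : R => `|g (x, y)|) by exact: measurableT_comp.
  apply: (@le_trans _ _ (\int[mu]_x (`|g (x + t_ n, y)| + `|g (x, y)|)%:E)%E).
    apply: le_int => //.
    - exact: (measurableT_comp (mF n) (measurable_pair2 _)).
    - exact: measurable_funD.
    - by move=> x; rewrite /F sE; exact: ler_normB.
  rewrite intD// (@ge0_integral_shift R (t_ n) (fun x : R => `|g (x, y)|%:E)).
  - by rewrite mule_natl mule2n.
  - exact/measurable_EFinP.
  - by move=> x; rewrite lee_fin.
have mI : measurable_fun setT (fun y => \int[mu]_x `|g (x, y)|%:E)%E.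
  exact: (measurable_int_fst mabs (fun z => normr_ge0 (g z))).
have fI : (\int[mu]_y \int[mu]_x `|g (x, y)|%:E < +oo)%E.
  by have /integrableP[_] := ig; rewrite (int_tonelli' mabs (fun z => normr_ge0 (g z))).
have F1 n y : (0 <= \int[mu]_x (F n (x, y))%:E)%E by exact: int_ge0.
have [] := @dominated_convergence _ _ _ mu setT measurableT
  (fun n y => (\int[mu]_x (F n (x, y))%:E)%E) (cst 0%E)
  (fun y => 2%:E * \int[mu]_x `|g (x, y)|%:E)%E.
- by move=> n; exact: (measurable_int_fst (mF n) (F0 n)).
- exact: measurable_cst.
- have := ae_integrable2 ig; apply: filterS => y igy _.
  have := L1_shift_cvg igy ht; rewrite /F.
  by under eq_fun do under eq_integral do rewrite -sE.
- apply: integrableZl => //; apply/integrableP; split => //.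
  by under eq_integral do rewrite gee0_abs ?int_ge0//.
- by apply: aeW => y n _; rewrite gee0_abs.
- by move=> _ _; rewrite integral0.
Qed.

Lemma measurable_swap2 : measurable_fun [set: T] (fun z : T => (z.2, z.1) : T).
Proof. apply/measurable_fun_pairP; split; [exact: measurable_snd|exact: measurable_fst]. Qed.

Lemma int_swap f : measurable_fun setT f -> (forall z, 0 <= f z) ->
  (\int[leb]_z (f (z.2, z.1))%:E = \int[leb]_z (f z)%:E)%E.
Proof.
move=> mf f0; rewrite (int_tonelli' mf f0) int_tonelli//.
exact: (measurableT_comp mf measurable_swap2).
Qed.

Lemma L1_shift_cvg_y g (t_ : nat -> R) :
  leb.-integrable setT (EFin \o g) -> (forall n, `|t_ n| <= n.+1%:R^-1) ->
  (\int[leb]_z `|g (z + (0, t_ n)) - g z|%:E @[n --> \oo] --> 0)%E.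
Proof.
move=> ig ht.
have mg : measurable_fun setT g by apply/measurable_EFinP; exact: measurable_int ig.
have ms : measurable_fun setT (fun z : T => g (z.2, z.1)) by exact: (measurableT_comp mg measurable_swap2).
have isw : leb.-integrable setT (EFin \o (fun z : T => g (z.2, z.1))).
  have /integrableP[_ fin] := ig; apply/integrableP; split; first exact/measurable_EFinP.
  rewrite /= (@int_swap (fun z => `|g z|))//; exact: measurableT_comp.
have := L1_shift_cvg_x isw ht.
rewrite (_ : (fun n => _) = (fun n => \int[leb]_z `|g (z + (0, t_ n)) - g z|%:E)%E)//.
apply/funext => n.
rewrite -(@int_swap (fun z : T => `|g (z + (0, t_ n)) - g z|))//.
exact: measurable_dist_shift2.
Qed.

(** A shift by [h] is a vertical shift followed by a horizontal one, and each is allowed e/2. *)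
Lemma L1_shift_modulus g : leb.-integrable setT (EFin \o g) ->
  forall e : R, 0 < e -> exists2 d : R, 0 < d & forall h, `|h.1| <= d -> `|h.2| <= d ->
    (\int[leb]_z `|g (z + h) - g z|%:E <= e%:E)%E.
Proof.
move=> ig e e0.
have mg : measurable_fun setT g by apply/measurable_EFinP; exact: measurable_int ig.
have e2 : 0 < e / 2 by rewrite divr_gt0.
have [d1 d10 hd1] := @seq_modulus _ (fun t => \int[leb]_z `|g (z + (t, 0)) - g z|%:E)%E (fun t_ => @L1_shift_cvg_x g t_ ig) (fun t => int_ge0 _ (fun z => normr_ge0 _)) _ e2.
have [d2 d20 hd2] := @seq_modulus _ (fun t => \int[leb]_z `|g (z + (0, t)) - g z|%:E)%E (fun t_ => @L1_shift_cvg_y g t_ ig) (fun t => int_ge0 _ (fun z => normr_ge0 _)) _ e2.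
exists (Num.min d1 d2); first by rewrite lt_min d10.
move=> h; rewrite !le_min => /andP[h1 _] /andP[_ h2].
have hE (z : T) : z + h = z + (0, h.2) + (h.1, 0).
  by case: z h {h1 h2} => x y [a b]; rewrite -addrA; congr (_ + _);
    rewrite -[(0, b) + (a, 0)]/(0 + a, b + 0) add0r addr0.
have m1 : measurable_fun setT (fun z : T => `|g (z + (0, h.2) + (h.1, 0)) - g (z + (0, h.2))|).
  exact: (measurable_fun_shift2 (0, h.2) (measurable_dist_shift2 (h.1, 0) mg)).
have m2 := measurable_dist_shift2 (0, h.2) mg.
apply: (@le_trans _ _ (\int[leb]_z (`|g (z + (0, h.2) + (h.1, 0)) - g (z + (0, h.2))| + `|g (z + (0, h.2)) - g z|)%:E)%E).
  apply: le_int => //.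
  - exact: measurable_dist_shift2.
  - exact: measurable_funD.
  - by move=> z; rewrite hE; exact: ler_distD.
rewrite intD//.
rewrite (@int_shift2 (fun z => `|g (z + (h.1, 0)) - g z|))//; last exact: measurable_dist_shift2.
by rewrite [e]splitr EFinD; apply: leeD; [exact: hd1|exact: hd2].
Qed.

Definition L2int f : \bar R := (\int[leb]_z (f z ^+ 2)%:E)%E.

Lemma L2int_ge0 f : (0 <= L2int f)%E.
Proof. by apply: int_ge0 => z; exact: sqr_ge0. Qed.

Lemma measurable_sqr f : measurable_fun setT f -> measurable_fun setT (fun z => f z ^+ 2).
Proof. by move=> mf; exact: measurable_funX. Qed.

Lemma measurable_diff_shift2 f h : measurable_fun setT f ->
  measurable_fun setT (fun z : T => f (z + h) - f z).
Proof.
by move=> mf; apply: measurable_funB => //; exact: measurable_fun_shift2.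
Qed.

(** Replaces Minkowski's inequality: squared norms stay additive under Tonelli and may be infinite,
    and the lost factor 2 only enters constants. *)
Lemma L2intD2 f g : measurable_fun setT f -> measurable_fun setT g ->
  (L2int (fun z => f z + g z)%R <= 2%:E * L2int f + 2%:E * L2int g)%E.
Proof.
move=> mf mg; have mf2 := measurable_sqr mf; have mg2 := measurable_sqr mg.
have sq2 (k : T -> R) z : 0 <= 2 * k z ^+ 2 by rewrite mulr_ge0 ?sqr_ge0.
have m2 (k : T -> R) : measurable_fun setT k -> measurable_fun setT (fun z => 2 * k z ^+ 2).
  by move=> mk; apply: measurable_funM => //; exact: measurable_sqr.
rewrite /L2int -!intZ//; [|by move=> z; exact: sqr_ge0..].
rewrite -intD//; [|exact: m2..].
apply: le_int.
- by apply: measurable_sqr; exact: measurable_funD.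
- by apply: measurable_funD; exact: m2.
- by move=> z; exact: sqr_ge0.
- by move=> z; have := sqr_ge0 (f z - g z); nra.
Qed.

Lemma L2int_shift f h : measurable_fun setT f -> L2int (fun z => f (z + h)) = L2int f.
Proof.
move=> mf; apply: (@int_shift2 (fun z => f z ^+ 2)); first exact: measurable_sqr.
by move=> z; exact: sqr_ge0.
Qed.

Lemma L2intN f : L2int (fun z => - f z) = L2int f.
Proof. by apply: eq_integral => z _; rewrite sqrrN. Qed.

Lemma L2int_diff_le f h : measurable_fun setT f ->
  (L2int (fun z => f (z + h) - f z)%R <= 4%:E * L2int f)%E.
Proof.
move=> mf; apply: (le_trans (L2intD2 (measurable_fun_shift2 h mf) (measurableT_comp (@oppr_measurable _ _) mf))).
rewrite L2int_shift// (_ : L2int (-%R \o f) = L2int f); last exact: L2intN.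
by rewrite -ge0_muleDl ?lee_fin// -EFinD; apply: lee_pmul => //; rewrite ?L2int_ge0// lee_fin; lra.
Qed.

End translation_L1_plane.

(** * Clamping of values and continuity of translations in L^2 *)

Section translation_L2.
Context {R : realType}.
Local Notation T := (measurableTypeR R * measurableTypeR R)%type.
Local Notation mu := (@lebesgue_measure R).
Implicit Types (f g : T -> R) (h : T) (t a b : R).

(** Truncation of values to [-t, t] for [t >= 0]. Being 1-Lipschitz and fixing 0, it increases
    neither the L^2 norm of a function nor the L^2 norms of its increments. *)
Definition clamp t a : R := Num.max (- t) (Num.min t a).

Lemma clamp_dist t a b : `|clamp t a - clamp t b| <= `|a - b|.
Proof.
have h1 := ler_norm (a - b); have h2 := ler_norm (b - a); rewrite distrC in h2.
rewrite /clamp !maxEle !minEle ler_norml.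
by case: (leP t a) => ?; case: (leP t b) => ?; do ?[case: ifPn; rewrite -?ltNge => ?]; apply/andP; split; lra.
Qed.

Lemma clamp_le t a : 0 <= t -> `|clamp t a| <= t.
Proof.
move=> t0; rewrite /clamp maxEle minEle ler_norml.
by case: (leP t a) => ?; case: ifPn; rewrite -?ltNge => ?; apply/andP; split; lra.
Qed.

Lemma clamp_id t a : `|a| <= t -> clamp t a = a.
Proof.
rewrite ler_norml => /andP[ta at_]; rewrite /clamp minEle maxEle.
by case: (leP t a) => ?; case: ifPn; rewrite -?ltNge => ?; lra.
Qed.

Lemma clamp0 t : 0 <= t -> clamp t 0 = 0.
Proof. by move=> t0; apply: clamp_id; rewrite normr0. Qed.

Lemma clamp_norm t a : 0 <= t -> `|clamp t a| <= `|a|.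
Proof. by move=> t0; have := clamp_dist t a 0; rewrite clamp0// !subr0. Qed.

Lemma clamp_err t a : 0 <= t -> `|a - clamp t a| <= `|a|.
Proof.
move=> t0; have h1 := ler_norm a; have h2 := ler_norm (- a); rewrite normrN in h2.
rewrite /clamp maxEle minEle ler_norml.
by case: (leP t a) => ?; case: ifPn; rewrite -?ltNge => ?; apply/andP; split; lra.
Qed.

Lemma measurable_clamp t f : measurable_fun setT f -> measurable_fun setT (fun z => clamp t (f z)).
Proof.
move=> mf; apply: measurable_maxr; first exact: measurable_cst.
by apply: measurable_minr => //; exact: measurable_cst.
Qed.

Lemma clamp_cvg a : \forall n \near \oo, clamp n%:R a = a.
Proof.
exists (Num.trunc `|a|).+1 => // n /= kn; rewrite clamp_id//.
by rewrite (le_trans (ltW (truncnS_gt _)))// ler_nat.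
Qed.

Lemma L2int_clamp_cvg f : measurable_fun setT f -> (L2int f < +oo)%E ->
  (L2int (fun z => f z - clamp n%:R (f z))%R @[n --> \oo] --> 0)%E.
Proof.
move=> mf ffin; rewrite -(integral0 leb [set: T]).
apply: (@dominated_cvg _ _ _ _ setT measurableT _ _ (fun z : T => (f z ^+ 2)%:E)).
- move=> n; apply/measurable_EFinP; apply: measurable_sqr; apply: measurable_funB => //.
  exact: measurable_clamp.
- move=> z _; apply: cvg_near_cst; apply: filterS (clamp_cvg (f z)) => n ->.
  by rewrite subrr expr0n.
- by [].
- apply/integrableP; split; first by apply/measurable_EFinP; exact: measurable_sqr.
  by under eq_integral do rewrite gee0_abs ?lee_fin ?sqr_ge0//.
- move=> n z _; rewrite gee0_abs ?lee_fin ?sqr_ge0//.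
  by rewrite -[leLHS]real_normK ?num_real// -[leRHS]real_normK ?num_real// lerXn2r ?nnegrE//; exact: clamp_err.
Qed.

(** The part removed by the clamp is small in L^2, and so are its increments. For the clamped part
    one factor of the squared increment is bounded by 2N, which leaves the L^1 modulus of [g]. *)
Lemma L2_shift_modulus g : leb.-integrable setT (EFin \o g) -> (L2int g < +oo)%E ->
  forall e : R, 0 < e -> exists2 d : R, 0 < d & forall h, `|h.1| <= d -> `|h.2| <= d ->
    (L2int (fun z => g (z + h) - g z)%R <= e%:E)%E.
Proof.
move=> ig gfin e e0.
have mg : measurable_fun setT g by apply/measurable_EFinP; exact: measurable_int ig.
have e16 : 0 < e / 16 by rewrite divr_gt0.
have /(ge0_cvge0P (fun n => L2int_ge0 _))/(_ _ e16)[n /(_ _ (leqnn _)) Hn] := L2int_clamp_cvg mg gfin.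
pose N : R := n.+1%:R; have N0 : 0 < N by rewrite ltr0n.
(* Balanced by [L2intD2]: 2 (2N) e/(8N) = e/2 for the clamped part and 2 * 4 * e/16 = e/2 for the
   remainder. *)
have [d d0 Hd] := L1_shift_modulus ig (divr_gt0 e0 (mulr_gt0 (ltr0n _ 8) N0)).
exists d => // h h1 h2.
pose gn z := clamp n%:R (g z).
have mgn : measurable_fun setT gn by exact: measurable_clamp.
have mr : measurable_fun setT (fun z => g z - gn z) by exact: measurable_funB.
have -> : L2int (fun z => g (z + h) - g z)%R = L2int (fun z => (gn (z + h) - gn z) + ((g (z + h) - gn (z + h)) - (g z - gn z))).
  by apply: eq_integral => z _; congr ((_ ^+ 2)%:E); ring.
apply: (le_trans (L2intD2 (measurable_diff_shift2 h mgn) (measurable_diff_shift2 h mr))).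
apply: (@le_trans _ _ (2%:E * (2 * N * (e / (8 * N)))%:E + 2%:E * (4%:E * (e / 16)%:E))%E); last first.
  by rewrite -!EFinM -EFinD lee_fin le_eqVlt; apply/orP; left; apply/eqP; field; rewrite gt_eqF.
apply: leeD; apply: lee_pmul => //; rewrite ?L2int_ge0//; last first.
  by apply: (le_trans (L2int_diff_le h mr)); apply: lee_pmul => //; exact: L2int_ge0.
apply: (@le_trans _ _ (\int[leb]_z (2 * N * `|g (z + h) - g z|)%:E)%E).
  apply: le_int.
  - by apply: measurable_sqr; exact: measurable_diff_shift2.
  - by apply: measurable_funM => //; exact: measurable_dist_shift2.
  - by move=> z; exact: sqr_ge0.
  - move=> z; rewrite -[leLHS]real_normK ?num_real// expr2 ler_pM//; last exact: clamp_dist.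
    have nN : n%:R <= N by rewrite ler_nat.
    rewrite (le_trans (ler_normB _ _))// (_ : 2 * N = N + N); last by ring.
    by rewrite lerD// (le_trans (clamp_le _ _)).
rewrite intZ//; [|exact: measurable_dist_shift2|by rewrite mulr_ge0// ltW].
by rewrite (EFinM (2 * N)); apply: lee_pmul => //; [rewrite lee_fin mulr_ge0// ltW|exact: int_ge0|exact: Hd].
Qed.

End translation_L2.

(** * The Poisson kernel *)

Section poisson.
Context {R : realType}.
Local Notation mu := (@lebesgue_measure R).
Implicit Types (e a x : R).

(** The integrands contain |x| and are not differentiable at 0. By symmetry only x >= 0 matters,
    where [f] agrees with the derivative [h] of a function that is smooth across 0. *)
Lemma int_even_FTC (f h F : R -> R) (l : R) : (forall x, 0 <= f x) ->
  continuous f -> (forall x, f (- x) = f x) -> (forall x, is_derive x (1 : R) F (h x)) ->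
  (forall x, 0 <= x -> f x = h x) -> F x @[x --> +oo] --> l ->
  (\int[mu]_x (f x)%:E = (2 * (l - F 0))%:E)%E.
Proof.
move=> f0 cf ef dF fh Fl; rewrite ge0_symfun_integralT//; last by move=> x; rewrite /= ef.
rewrite -set_itvcy (@ge0_continuous_FTC2y _ _ F 0 l)//.
- exact: continuous_subspaceT.
- apply: cvg_at_right_filter; apply: differentiable_continuous.
  by apply/derivable1_diffP; exact: ex_derive.
- move=> x; rewrite in_itv/= andbT => x0; rewrite derive1E fh ?ltW//.
  exact: derive_val.
Qed.

(** Transform of exp(-e|x|) at the frequency a, that is, the Poisson kernel normalised to have
    integral 2 pi. *)
Definition pois e a : R := 2 * e / (e ^+ 2 + a ^+ 2).

Lemma pois_ge0 e a : 0 <= e -> 0 <= pois e a.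
Proof. by move=> e0; rewrite /pois divr_ge0// ?mulr_ge0// addr_ge0// sqr_ge0. Qed.

Lemma pois_den e a : 0 < e -> 0 < e ^+ 2 + a ^+ 2.
Proof. by move=> e0; rewrite ltr_wpDr ?sqr_ge0// exprn_gt0. Qed.

Lemma poisN e a : pois e (- a) = pois e a.
Proof. by rewrite /pois sqrrN. Qed.

Lemma continuous_pois e : 0 < e -> continuous (pois e).
Proof.
move=> e0 x; apply: cvgM; first exact: cvg_cst.
apply: cvgV; first by rewrite gt_eqF// pois_den.
apply: cvgD; first exact: cvg_cst.
exact: exprn_continuous.
Qed.

Lemma cvgy_scale e : 0 < e -> (e * x) @[x --> +oo] --> +oo.
Proof. by move=> e0; apply: gt0_cvgMry => //; exact: cvg_id. Qed.

Lemma int_pois e : 0 < e -> (\int[mu]_x (pois e x)%:E = (2 * pi)%:E)%E.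
Proof.
move=> e0.
have dF x : is_derive x (1 : R) (fun x => 2 * atan (e^-1 * x)) (pois e x).
  have da : is_derive (e^-1 * x) (1 : R) atan (1 + (e^-1 * x) ^+ 2)^-1 := is_derive1_atan _.
  apply: is_derive_eq.
  rewrite /pois /= -![_ *: _]/(_ * _) mulr1.
  by field; rewrite !gt_eqF// ?pois_den// addrC pois_den.
rewrite (@int_even_FTC _ _ _ (2 * (pi / 2)) _ _ _ dF)//.
- by rewrite mulr0 atan0 mulr0 subr0; congr (_%:E); field.
- by move=> x; rewrite pois_ge0// ltW.
- exact: continuous_pois.
- exact: poisN.
- apply: cvgM; first exact: cvg_cst.
  apply: (cvg_comp (fun x => e^-1 * x) atan); last exact: cvgy_atan.
  by apply: cvgy_scale; rewrite invr_gt0.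
Qed.

(** The summand 1 keeps the integrand nonnegative, so that the integral up to infinity is computed
    without knowing integrability first. It contributes 2/e, and the cosine part is recovered later
    by subtraction. *)
Lemma int_exp_cos e a : 0 < e ->
  (\int[mu]_x (expR (- (e * `|x|)) * (1 + cos (a * x)))%:E = (2 / e + pois e a)%:E)%E.
Proof.
move=> e0.
(* Antiderivative on the half-line x >= 0, chosen to vanish at infinity; the integral is minus twice
   its value at 0. *)
have dF x : is_derive x (1 : R) (fun x => expR (- (e * x)) * ((a * sin (a * x) - e * cos (a * x)) / (e ^+ 2 + a ^+ 2) - e^-1)) (expR (- (e * x)) * (1 + cos (a * x))).
  apply: is_derive_eq.
  rewrite -![_ *: _]/(_ * _) !mulr1.
  by field; rewrite !gt_eqF// pois_den.
rewrite (@int_even_FTC _ _ _ 0 _ _ _ dF).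
- rewrite !mulr0 sin0 cos0 oppr0 expR0 /pois; congr (_%:E).
  by field; rewrite !gt_eqF// pois_den.
- by move=> x; rewrite mulr_ge0 ?expR_ge0//; have := cos_geN1 (a * x); lra.
- move=> x; apply: cvgM.
    apply: (cvg_comp _ expR); last exact: continuous_expR.
    apply: cvgN; apply: cvgM; first exact: cvg_cst.
    exact: norm_continuous.
  apply: cvgD; first exact: cvg_cst.
  apply: (cvg_comp _ cos); last exact: continuous_cos.
  by apply: cvgM; first exact: cvg_cst.
- by move=> x; rewrite normrN mulrN cosN.
- by move=> x x0; rewrite ger0_norm.
- pose C := (`|a| + e) / (e ^+ 2 + a ^+ 2) + e^-1.
  apply/norm_cvg0P; apply: (@squeeze_cvgr _ _ _ _ (fun=> 0) (fun x => expR (- (e * x)) * C)).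
  + near=> x; rewrite normr_ge0/= normrM ger0_norm ?expR_ge0// ler_wpM2l ?expR_ge0//.
    rewrite /C (le_trans (ler_normB _ _))// [`|e^-1|]gtr0_norm ?invr_gt0// lerD2r.
    rewrite normrM [`|_^-1|]gtr0_norm ?invr_gt0 ?pois_den//.
    apply: ler_wpM2r; first by rewrite invr_ge0 ltW ?pois_den.
    rewrite (le_trans (ler_normB _ _))//.
    rewrite !normrM [`|e|]gtr0_norm// lerD//.
      by rewrite ler_piMr// sin_max.
    by rewrite ler_piMr ?cos_max ?ltW.
  + exact: cvg_cst.
  + rewrite -(mul0r C); apply: cvgM; last exact: cvg_cst.
    apply: (cvg_comp (fun x => e * x) (fun y => expR (- y))); last exact: cvgr_expR.
    exact: cvgy_scale.
Unshelve. all: by end_near. Qed.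

Lemma int_exp e : 0 < e -> (\int[mu]_x (expR (- (e * `|x|)))%:E = (2 / e)%:E)%E.
Proof.
move=> e0; have := int_exp_cos 0 e0.
under eq_integral => x _.
  rewrite (_ : expR _ * _ = 2 * expR (- (e * `|x|))); last by rewrite mul0r cos0; ring.
  over.
have mE : measurable_fun setT (fun x => expR (- (e * `|x|))).
  apply: measurableT_comp => //; apply: measurableT_comp => //.
  by apply: measurable_funM => //; exact: measurableT_comp.
rewrite intZ//.
have := int_ge0 mu (fun x => expR_ge0 (- (e * `|x|))).
case: (integral _ _ _) => [r||]//=.
- move=> _ [] h; congr (_%:E).
  have : 2 * r = 2 * (2 / e).
    by rewrite h /pois; field; rewrite gt_eqF.
  by move/(mulfI _); apply; rewrite pnatr_eq0.
- by move=> _; rewrite gt0_muley ?lte_fin.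
Qed.

End poisson.

(** * Plancherel's identity *)

Section product_integral.
Context d1 d2 (T1 : measurableType d1) (T2 : measurableType d2) {R : realType}.
Variables (m1 : {sigma_finite_measure set T1 -> \bar R}) (m2 : {sigma_finite_measure set T2 -> \bar R}).
Implicit Types (f : T1 -> R) (g : T2 -> R).

Lemma measurable_prod_fun f g : measurable_fun setT f -> measurable_fun setT g ->
  measurable_fun setT (fun z : T1 * T2 => f z.1 * g z.2).
Proof.
move=> mf mg; apply: measurable_funM.
- exact: (measurableT_comp mf measurable_fst).
- exact: (measurableT_comp mg measurable_snd).
Qed.

Lemma integrable_prod f g : m1.-integrable setT (EFin \o f) -> m2.-integrable setT (EFin \o g) ->
  (m1 \x m2)%E.-integrable setT (EFin \o (fun z : T1 * T2 => f z.1 * g z.2)).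
Proof.
move=> /integrableP[/measurable_EFinP mf fi] /integrableP[/measurable_EFinP mg gi].
apply/integrable12ltyP; first by apply/measurable_EFinP; exact: measurable_prod_fun.
have mg' : measurable_fun setT (fun y => `|g y|) by exact: measurableT_comp.
have mf' : measurable_fun setT (fun y => `|f y|) by exact: measurableT_comp.
under eq_integral => x _.
  under eq_integral => y _ do rewrite /= normrM.
  rewrite intZ//. over.
rewrite ge0_integralZr//; [|exact/measurable_EFinP|exact: int_ge0].
apply: lte_mul_pinfty => //; first exact: int_ge0.
by rewrite ge0_fin_numE// int_ge0.
Qed.

Lemma integral_prod f g : m1.-integrable setT (EFin \o f) -> m2.-integrable setT (EFin \o g) ->
  (\int[m1 \x m2]_z (f z.1 * g z.2)%:E = (\int[m1]_x (f x)%:E) * (\int[m2]_y (g y)%:E))%E.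
Proof.
move=> fi gi; rewrite -(integral12_prod_meas1 (integrable_prod fi gi)) /fubini_F /=.
have gf : (\int[m2]_y (g y)%:E \is a fin_num)%E by exact: integrable_fin_num.
under eq_integral => x _.
  under eq_integral do rewrite EFinM.
  rewrite integralZl//= -(fineK gf). over.
by rewrite integralZr//= fineK.
Qed.

End product_integral.

Lemma norm_dot2_le {R : realDomainType} (a1 a2 b1 b2 : R) :
  `|a1| <= 1 -> `|a2| <= 1 -> `|b1| <= 1 -> `|b2| <= 1 -> `|a1 * a2 + b1 * b2| <= 2.
Proof.
move=> a1_ a2_ b1_ b2_; rewrite (le_trans (ler_normD _ _))// !normrM -[leRHS]/(1 + 1) lerD//.
  by rewrite -[leRHS]mulr1 ler_pM.
by rewrite -[leRHS]mulr1 ler_pM.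
Qed.

Section parseval.
Context d1 d2 (Z : measurableType d1) (K : measurableType d2) {R : realType}.
Variables (m : {sigma_finite_measure set Z -> \bar R}) (n : {sigma_finite_measure set K -> \bar R}).
Variables (g : Z -> R) (r : K -> R) (c s : Z -> K -> R).
Hypotheses (ig : m.-integrable setT (EFin \o g)) (ir : n.-integrable setT (EFin \o r)).
Hypotheses (mc : measurable_fun setT (fun w : Z * K => c w.1 w.2))
  (ms : measurable_fun setT (fun w : Z * K => s w.1 w.2)).
Hypotheses (c1 : forall z k, `|c z k| <= 1) (s1 : forall z k, `|s z k| <= 1).

(** The common integrand: integrating out [K] leaves a double integral over pairs of points,
    integrating out the pair leaves the weighted sum of squares. *)
Let H (w : (Z * Z) * K) : R :=
  g w.1.1 * g w.1.2 * r w.2 * (c w.1.1 w.2 * c w.1.2 w.2 + s w.1.1 w.2 * s w.1.2 w.2).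

Let mg : measurable_fun setT g.
Proof. by apply/measurable_EFinP; exact: measurable_int ig. Qed.

Let mr : measurable_fun setT r.
Proof. by apply/measurable_EFinP; exact: measurable_int ir. Qed.

Let p1 : measurable_fun setT (fun w : (Z * Z) * K => (w.1.1, w.2)).
Proof.
by apply/measurable_fun_pairP; split; [exact: (measurableT_comp measurable_fst measurable_fst)|exact: measurable_snd].
Qed.

Let p2 : measurable_fun setT (fun w : (Z * Z) * K => (w.1.2, w.2)).
Proof.
by apply/measurable_fun_pairP; split; [exact: (measurableT_comp measurable_snd measurable_fst)|exact: measurable_snd].
Qed.

Let mc1 := measurableT_comp mc p1.
Let mc2 := measurableT_comp mc p2.
Let ms1 := measurableT_comp ms p1.
Let ms2 := measurableT_comp ms p2.

Let ggr : ((prodm m m) \x n)%E.-integrable setT (EFin \o (fun w => g w.1.1 * g w.1.2 * r w.2)).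
Proof. exact: (@integrable_prod _ _ _ _ _ (prodm m m) n (fun z => g z.1 * g z.2) r (integrable_prod ig ig) ir). Qed.

Let mH : measurable_fun setT H.
Proof.
apply: measurable_funM; first by apply/measurable_EFinP; exact: measurable_int ggr.
by apply: measurable_funD; apply: measurable_funM.
Qed.

Let iH : ((prodm m m) \x n)%E.-integrable setT (EFin \o H).
Proof.
apply: (@le_integrable _ _ _ _ _ _ _ (fun w => 2%:E * (g w.1.1 * g w.1.2 * r w.2)%:E)%E) => //.
- exact/measurable_EFinP.
- move=> w _; rewrite -EFinM /H [in leRHS]mulrC !abse_EFin lee_fin normrM [leRHS]normrM ler_wpM2l//.
  by rewrite [leRHS]ger0_norm// norm_dot2_le.
- exact: integrableZl ggr.
Qed.

(** Each square of an integral is a double integral over (z, z'), and Fubini exchanges it with the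
    integral in k. The integrable weight [r] is what makes this legitimate: [H] is dominated by 2 |g
    g r|. *)
Lemma parseval_fubini :
  (\int[n]_k (r k * ((fine (\int[m]_z (g z * c z k)%:E)) ^+ 2 + (fine (\int[m]_z (g z * s z k)%:E)) ^+ 2))%:E =
   \int[prodm m m]_w (g w.1 * g w.2 * fine (\int[n]_k (r k * (c w.1 k * c w.2 k + s w.1 k * s w.2 k))%:E))%:E)%E
  /\ (prodm m m).-integrable setT (fun w => (g w.1 * g w.2 * fine (\int[n]_k (r k * (c w.1 k * c w.2 k + s w.1 k * s w.2 k))%:E))%:E).
Proof.
have mcz z : measurable_fun setT (c z) by exact: (measurableT_comp mc (measurable_pair1 z)).
have msz z : measurable_fun setT (s z) by exact: (measurableT_comp ms (measurable_pair1 z)).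
have mck k : measurable_fun setT (c^~ k) by exact: (measurableT_comp mc (measurable_pair2 k)).
have msk k : measurable_fun setT (s^~ k) by exact: (measurableT_comp ms (measurable_pair2 k)).
have iV z z' : n.-integrable setT (EFin \o (fun k => r k * (c z k * c z' k + s z k * s z' k))).
  apply: (@le_integrable _ _ _ _ _ _ _ (fun k => 2%:E * (r k)%:E)%E) => //.
  - apply/measurable_EFinP; apply: measurable_funM => //.
    by apply: measurable_funD; apply: measurable_funM.
  - by move=> k _; rewrite -EFinM [in leRHS]mulrC !abse_EFin lee_fin normrM [leRHS]normrM ler_wpM2l// [leRHS]ger0_norm// norm_dot2_le.
  - exact: integrableZl ir.
have iG (a : Z -> K -> R) k : (forall k, measurable_fun setT (a^~ k)) -> (forall z k, `|a z k| <= 1) ->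
    m.-integrable setT (EFin \o (fun z => g z * a z k)).
  move=> ma a1; apply: (@le_integrable _ _ _ _ _ _ _ (EFin \o g)) => //.
  - by apply/measurable_EFinP; apply: measurable_funM => //; exact: ma.
  - by move=> z _; rewrite /= lee_fin normrM ler_piMr.
have FE w : fubini_F n (EFin \o H) w =
    (g w.1 * g w.2 * fine (\int[n]_k (r k * (c w.1 k * c w.2 k + s w.1 k * s w.2 k))%:E))%:E.
  rewrite /fubini_F /H /=; under eq_integral do rewrite -mulrA EFinM.
  rewrite integralZl//; last exact: iV.
  by rewrite [in RHS]EFinM fineK//; apply: integrable_fin_num => //; exact: iV.
have GE k : fubini_G (prodm m m) (EFin \o H) k =
    (r k * ((fine (\int[m]_z (g z * c z k)%:E)) ^+ 2 + (fine (\int[m]_z (g z * s z k)%:E)) ^+ 2))%:E.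
  have ic := iG c k mck c1; have is_ := iG s k msk s1.
  rewrite /fubini_G /H /=.
  under eq_integral => w _.
    rewrite (_ : _ * _ = r k * (((g w.1 * c w.1 k) * (g w.2 * c w.2 k)) + ((g w.1 * s w.1 k) * (g w.2 * s w.2 k)))); last by ring.
    rewrite EFinM EFinD. over.
  have icc := integrable_prod ic ic; have iss := integrable_prod is_ is_.
  rewrite integralZl//; last exact: (integrableD measurableT icc iss).
  rewrite (integralD measurableT icc iss) (integral_prod ic ic) (integral_prod is_ is_).
  rewrite [RHS]EFinM EFinD !expr2 !EFinM !fineK//; exact: integrable_fin_num.
split.
  under eq_integral do rewrite -GE; under [RHS]eq_integral do rewrite -FE.
  by rewrite (integral21_prod_meas1 iH) (integral12_prod_meas1 iH).
apply: (eq_integrable measurableT (fubini_F n (EFin \o H))); first by move=> w _; rewrite FE.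
exact: integrable_fubini_F.
Qed.

End parseval.

Section exponential_weight.
Context {R : realType}.
Local Notation T := (measurableTypeR R * measurableTypeR R)%type.
Local Notation mu := (@lebesgue_measure R).
Implicit Types (e a x : R) (z k h : T).

Lemma ge0_integral_opp (f : R -> \bar R) : measurable_fun setT f -> (forall x, 0 <= f x)%E ->
  (\int[mu]_x f (- x)%R = \int[mu]_x f x)%E.
Proof.
move=> mf f0.
have mN : measurable_fun setT (-%R : measurableTypeR R -> measurableTypeR R) by exact: oppr_measurable.
rewrite -[LHS]/(\int[mu]_(x in (-%R : _ -> measurableTypeR R) @^-1` setT) (f \o -%R%R) x)%E.
rewrite -ge0_integral_pushforward//=.
by apply: eq_measure_integral => A mA AS; exact/lebesgue_measureN.
Qed.

Lemma integral_opp (f : R -> \bar R) : measurable_fun setT f ->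
  (\int[mu]_x f (- x)%R = \int[mu]_x f x)%E.
Proof.
move=> mf; rewrite integralE [RHS]integralE; congr (_ - _)%E.
- transitivity (\int[mu]_x f^\+ (- x)%R)%E; first by apply: eq_integral => x _; rewrite !funeposE.
  by apply: ge0_integral_opp; [exact: measurable_funepos|move=> x; exact: funepos_ge0].
- transitivity (\int[mu]_x f^\- (- x)%R)%E; first by apply: eq_integral => x _; rewrite !funenegE.
  by apply: ge0_integral_opp; [exact: measurable_funeneg|move=> x; exact: funeneg_ge0].
Qed.

Definition expabs e x : R := expR (- (e * `|x|)).

Lemma measurable_expabs e : measurable_fun [set: R] (expabs e).
Proof.
apply: measurableT_comp => //; apply: measurableT_comp => //.
by apply: measurable_funM => //; exact: measurableT_comp.
Qed.

Lemma integrable_expabs e : 0 < e -> mu.-integrable setT (EFin \o expabs e).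
Proof.
move=> e0; apply/integrableP; split; first by apply/measurable_EFinP; exact: measurable_expabs.
by under eq_integral do rewrite /= ger0_norm ?expR_ge0//; rewrite int_exp// ltry.
Qed.

Lemma measurable_cosM a : measurable_fun [set: R] (fun x => cos (a * x)).
Proof.
apply: continuous_measurable_fun => x; apply: (cvg_comp _ cos); last exact: continuous_cos.
by apply: cvgM; [exact: cvg_cst|exact: cvg_id].
Qed.

Lemma measurable_sinM a : measurable_fun [set: R] (fun x => sin (a * x)).
Proof.
apply: continuous_measurable_fun => x; apply: (cvg_comp _ sin); last exact: continuous_sin.
by apply: cvgM; [exact: cvg_cst|exact: cvg_id].
Qed.

Lemma integrable_expabsM e (f : R -> R) : 0 < e -> measurable_fun setT f -> (forall x, `|f x| <= 1) ->
  mu.-integrable setT (EFin \o (fun x => expabs e x * f x)).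
Proof.
move=> e0 mf f1; apply: (@le_integrable _ _ R mu setT measurableT _ (EFin \o expabs e)) => //.
- by apply/measurable_EFinP; apply: measurable_funM => //; exact: measurable_expabs.
- by move=> x _; rewrite /= lee_fin normrM ler_piMr.
- exact: integrable_expabs.
Qed.

Lemma int_expabs_cos e a : 0 < e -> (\int[mu]_x (expabs e x * cos (a * x))%:E = (pois e a)%:E)%E.
Proof.
move=> e0; have := int_exp_cos a e0.
under eq_integral do rewrite mulrDr mulr1 EFinD.
have i1 := integrable_expabs e0.
have i2 := integrable_expabsM e0 (measurable_cosM a) (fun x => cos_max _).
rewrite (integralD measurableT i1 i2) int_exp//.
have /fineK <- : (\int[mu]_x (expabs e x * cos (a * x))%:E \is a fin_num)%E by exact: integrable_fin_num i2.
by rewrite -EFinD => -[] /addrI ->.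
Qed.

Lemma int_expabs_sin e a : 0 < e -> (\int[mu]_x (expabs e x * sin (a * x))%:E = 0)%E.
Proof.
move=> e0; have i2 := integrable_expabsM e0 (measurable_sinM a) (fun x => sin_max _).
have := @integral_opp (fun x => (expabs e x * sin (a * x))%:E) (measurable_int _ i2).
under eq_integral => x _ do rewrite /expabs normrN mulrN sinN mulrN EFinN.
rewrite integralN/=; last exact: integrable_add_def.
have /fineK <- : (\int[mu]_x (expabs e x * sin (a * x))%:E \is a fin_num)%E by exact: integrable_fin_num i2.
by move=> [] h; congr (_%:E); lra.
Qed.

Definition dot z k : R := z.1 * k.1 + z.2 * k.2.

Lemma dotBl z z' k : dot (z - z') k = dot z k - dot z' k.
Proof. by rewrite /dot /=; ring. Qed.

Lemma measurable_dot : measurable_fun setT (fun w : T * T => dot w.1 w.2).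
Proof.
have p (D : T -> R) : measurable_fun setT D -> measurable_fun setT (fun w : T * T => D w.1) /\ measurable_fun setT (fun w : T * T => D w.2).
  by move=> mD; split; [exact: (measurableT_comp mD measurable_fst)|exact: (measurableT_comp mD measurable_snd)].
have [a1 a2] := p fst measurable_fst; have [b1 b2] := p snd measurable_snd.
by apply: measurable_funD; apply: measurable_funM.
Qed.

Lemma measurable_cos_dot : measurable_fun setT (fun w : T * T => cos (dot w.1 w.2)).
Proof.
apply: (@measurableT_comp _ _ _ _ _ _ (cos : R -> R)); last exact: measurable_dot.
exact: continuous_measurable_fun (@continuous_cos R).
Qed.

Lemma measurable_sin_dot : measurable_fun setT (fun w : T * T => sin (dot w.1 w.2)).
Proof.
apply: (@measurableT_comp _ _ _ _ _ _ (sin : R -> R)); last exact: measurable_dot.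
exact: continuous_measurable_fun (@continuous_sin R).
Qed.

Definition rho e k : R := expabs e k.1 * expabs e k.2.

Definition pois2 e h : R := pois e h.1 * pois e h.2.

Lemma rho_ge0 e k : 0 <= rho e k.
Proof. by rewrite /rho mulr_ge0// expR_ge0. Qed.

Lemma measurable_rho e : measurable_fun setT (rho e).
Proof. by apply: measurable_prod_fun; exact: measurable_expabs. Qed.

Lemma integrable_rho e : 0 < e -> leb.-integrable setT (EFin \o rho e).
Proof. by move=> e0; apply: integrable_prod; exact: integrable_expabs. Qed.

(** The addition formula splits the integral into products of one-dimensional ones; the product of
    the sine integrals vanishes by oddness. *)
Lemma int_rho_cos e h : 0 < e -> (\int[leb]_k (rho e k * cos (dot h k))%:E = (pois2 e h)%:E)%E.
Proof.
move=> e0.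
have ic b := integrable_expabsM e0 (measurable_cosM b) (fun x => cos_max _).
have is_ b := integrable_expabsM e0 (measurable_sinM b) (fun x => sin_max _).
under eq_integral => k _.
  rewrite /dot cosD (_ : _ * _ = (expabs e k.1 * cos (h.1 * k.1)) * (expabs e k.2 * cos (h.2 * k.2))
     - (expabs e k.1 * sin (h.1 * k.1)) * (expabs e k.2 * sin (h.2 * k.2))); last by rewrite /rho; ring.
  rewrite EFinB. over.
rewrite (integralB measurableT (integrable_prod (ic _) (ic _)) (integrable_prod (is_ _) (is_ _))).
rewrite (integral_prod (ic _) (ic _)) (integral_prod (is_ _) (is_ _)).
by rewrite !int_expabs_cos// !int_expabs_sin// mul0e sube0.
Qed.

Lemma pois2_ge0 e h : 0 < e -> 0 <= pois2 e h.
Proof. by move=> e0; rewrite /pois2 mulr_ge0// pois_ge0// ltW. Qed.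

Lemma pois2N e h : pois2 e (- h) = pois2 e h.
Proof. by rewrite /pois2 /= !poisN. Qed.

Lemma measurable_pois e : 0 < e -> measurable_fun [set: R] (pois e).
Proof. by move=> e0; apply: continuous_measurable_fun; exact: continuous_pois. Qed.

Lemma measurable_pois2 e : 0 < e -> measurable_fun setT (pois2 e).
Proof. by move=> e0; apply: measurable_prod_fun; exact: measurable_pois. Qed.

Lemma integrable_pois e : 0 < e -> mu.-integrable setT (EFin \o pois e).
Proof.
move=> e0; apply/integrableP; split; first by apply/measurable_EFinP; exact: measurable_pois.
by under eq_integral do rewrite /= ger0_norm ?pois_ge0 ?ltW//; rewrite int_pois// ltry.
Qed.

Lemma int_pois_prod e e' : 0 < e -> 0 < e' ->
  (\int[leb]_h (pois e h.1 * pois e' h.2)%:E = ((2 * pi) ^+ 2)%:E)%E.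
Proof.
move=> e0 e'0; rewrite (integral_prod (integrable_pois e0) (integrable_pois e'0)).
by rewrite !int_pois// -EFinM.
Qed.

End exponential_weight.

(** * Parseval's identity with an exponential weight *)

Section parseval_poisson.
Context {R : realType}.
Local Notation T := (measurableTypeR R * measurableTypeR R)%type.
Implicit Types (e : R) (z k h : T) (g : T -> R).

(** For real integrable [g] the transform is [fcos g - i fsin g], so [fsq g] is its squared modulus;
    [fine] is applied to finite integrals only. *)
Definition fcos g k : R := fine (\int[leb]_z (g z * cos (dot z k))%:E)%E.
Definition fsin g k : R := fine (\int[leb]_z (g z * sin (dot z k))%:E)%E.
Definition fsq g k : R := fcos g k ^+ 2 + fsin g k ^+ 2.

(** Total mass of [pois2 e], hence the constant of Plancherel's identity for the transform without
    prefactor. *)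
Definition pi2 : R := (2 * pi) ^+ 2.

Lemma pi2_gt0 : 0 < pi2.
Proof. by rewrite /pi2 exprn_gt0// mulr_gt0// pi_gt0. Qed.

Lemma fsq_ge0 g k : 0 <= fsq g k.
Proof. by rewrite /fsq addr_ge0// sqr_ge0. Qed.

Lemma shift_pois2 e z : 0 < e -> (\int[leb]_z' (pois2 e (z - z'))%:E = pi2%:E)%E.
Proof.
move=> e0; transitivity (\int[leb]_z' (pois2 e (z' - z))%:E)%E.
  by apply: eq_integral => z' _; rewrite -pois2N opprB.
rewrite (int_shift2 (- z) (measurable_pois2 e0) (fun h => pois2_ge0 h e0)).
exact: int_pois_prod.
Qed.

Lemma shift_pois2' e z' : 0 < e -> (\int[leb]_z (pois2 e (z - z'))%:E = pi2%:E)%E.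
Proof.
move=> e0; rewrite (int_shift2 (- z') (measurable_pois2 e0) (fun h => pois2_ge0 h e0)).
exact: int_pois_prod.
Qed.

Lemma measurable_sub2 : measurable_fun setT (fun w : T * T => (w.1 - w.2 : T)).
Proof.
have a1 := measurableT_comp (@measurable_fst _ _ (measurableTypeR R) (measurableTypeR R)) (@measurable_fst _ _ T T).
have a2 := measurableT_comp (@measurable_snd _ _ (measurableTypeR R) (measurableTypeR R)) (@measurable_fst _ _ T T).
have b1 := measurableT_comp (@measurable_fst _ _ (measurableTypeR R) (measurableTypeR R)) (@measurable_snd _ _ T T).
have b2 := measurableT_comp (@measurable_snd _ _ (measurableTypeR R) (measurableTypeR R)) (@measurable_snd _ _ T T).
apply/measurable_fun_pairP; split.
- exact: (measurable_funB a1 b1).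
- exact: (measurable_funB a2 b2).
Qed.

Lemma measurable_add2 : measurable_fun setT (fun w : T * T => (w.1 + w.2 : T)).
Proof.
have a1 := measurableT_comp (@measurable_fst _ _ (measurableTypeR R) (measurableTypeR R)) (@measurable_fst _ _ T T).
have a2 := measurableT_comp (@measurable_snd _ _ (measurableTypeR R) (measurableTypeR R)) (@measurable_fst _ _ T T).
have b1 := measurableT_comp (@measurable_fst _ _ (measurableTypeR R) (measurableTypeR R)) (@measurable_snd _ _ T T).
have b2 := measurableT_comp (@measurable_snd _ _ (measurableTypeR R) (measurableTypeR R)) (@measurable_snd _ _ T T).
apply/measurable_fun_pairP; split.
- exact: (measurable_funD a1 b1).
- exact: (measurable_funD a2 b2).
Qed.

Lemma measurable_L2int_diff g : measurable_fun setT g ->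
  measurable_fun [set: T] (fun h => L2int (fun z => g (z + h) - g z)).
Proof.
move=> mg; apply: (@measurable_fun_fubini_tonelli_G _ _ _ _ _ leb (fun w : T * T => ((g (w.1 + w.2) - g w.1) ^+ 2)%:E)).
  apply/measurable_EFinP; apply: measurable_funX; apply: measurable_funB.
    exact: (measurableT_comp mg measurable_add2).
  exact: (measurableT_comp mg measurable_fst).
by move=> w; rewrite lee_fin sqr_ge0.
Qed.

Lemma int_tonelli2 (f : T * T -> R) : measurable_fun setT f -> (forall w, 0 <= f w) ->
  (\int[prodm leb leb]_w (f w)%:E = \int[leb]_z \int[leb]_z' (f (z, z'))%:E)%E.
Proof.
move=> mf f0; apply: (@fubini_tonelli1 _ _ _ _ _ leb leb (EFin \o f)); first exact/measurable_EFinP.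
by move=> z; rewrite lee_fin.
Qed.

Lemma int_tonelli2' (f : T * T -> R) : measurable_fun setT f -> (forall w, 0 <= f w) ->
  (\int[prodm leb leb]_w (f w)%:E = \int[leb]_z' \int[leb]_z (f (z, z'))%:E)%E.
Proof.
move=> mf f0; apply: (@fubini_tonelli2 _ _ _ _ _ leb leb (EFin \o f)); first exact/measurable_EFinP.
by move=> z; rewrite lee_fin.
Qed.

(** The identity 2 g(z) g(z') + (g(z) - g(z'))^2 = g(z)^2 + g(z')^2 integrated against
    [pois2 e (z - z')]. By [parseval_fubini] the first term is the weighted integral of [fsq g];
    each square on the right contributes [pi2 * L2int g]. It is written without subtraction so that
    it makes sense before finiteness is known. *)
Lemma parseval_pois e g : 0 < e -> leb.-integrable setT (EFin \o g) -> (L2int g < +oo)%E ->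
  (2%:E * \int[leb]_k (rho e k * fsq g k)%:E +
    \int[leb]_h ((pois2 e h)%:E * L2int (fun z => g (z + h) - g z)%R) = 2%:E * (pi2%:E * L2int g))%E.
Proof.
move=> e0 ig gfin.
have mg : measurable_fun setT g by apply/measurable_EFinP; exact: measurable_int ig.
pose P (w : T * T) := pois2 e (w.1 - w.2).
have mP : measurable_fun setT P by exact: (measurableT_comp (measurable_pois2 e0) measurable_sub2).
have P0 w : 0 <= P w by exact: pois2_ge0.
have mg1 : measurable_fun setT (fun w : T * T => g w.1) by exact: (measurableT_comp mg measurable_fst).
have mg2 : measurable_fun setT (fun w : T * T => g w.2) by exact: (measurableT_comp mg measurable_snd).
have [E iX] := @parseval_fubini _ _ T T R leb leb g (rho e) (fun z k => cos (dot z k)) (fun z k => sin (dot z k))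
  ig (integrable_rho e0) measurable_cos_dot measurable_sin_dot (fun z k => cos_max _) (fun z k => sin_max _).
have WE w : fine (\int[leb]_k (rho e k * (cos (dot w.1 k) * cos (dot w.2 k) + sin (dot w.1 k) * sin (dot w.2 k)))%:E)%E = P w.
  by under eq_integral do rewrite -cosB -dotBl; rewrite int_rho_cos.
pose X (w : T * T) : R := g w.1 * g w.2 * P w.
have {}iX : (prodm leb leb).-integrable setT (EFin \o X).
  by move: iX; under eq_fun do rewrite WE.
have {E} -> : (\int[leb]_k (rho e k * fsq g k)%:E = \int[prodm leb leb]_w (X w)%:E)%E.
  by rewrite E; apply: eq_integral => w _; rewrite WE.
have gfin' : (L2int g \is a fin_num)%E by rewrite ge0_fin_numE// L2int_ge0.
have mg2sq : measurable_fun setT (fun z => g z ^+ 2) by exact: measurable_sqr.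
pose A1 (w : T * T) := g w.1 ^+ 2 * P w; pose A2 (w : T * T) := g w.2 ^+ 2 * P w.
have mA1 : measurable_fun setT A1 by apply: measurable_funM => //; exact: measurable_funX.
have mA2 : measurable_fun setT A2 by apply: measurable_funM => //; exact: measurable_funX.
have A10 w : 0 <= A1 w by rewrite mulr_ge0// sqr_ge0.
have A20 w : 0 <= A2 w by rewrite mulr_ge0// sqr_ge0.
have mPz z : measurable_fun setT (fun z' : T => P (z, z')) by exact: (measurableT_comp mP (measurable_pair1 z)).
have mPz' z' : measurable_fun setT (fun z : T => P (z, z')) by exact: (measurableT_comp mP (measurable_pair2 z')).
have intA1 : (\int[prodm leb leb]_w (A1 w)%:E = pi2%:E * L2int g)%E.
  rewrite int_tonelli2//; transitivity (\int[leb]_z (pi2%:E * (g z ^+ 2)%:E))%E.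
    apply: eq_integral => z _; apply: etrans (intZ leb (mPz z) (sqr_ge0 (g z)) (fun z' => P0 (z, z'))) _.
    by rewrite shift_pois2// muleC.
  rewrite ge0_integralZl//; [exact/measurable_EFinP|by move=> z _; rewrite lee_fin sqr_ge0|by rewrite lee_fin ltW// pi2_gt0].
have intA2 : (\int[prodm leb leb]_w (A2 w)%:E = pi2%:E * L2int g)%E.
  rewrite int_tonelli2'//; transitivity (\int[leb]_z (pi2%:E * (g z ^+ 2)%:E))%E.
    apply: eq_integral => z _; apply: etrans (intZ leb (mPz' z) (sqr_ge0 (g z)) (fun z' => P0 (z', z))) _.
    by rewrite shift_pois2'// muleC.
  rewrite ge0_integralZl//; [exact/measurable_EFinP|by move=> z _; rewrite lee_fin sqr_ge0|by rewrite lee_fin ltW// pi2_gt0].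
have iA (A : T * T -> R) : measurable_fun setT A -> (forall w, 0 <= A w) ->
    (\int[prodm leb leb]_w (A w)%:E = pi2%:E * L2int g)%E -> (prodm leb leb).-integrable setT (EFin \o A).
  move=> mA A0 AE; apply/integrableP; split; first exact/measurable_EFinP.
  under eq_integral do rewrite gee0_abs ?lee_fin//.
  by rewrite AE lte_mul_pinfty// ?lee_fin ?ltW// pi2_gt0.
have iA1 := iA A1 mA1 A10 intA1; have iA2 := iA A2 mA2 A20 intA2.
(* Substitution [w.1 = z + h], [w.2 = z], done by Tonelli and translation invariance in the inner
   variable. *)
have -> : (\int[leb]_h ((pois2 e h)%:E * L2int (fun z => g (z + h) - g z)%R) =
   \int[prodm leb leb]_w ((g w.1 - g w.2) ^+ 2 * P w)%:E)%E.
  pose D (w : T * T) := (g w.1 - g w.2) ^+ 2 * P w.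
  have mD : measurable_fun setT D.
    by apply: measurable_funM => //; apply: measurable_funX; exact: measurable_funB.
  have D0 w : 0 <= D w by rewrite mulr_ge0// sqr_ge0.
  rewrite (int_tonelli2' mD D0).
  pose E (w : T * T) := pois2 e w.1 * (g (w.2 + w.1) - g w.2) ^+ 2.
  have mE : measurable_fun setT E.
    apply: measurable_funM; first exact: (measurableT_comp (measurable_pois2 e0) measurable_fst).
    apply: measurable_funX; apply: measurable_funB => //.
    apply: (measurableT_comp mg).
    rewrite (_ : (fun w : T * T => w.2 + w.1) = (fun w : T * T => w.1 + w.2)); first exact: measurable_add2.
    by apply/funext => w; rewrite addrC.
  have E0 w : 0 <= E w by rewrite mulr_ge0 ?pois2_ge0 ?sqr_ge0.
  transitivity (\int[leb]_h \int[leb]_z (E (h, z))%:E)%E.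
    apply: eq_integral => h _; rewrite -intZ//; [|exact: pois2_ge0|by move=> z; exact: sqr_ge0].
    by apply: measurable_sqr; exact: measurable_diff_shift2.
  rewrite -(int_tonelli2 mE E0) (int_tonelli2' mE E0); apply: eq_integral => z _.
  rewrite -(int_shift2 z (measurableT_comp mD (measurable_pair2 z)) (fun w => D0 (w, z))).
  apply: eq_integral => h _; rewrite /D /E /P /=; congr (_%:E).
  by rewrite addrK [h + z]addrC mulrC.
have -> : (\int[prodm leb leb]_w ((g w.1 - g w.2) ^+ 2 * P w)%:E =
   \int[prodm leb leb]_w ((A1 w)%:E + (A2 w)%:E - 2%:E * (X w)%:E))%E.
  apply: eq_integral => w _; transitivity ((A1 w + A2 w - 2 * X w)%:E); last by [].
  by congr (_%:E); rewrite /A1 /A2 /X; ring.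
rewrite (integralB measurableT (integrableD measurableT iA1 iA2) (integrableZl measurableT 2 iX)).
rewrite (integralD measurableT iA1 iA2) intA1 intA2 (integralZl measurableT iX).
have Xfin : (\int[prodm leb leb]_w (X w)%:E \is a fin_num)%E by exact: integrable_fin_num iX.
rewrite /= -(fineK Xfin) -(fineK gfin').
set x := fine _; set y := fine _.
transitivity ((2 * x + (pi2 * y + pi2 * y - 2 * x))%:E); first by [].
by rewrite -!EFinM; congr (_%:E); ring.
Qed.

End parseval_poisson.

Ltac pos := repeat first [done | exact: pi_gt0 | exact: sqr_ge0 | apply: mulr_gt0 | apply: mulr_ge0
  | rewrite invr_gt0 | rewrite invr_ge0 | apply: exprn_gt0 | apply: ltW].

Section fatou_bound.
Context d (T : measurableType d) {R : realType} (mu : {measure set T -> \bar R}).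

(** Removes the regularisations used below: the exponential weight, the restriction to boxes and the
    clamp. The available bounds may hold only from some index on and up to an error, so Fatou is
    applied to the sequence shifted by [N]. *)
Lemma fatou_bound (f_ : nat -> T -> R) (f : T -> R) (C : \bar R) :
  (forall n, measurable_fun setT (f_ n)) -> (forall n x, 0 <= f_ n x) ->
  (forall x, f_ n x @[n --> \oo] --> f x) ->
  (forall e : R, 0 < e -> exists N, forall n, (N <= n)%N -> (\int[mu]_x (f_ n x)%:E <= C + e%:E)%E) ->
  (\int[mu]_x (f x)%:E <= C)%E.
Proof.
move=> mf f0 ff fC; apply/lee_addgt0Pr => e e0; have [N HN] := fC e e0.
have mg n : measurable_fun setT (fun x => (f_ (n + N)%N x)%:E) by exact/measurable_EFinP.
have := fatou mu measurableT mg (fun n x _ => f0 _ x).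
rewrite (_ : (\int[mu]_x limn_einf _ = \int[mu]_x (f x)%:E)%E); last first.
  apply: eq_integral => x _.
  have h : ((f_ (n + N)%N x)%:E @[n --> \oo] --> (f x)%:E)%E.
    apply: cvg_EFin; first by apply: nearW.
    by have := ff x; rewrite -(cvg_shiftn N).
  have [-> _] := cvg_limn_einf_sup h; by [].
move/le_trans; apply; rewrite limn_einf_lim; apply: lime_le; first exact: is_cvg_einfs.
apply: nearW => n; apply: (le_trans _ (HN (n + N)%N (leq_addl _ _))).
by apply: ereal_inf_lbound; exists n => /=.
Qed.

End fatou_bound.

Section poisson_limit.
Context {R : realType}.
Local Notation T := (measurableTypeR R * measurableTypeR R)%type.
Implicit Types (e : R) (z k h : T) (g : T -> R).

Lemma measurable_param_ge0_int (f : T * T -> \bar R) : measurable_fun setT f -> (forall w, 0 <= f w)%E ->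
  measurable_fun setT (fun k => \int[leb]_z f (z, k))%E.
Proof. by move=> mf f0; apply: (@measurable_fun_fubini_tonelli_G _ _ _ _ _ leb f). Qed.

Lemma measurable_param_int (H : T * T -> R) : measurable_fun setT H ->
  measurable_fun setT (fun k => \int[leb]_z (H (z, k))%:E)%E.
Proof.
move=> mH; have mE : measurable_fun setT (EFin \o H) by exact/measurable_EFinP.
rewrite (_ : (fun k => _) = (fun k => (\int[leb]_z (EFin \o H)^\+ (z, k)) - (\int[leb]_z (EFin \o H)^\- (z, k)))%E).
  apply: emeasurable_funB; apply: measurable_param_ge0_int.
  - exact: measurable_funepos.
  - by move=> w; exact: funepos_ge0.
  - exact: measurable_funeneg.
  - by move=> w; exact: funeneg_ge0.
apply/funext => k; rewrite [LHS]integralE; congr (_ - _)%E; apply: eq_integral => z _.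
- by rewrite !funeposE.
- by rewrite !funenegE.
Qed.

Lemma measurable_fcos g : measurable_fun setT g -> measurable_fun setT (fcos g).
Proof.
move=> mg; apply: (measurableT_comp (fine_measurable measurableT)).
apply: (@measurable_param_int (fun w => g w.1 * cos (dot w.1 w.2))).
by apply: measurable_funM; [exact: (measurableT_comp mg measurable_fst)|exact: measurable_cos_dot].
Qed.

Lemma measurable_fsin g : measurable_fun setT g -> measurable_fun setT (fsin g).
Proof.
move=> mg; apply: (measurableT_comp (fine_measurable measurableT)).
apply: (@measurable_param_int (fun w => g w.1 * sin (dot w.1 w.2))).
by apply: measurable_funM; [exact: (measurableT_comp mg measurable_fst)|exact: measurable_sin_dot].
Qed.

Lemma measurable_fsq g : measurable_fun setT g -> measurable_fun setT (fsq g).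
Proof.
move=> mg; apply: measurable_funD; apply: measurable_sqr; [exact: measurable_fcos|exact: measurable_fsin].
Qed.

(** For |t| >= d one has d^2 + t^2 <= 2 t^2. The tail of the narrow kernel is thus a small multiple
    of a fixed kernel whose integral is already known. *)
Lemma pois_tail e d (t : R) : 0 < e -> 0 < d -> d <= `|t| -> pois e t <= 2 * e / d * pois d t.
Proof.
move=> e0 d0 dt; have dt2 : d ^+ 2 <= t ^+ 2.
  by rewrite -[t ^+ 2]real_normK ?num_real// lerXn2r// nnegrE ltW.
rewrite /pois [leRHS](_ : _ = 2 * e * (2 / (d ^+ 2 + t ^+ 2))); last first.
  by field; rewrite !gt_eqF// pois_den.
apply: ler_wpM2l; first by rewrite mulr_ge0// ltW.
rewrite ler_pdivlMr ?pois_den// mulrC ler_pdivrMr ?pois_den//.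
have := exprn_gt0 2 e0; lra.
Qed.

(** The approximate identity argument: for small [h] the L^2 modulus of continuity is used, and
    otherwise some coordinate of [h] exceeds d and [pois_tail] gains a factor e. *)
Lemma cvg_poisD g : leb.-integrable setT (EFin \o g) -> (L2int g < +oo)%E ->
  forall eta : R, 0 < eta -> exists2 e0 : R, 0 < e0 & forall e, 0 < e -> e <= e0 ->
    (\int[leb]_h ((pois2 e h)%:E * L2int (fun z => g (z + h) - g z)%R) <= eta%:E)%E.
Proof.
move=> ig gfin eta eta0.
have mg : measurable_fun setT g by apply/measurable_EFinP; exact: measurable_int ig.
have gfin' : (L2int g \is a fin_num)%E by rewrite ge0_fin_numE// L2int_ge0.
pose L := fine (L2int g); have L0 : 0 <= L by rewrite fine_ge0// L2int_ge0.
have pi0 := @pi2_gt0 R.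
(* The kernel has mass [pi2], so the modulus eta/(2 [pi2]) makes small shifts contribute at most
   eta/2. *)
have [d d0 Hd] := L2_shift_modulus ig gfin (divr_gt0 eta0 (mulr_gt0 (ltr0n _ 2) pi0)).
set eta' := eta / _ in Hd.
have eta'0 : 0 <= eta' by rewrite /eta'; pos.
pose K := 4 * L + 1; have K0 : 0 < K by rewrite /K; lra.
(* The tails contribute K (2e/d) (2 [pi2]) in total, which this threshold keeps below eta/2; the 1
   added in [K] makes the division legitimate when [g] vanishes. *)
exists (d * eta / (8 * K * pi2)); first by pos.
move=> e e0 ee.
(* One tail term for each coordinate that may exceed d; each integrates to [pi2] by
   [int_pois_prod]. *)
pose B h : R := eta' * pois2 e h + K * (2 * e / d) * (pois d h.1 * pois e h.2 + pois e h.1 * pois d h.2).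
have mpp a b : 0 < a -> 0 < b -> measurable_fun setT (fun h : T => pois a h.1 * pois b h.2).
  by move=> a0 b0; apply: measurable_prod_fun; exact: measurable_pois.
have pp0 a b h : 0 < a -> 0 < b -> 0 <= pois a h.1 * pois b h.2.
  by move=> a0 b0; rewrite mulr_ge0// pois_ge0// ltW.
have c0 : 0 <= K * (2 * e / d) by pos.
have m3 : measurable_fun setT (fun h : T => pois d h.1 * pois e h.2 + pois e h.1 * pois d h.2).
  by apply: measurable_funD; exact: mpp.
have m1 := measurable_pois2 e0.
have mB : measurable_fun setT B by apply: measurable_funD; apply: measurable_funM.
apply: (@le_trans _ _ (\int[leb]_h (B h)%:E)%E).
  apply: ge0_le_integral => //.
  - by move=> h _; apply: mule_ge0; rewrite ?lee_fin ?pois2_ge0// L2int_ge0.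
  - by apply: emeasurable_funM; [exact/measurable_EFinP|exact: measurable_L2int_diff].
  - exact/measurable_EFinP.
  move=> h _; have B20 : 0 <= pois d h.1 * pois e h.2 + pois e h.1 * pois d h.2.
    by rewrite addr_ge0 ?pp0.
  have [hd|hd] := boolP ((`|h.1| <= d) && (`|h.2| <= d)).
    move/andP: hd => [h1 h2]; apply: (@le_trans _ _ ((pois2 e h)%:E * eta'%:E)%E).
      by apply: lee_pmul; rewrite ?lee_fin ?pois2_ge0 ?L2int_ge0 ?Hd.
    by rewrite -EFinM lee_fin /B mulrC lerDl mulr_ge0.
  apply: (@le_trans _ _ ((pois2 e h)%:E * K%:E)%E).
    apply: lee_pmul; rewrite ?lee_fin ?pois2_ge0 ?L2int_ge0//.
    apply: (le_trans (L2int_diff_le h mg)); rewrite -(fineK gfin') -EFinM lee_fin /K -/L.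
    by lra.
  rewrite -EFinM lee_fin /B; apply: ler_wpDl; first by rewrite mulr_ge0 ?pois2_ge0.
  rewrite mulrC -mulrA; apply: ler_wpM2l; first by pos.
  rewrite /pois2 mulrDr.
  move: hd; rewrite negb_and -!ltNge => /orP[h1|h2].
    apply: ler_wpDr; first by apply: mulr_ge0; [pos|apply: mulr_ge0; exact/pois_ge0/ltW].
    by rewrite mulrA ler_wpM2r ?pois_tail// ?pois_ge0// ltW.
  apply: ler_wpDl; first by apply: mulr_ge0; [pos|apply: mulr_ge0; exact/pois_ge0/ltW].
  rewrite [leRHS]mulrCA; apply: ler_wpM2l; first exact/pois_ge0/ltW.
  by apply: pois_tail => //; exact: ltW.
have S0 h : 0 <= pois d h.1 * pois e h.2 + pois e h.1 * pois d h.2 by rewrite addr_ge0 ?pp0.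
rewrite intD//; [|exact: measurable_funM|exact: measurable_funM|by move=> h; rewrite mulr_ge0 ?pois2_ge0|by move=> h; rewrite mulr_ge0].
rewrite intZ//; [|by move=> h; rewrite pois2_ge0].
rewrite intZ// intD//; [|exact: mpp|exact: mpp|by move=> h; exact: pp0|by move=> h; exact: pp0].
rewrite !int_pois_prod// -[leLHS]/((eta' * pi2 + K * (2 * e / d) * (pi2 + pi2))%:E) lee_fin.
have -> : eta' * pi2 = eta / 2 by rewrite /eta'; field; rewrite gt_eqF.
rewrite [leRHS]splitr lerD2l.
have -> : K * (2 * e / d) * (pi2 + pi2) = (4 * K * pi2 / d) * e by field; rewrite gt_eqF.
have -> : eta / 2 = (4 * K * pi2 / d) * (d * eta / (8 * K * pi2)) by field; rewrite !gt_eqF.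
by rewrite ler_wpM2l//; pos.
Qed.

End poisson_limit.

Section plancherel.
Context {R : realType}.
Local Notation T := (measurableTypeR R * measurableTypeR R)%type.
Implicit Types (e : R) (z k h : T) (g : T -> R).

Lemma expabs_le1 e (x : R) : 0 <= e -> expabs e x <= 1.
Proof. by move=> e0; rewrite /expabs -expR0 ler_expR oppr_le0 mulr_ge0. Qed.

Lemma rho_le1 e k : 0 <= e -> rho e k <= 1.
Proof. by move=> e0; rewrite /rho mulr_ile1// ?expR_ge0// expabs_le1. Qed.

Lemma cvg_expabs (x : R) : expabs n.+1%:R^-1 x @[n --> \oo] --> (1 : R).
Proof.
have h : n.+1%:R^-1 * `|x| @[n --> \oo] --> (0 * `|x| : R).
  by apply: cvgM; [exact: cvg_harmonic|exact: cvg_cst].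
have : expabs n.+1%:R^-1 x @[n --> \oo] --> expR (- (0 * `|x|)).
  exact: (cvg_comp (fun n => - (n.+1%:R^-1 * `|x|)) expR (cvgN h) (@continuous_expR R _)).
by rewrite mul0r oppr0 expR0.
Qed.

Lemma ereal_2XDY (X Y : \bar R) (c : R) : (0 <= X)%E -> (0 <= Y)%E ->
  (2%:E * X + Y = 2%:E * c%:E)%E ->
  exists x y : R, [/\ X = x%:E, Y = y%:E, 0 <= x, 0 <= y & 2 * x + y = 2 * c].
Proof.
case: X => [x| |]//; case: Y => [y| |]//; rewrite ?lee_fin => x0 y0.
- by move=> [] xy; exists x, y.
- by rewrite gt0_muley ?lte_fin.
- by rewrite gt0_muley ?lte_fin.
Qed.

(** For the upper bound the nonnegative Poisson term of [parseval_pois] is dropped and Fatou lets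
    the weight tend to 1. For the lower bound the weight is at most 1 and the Poisson term is small
    by [cvg_poisD]. *)
Lemma plancherel g : leb.-integrable setT (EFin \o g) -> (L2int g < +oo)%E ->
  (\int[leb]_k (fsq g k)%:E = pi2%:E * L2int g)%E.
Proof.
move=> ig gfin.
have mg : measurable_fun setT g by apply/measurable_EFinP; exact: measurable_int ig.
have mF := measurable_fsq mg.
have gfin' : (L2int g \is a fin_num)%E by rewrite ge0_fin_numE// L2int_ge0.
have mrF e : measurable_fun setT (fun k => rho e k * fsq g k).
  by apply: measurable_funM => //; exact: measurable_rho.
have rF0 e k : 0 <= rho e k * fsq g k by rewrite mulr_ge0 ?rho_ge0 ?fsq_ge0.
have D0 e : 0 < e -> (0 <= \int[leb]_h ((pois2 e h)%:E * L2int (fun z => g (z + h) - g z)%R))%E.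
  by move=> e0; apply: integral_ge0 => h _; apply: mule_ge0; [rewrite lee_fin pois2_ge0|exact: L2int_ge0].
apply/eqP; rewrite eq_le; apply/andP; split.
  apply: (@fatou_bound _ _ _ _ (fun n k => rho n.+1%:R^-1 k * fsq g k)) => //.
  - move=> k; rewrite -[X in _ --> X]mul1r; apply: cvgM; last exact: cvg_cst.
    by rewrite -[X in _ --> X]mul1r; apply: cvgM; exact: cvg_expabs.
  - move=> d d0; exists 0%N => n _; have n0 : 0 < n.+1%:R^-1 :> R by rewrite invr_gt0.
    have := parseval_pois n0 ig gfin; have := D0 _ n0.
    move: (\int[_]_h (_ * _))%E (int_ge0 leb (rF0 n.+1%:R^-1)) => Y.
    rewrite -(fineK gfin') => X0 Y0 /(ereal_2XDY X0 Y0)[x [y [-> _ _ y0 xy]]].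
    by rewrite -EFinM -EFinD lee_fin; lra.
apply/lee_addgt0Pr => eta eta0.
have [e e0 /(_ e e0 (lexx _)) De] := cvg_poisD ig gfin eta0.
have rF : (\int[leb]_k (rho e k * fsq g k)%:E <= \int[leb]_k (fsq g k)%:E)%E.
  apply: le_int => // k; rewrite ler_piMl ?fsq_ge0// rho_le1//; exact: ltW.
have := parseval_pois e0 ig gfin; have := D0 _ e0; move: De rF (int_ge0 leb (rF0 e)).
move: (\int[_]_h (_ * _))%E => Y.
rewrite -(fineK gfin') => De rF X0 Y0 /(ereal_2XDY X0 Y0)[x [y [xE yE _ _ xy]]].
move: De rF; rewrite {}xE {}yE lee_fin => De rF.
apply: (@le_trans _ _ (x%:E + eta%:E)%E); last exact: leeD.
by rewrite -EFinM -EFinD lee_fin; lra.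
Qed.

End plancherel.

Section fourier_shift.
Context {R : realType}.
Local Notation T := (measurableTypeR R * measurableTypeR R)%type.
Implicit Types (e : R) (z k h : T) (g : T -> R).

Lemma integrable_bounded_mul g (c : T -> R) : leb.-integrable setT (EFin \o g) ->
  measurable_fun setT c -> (forall z, `|c z| <= 1) ->
  leb.-integrable setT (EFin \o (fun z => g z * c z)).
Proof.
move=> ig mc c1; have mg : measurable_fun setT g by apply/measurable_EFinP; exact: measurable_int ig.
apply: (@le_integrable _ _ R leb setT measurableT _ (EFin \o g)) => //.
- by apply/measurable_EFinP; exact: measurable_funM.
- by move=> z _; rewrite /= lee_fin normrM ler_piMr.
Qed.

Lemma measurable_cos_dot1 k : measurable_fun setT (fun z => cos (dot z k)).
Proof. exact: (measurableT_comp measurable_cos_dot (measurable_pair2 k)). Qed.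

Lemma measurable_sin_dot1 k : measurable_fun setT (fun z => sin (dot z k)).
Proof. exact: (measurableT_comp measurable_sin_dot (measurable_pair2 k)). Qed.

Lemma int_lin_comb (f1 f2 : T -> R) a b :
  leb.-integrable setT (EFin \o f1) -> leb.-integrable setT (EFin \o f2) ->
  fine (\int[leb]_z (a * f1 z + b * f2 z)%:E)%E =
  a * fine (\int[leb]_z (f1 z)%:E)%E + b * fine (\int[leb]_z (f2 z)%:E)%E.
Proof.
move=> i1 i2; under eq_integral do rewrite EFinD !EFinM.
rewrite (integralD measurableT (integrableZl measurableT a i1) (integrableZl measurableT b i2)).
rewrite (integralZl measurableT i1) (integralZl measurableT i2).
have f1f : (\int[leb]_z (f1 z)%:E \is a fin_num)%E by exact: integrable_fin_num i1.
have f2f : (\int[leb]_z (f2 z)%:E \is a fin_num)%E by exact: integrable_fin_num i2.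
by rewrite -(fineK f1f) -(fineK f2f).
Qed.

(** A translation multiplies the transform by exp(i h.k), and |exp(i a) - 1|^2 = 2 - 2 cos a; the
    proof is the same computation in real and imaginary parts. *)
Lemma fsq_shift g h k : leb.-integrable setT (EFin \o g) ->
  fsq (fun z => g (z + h) - g z) k = (2 - 2 * cos (dot h k)) * fsq g k.
Proof.
move=> ig; have mg : measurable_fun setT g by apply/measurable_EFinP; exact: measurable_int ig.
have ic := integrable_bounded_mul ig (measurable_cos_dot1 k) (fun z => cos_max _).
have is_ := integrable_bounded_mul ig (measurable_sin_dot1 k) (fun z => sin_max _).
(* Translation invariance moves the shift from [g] to the trigonometric factor. *)
have sh (c : T -> R) : measurable_fun setT c -> (forall z, `|c z| <= 1) ->
    fine (\int[leb]_z ((g (z + h) - g z) * c z)%:E)%E =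
    fine (\int[leb]_z (1 * (g z * c (z - h)) + (-1) * (g z * c z))%:E)%E.
  move=> mc c1.
  have i0 := integrable_bounded_mul ig mc c1.
  have i1 := integrable_bounded_mul ig (measurable_fun_shift2 (- h) mc) (fun z => c1 _).
  rewrite int_lin_comb// mul1r mulN1r.
  have igh : leb.-integrable setT (EFin \o (fun z => g (z + h))).
    apply/integrableP; split; first by apply/measurable_EFinP; exact: measurable_fun_shift2.
    have /integrableP[_] := ig; rewrite -(@int_shift2 _ (fun z => `|g z|) h)//.
    exact: measurableT_comp.
  have i2 := integrable_bounded_mul igh mc c1.
  have -> : (\int[leb]_z ((g (z + h) - g z) * c z)%:E = \int[leb]_z (1 * (g (z + h) * c z) + (-1) * (g z * c z))%:E)%E.
    by apply: eq_integral => z _; congr (_%:E); ring.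
  rewrite int_lin_comb// mul1r mulN1r; congr (fine _ - _).
  have := integral_shift2 h (measurable_int _ i1); rewrite /= => <-.
  by apply: eq_integral => z _; rewrite /= addrK.
have C' : fcos (fun z => g (z + h) - g z) k = (cos (dot h k) - 1) * fcos g k + sin (dot h k) * fsin g k.
  rewrite /fcos /fsin (sh _ (measurable_cos_dot1 k) (fun z => cos_max _)) -(int_lin_comb _ _ ic is_).
  by congr fine; apply: eq_integral => z _; rewrite dotBl cosB; congr (_%:E); ring.
have S' : fsin (fun z => g (z + h) - g z) k = (cos (dot h k) - 1) * fsin g k + (- sin (dot h k)) * fcos g k.
  rewrite /fcos /fsin (sh _ (measurable_sin_dot1 k) (fun z => sin_max _)) -(int_lin_comb _ _ is_ ic).
  by congr fine; apply: eq_integral => z _; rewrite dotBl sinB; congr (_%:E); ring.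
rewrite /fsq C' S'; have := cos2Dsin2 (dot h k).
move: (cos _) (sin _) (fcos _ _) (fsin _ _) => c s C S cs.
rewrite (_ : 2 - 2 * c = (c - 1) ^+ 2 + s ^+ 2); first by ring.
by rewrite -[2 in LHS]/(1 + 1) -{1}cs; ring.
Qed.

End fourier_shift.

(** * The Fourier-Plancherel transform on L^2 *)

Section fourier_truncation.
Context {R : realType}.
Local Notation T := (measurableTypeR R * measurableTypeR R)%type.
Implicit Types (e : R) (z k h : T) (g u w : T -> R) (v : T -> R[i]).

Lemma inL2P u : inLp 2 u -> measurable_fun setT u /\ (L2int u < +oo)%E.
Proof.
move=> u2; have /integrableP[_ h] := Lfun2_integrable_sqr u2.
split; first by move: u2; rewrite /inLp inE => /andP[]; rewrite inE.
apply: le_lt_trans h; rewrite le_eqVlt; apply/orP; left; apply/eqP.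
by apply: eq_integral => z _ /=; rewrite ger0_norm// sqr_ge0.
Qed.

Definition vsq v k : R := complex.Re (v k) ^+ 2 + complex.Im (v k) ^+ 2.

Lemma vsq_ge0 v k : 0 <= vsq v k.
Proof. by rewrite /vsq addr_ge0// sqr_ge0. Qed.

Lemma measurable_vsq v : inL2C v -> measurable_fun setT (vsq v).
Proof.
by case=> /inL2P[m1 _] /inL2P[m2 _]; apply: measurable_funD; exact: measurable_sqr.
Qed.

Definition trunc n u : T -> R := u \_ (box n).

Lemma measurable_box n : measurable (@box R n : set T).
Proof. by apply: measurableX; exact: measurable_itv. Qed.

Lemma measurable_trunc n u : measurable_fun setT u -> measurable_fun setT (trunc n u).
Proof.
by move=> mu_; apply/measurable_restrict => //; [exact: measurable_box|exact: measurable_funTS].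
Qed.

Lemma trunc_sqr_le n u z : trunc n u z ^+ 2 <= u z ^+ 2.
Proof. by rewrite /trunc patchE; case: ifPn => // _; rewrite expr0n sqr_ge0. Qed.

Lemma L2int_trunc n u : measurable_fun setT u -> (L2int (trunc n u) <= L2int u)%E.
Proof.
move=> mu_; apply: le_int; [by apply: measurable_sqr; exact: measurable_trunc|exact: measurable_sqr| |].
- by move=> z; exact: sqr_ge0.
- by move=> z; exact: trunc_sqr_le.
Qed.

Lemma trunc_cvg u z : \forall n \near \oo, trunc n u z = u z.
Proof.
have [k zk] : exists k : nat, `|z.1| + `|z.2| <= k%:R.
  by exists (Num.trunc (`|z.1| + `|z.2|)).+1; rewrite ltW// truncnS_gt.
exists k => // n /= kn; have kn' : k%:R <= n%:R :> R by rewrite ler_nat.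
rewrite /trunc patchE mem_set//; split => /=; rewrite in_itv/= -ler_norml (le_trans _ kn')// (le_trans _ zk)//.
  by rewrite lerDl.
by rewrite lerDr.
Qed.

(** On the box |u| <= u^2 + 1, and the box has finite measure. *)
Lemma integrable_trunc n u : measurable_fun setT u -> (L2int u < +oo)%E ->
  leb.-integrable setT (EFin \o trunc n u).
Proof.
move=> mu_ ufin; have mt := measurable_trunc n mu_.
apply/integrableP; split; first exact/measurable_EFinP.
pose c z : R := u z ^+ 2 + \1_(box n) z.
have mi : measurable_fun setT (fun z : T => \1_(box n) z : R) by apply: measurable_indic; exact: measurable_box.
apply: (@le_lt_trans _ _ (\int[leb]_z (u z ^+ 2 + \1_(box n) z)%:E)%E).
  apply: le_int => //.
  - exact: measurableT_comp.
  - by apply: measurable_funD => //; exact: measurable_sqr.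
  move=> z; rewrite /= /trunc patchE indicE; case: ifPn => _; last by rewrite normr0 addr_ge0 ?sqr_ge0.
  by rewrite -(real_normK (num_real (u z))) mulr1n; have := sqr_ge0 (`|u z| - 1); have := normr_ge0 (u z); nra.
rewrite intD//; [|exact: measurable_sqr|by move=> z; exact: sqr_ge0].
apply: lte_add_pinfty => //; rewrite integral_indic//; last exact: measurable_box.
rewrite setIT /= /prodm product_measure1E//; [|exact: measurable_itv..].
have hb : (lebesgue_measure [set` `[- (n%:R : R), n%:R]%R] < +oo)%E.
  by rewrite lebesgue_measure_itv/=; case: ifPn => _; rewrite ?ltry// -EFinB ltry.
by apply: lte_mul_pinfty => //; rewrite ge0_fin_numE.
Qed.

Lemma fourier_boxE n u k :
  complex.Re (fourier_box n u k) = fcos (trunc n u) k /\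
  complex.Im (fourier_box n u k) = - fsin (trunc n u) k.
Proof.
have rE (c : T -> R) : Rintegral leb2 (box n) (fun z => u z * c z) = fine (\int[leb]_z (trunc n u z * c z)%:E)%E.
  rewrite Rintegral_mkcond /Rintegral; congr fine; apply: eq_integral => z _.
  by rewrite /trunc !patchE; case: ifPn => // _; rewrite mul0r.
by split; rewrite /fourier_box /= rE.
Qed.

(** Square of the integrand whose L^2 norm tends to 0 in [is_fourier]. *)
Definition fdist n u v k : R := vsq (fun k => fourier_box n u k - v k)%C k.

End fourier_truncation.

Section fourier_L2.
Context {R : realType}.
Local Notation T := (measurableTypeR R * measurableTypeR R)%type.
Implicit Types (e : R) (z k h : T) (g u w : T -> R) (v : T -> R[i]).

Lemma normLp2_sqr u : (normLp 2 u `^ 2)%E = L2int u.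
Proof.
rewrite /normLp poweR_Lnorm ?pnatr_eq0//; apply: eq_integral => z _ /=.
by rewrite powR_mulrn ?normr_ge0// real_normK ?num_real.
Qed.

Lemma normc_sqr (x : R[i]) : Normc.normc x ^+ 2 = complex.Re x ^+ 2 + complex.Im x ^+ 2.
Proof. by case: x => a b /=; rewrite sqr_sqrtr// addr_ge0// sqr_ge0. Qed.

Lemma ReB (x y : R[i]) : complex.Re (x - y) = complex.Re x - complex.Re y.
Proof. by case: x y => a b [c d]. Qed.

Lemma ImB (x y : R[i]) : complex.Im (x - y) = complex.Im x - complex.Im y.
Proof. by case: x y => a b [c d]. Qed.

Lemma is_fourierP u v : is_fourier u v -> [/\ inLp 2 u, inL2C v &
  forall e, 0 < e -> exists N, forall n, (N <= n)%N -> (\int[leb]_k (fdist n u v k)%:E <= e%:E)%E].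
Proof.
case=> u2 v2 uv; split => // e e0.
(* Capped at 1 so that the squared norm is at most e'^2 <= e' <= e. *)
pose e' := Num.min e 1; have e'0 : 0 < e' by rewrite lt_min e0/=.
have N0 n : (0 <= normLp 2 (fun k : R * R => Normc.normc (fourier_box n u k - v k)%R))%E by exact: Lnorm_ge0.
have /(ge0_cvge0P N0)/(_ _ e'0)[N HN] := uv.
exists N => n /HN {}HN.
have -> : (\int[leb]_k (fdist n u v k)%:E = normLp 2 (fun k : R * R => Normc.normc (fourier_box n u k - v k)%R) `^ 2)%E.
  by rewrite normLp2_sqr; apply: eq_integral => k _; rewrite normc_sqr.
apply: (@le_trans _ _ (e'%:E `^ 2)%E); first by apply: gt0_ler_poweR => //; rewrite in_itv/= ?leey ?lee_fin ?N0 ?ltW.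
rewrite poweR_EFin lee_fin powR_mulrn; last exact: ltW.
have : e' <= e by rewrite ge_min lexx.
have : e' <= 1 by rewrite ge_min lexx orbT.
nra.
Qed.

Lemma measurable_fdist n u v : inLp 2 u -> inL2C v -> measurable_fun setT (fdist n u v).
Proof.
move=> /inL2P[mu_ _] [/inL2P[m1 _] /inL2P[m2 _]]; apply: measurable_funD; apply: measurable_sqr.
- rewrite (_ : (fun k => _) = (fun k => fcos (trunc n u) k - complex.Re (v k))).
    by apply: measurable_funB => //; apply: measurable_fcos; exact: measurable_trunc.
  by apply/funext => k; rewrite ReB (fourier_boxE n u k).1.
- rewrite (_ : (fun k => _) = (fun k => - fsin (trunc n u) k - complex.Im (v k))).
    apply: measurable_funB => //; apply: (measurableT_comp (@oppr_measurable _ _)).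
    by apply: measurable_fsin; exact: measurable_trunc.
  by apply/funext => k; rewrite ImB (fourier_boxE n u k).2.
Qed.

Lemma vsq_le n u v k : vsq v k <= 2 * fsq (trunc n u) k + 2 * fdist n u v k.
Proof.
rewrite /fdist /vsq ReB ImB (fourier_boxE n u k).1 (fourier_boxE n u k).2 /fsq.
have := sqr_ge0 (2 * fcos (trunc n u) k - complex.Re (v k)).
have := sqr_ge0 (2 * fsin (trunc n u) k + complex.Im (v k)); nra.
Qed.

Lemma fsq_le n u v k : fsq (trunc n u) k <= 2 * vsq v k + 2 * fdist n u v k.
Proof.
rewrite /fdist /vsq ReB ImB (fourier_boxE n u k).1 (fourier_boxE n u k).2 /fsq.
have := sqr_ge0 (2 * complex.Re (v k) - fcos (trunc n u) k).
have := sqr_ge0 (2 * complex.Im (v k) + fsin (trunc n u) k); nra.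
Qed.

(** Plancherel for a truncation, passed to the limit by [vsq_le], which compares squares directly
    and thereby loses the factor 2. *)
Lemma fourier_L2_le u v : is_fourier u v ->
  (\int[leb]_k (vsq v k)%:E <= 2%:E * (pi2%:E * L2int u))%E.
Proof.
move=> /is_fourierP[u2 v2 uv]; have [mu_ ufin] := inL2P u2.
apply/lee_addgt0Pr => e e0; have [N /(_ _ (leqnn _)) HN] := uv (e / 2) (divr_gt0 e0 (ltr0n _ 2)).
have mf : measurable_fun setT (fsq (trunc N u)) by apply: measurable_fsq; exact: measurable_trunc.
have md := measurable_fdist N u2 v2.
apply: (@le_trans _ _ (\int[leb]_k (2 * fsq (trunc N u) k + 2 * fdist N u v k)%:E)%E).
  apply: le_int.
  - exact: measurable_vsq.
  - by apply: measurable_funD; exact: measurable_funM.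
  - exact: vsq_ge0.
  - by move=> k; exact: vsq_le.
rewrite intD; last 4 first.
- exact: measurable_funM.
- exact: measurable_funM.
- by move=> k; rewrite mulr_ge0// fsq_ge0.
- by move=> k; rewrite mulr_ge0// vsq_ge0.
rewrite intZ//; last exact: fsq_ge0.
rewrite intZ//; last by move=> k; exact: vsq_ge0.
have it := integrable_trunc N mu_ ufin; have tu := L2int_trunc N mu_.
rewrite (plancherel it (le_lt_trans tu ufin)).
apply: leeD.
  apply: lee_pmul => //; first by apply: mule_ge0; [rewrite lee_fin ltW// pi2_gt0|exact: L2int_ge0].
  by apply: lee_pmul => //; [rewrite lee_fin ltW// pi2_gt0|exact: L2int_ge0].
rewrite (_ : e = 2 * (e / 2)); last by field.
by rewrite EFinM; apply: lee_pmul => //; apply: int_ge0 => k; exact: vsq_ge0.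
Qed.

(** Plancherel and [fsq_shift] apply to the increment of a truncation, which lies in L^1 and L^2. On
    the Fourier side the truncation is replaced by [v] through [fsq_le]; in real space Fatou removes
    it. *)
Lemma fourier_shift_le u v h : is_fourier u v ->
  (pi2%:E * L2int (fun z => u (z + h) - u z)%R <= 2%:E * \int[leb]_k ((2 - 2 * cos (dot h k)) * vsq v k)%:E)%E.
Proof.
move=> /is_fourierP[u2 v2 uv]; have [mu_ ufin] := inL2P u2.
have mD g : measurable_fun setT g -> measurable_fun setT (fun z => (g (z + h) - g z) ^+ 2).
  by move=> mg; apply: measurable_sqr; exact: measurable_diff_shift2.
have p0 : (0 : R) <= pi2 by rewrite ltW// pi2_gt0.
rewrite /L2int -intZ//; [|exact: mD|by move=> z; exact: sqr_ge0].
have cE (k : T) : cos (dot h k) = cos (dot k h) by congr cos; rewrite /dot; ring.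
have mc : measurable_fun setT (fun k => 2 - 2 * cos (dot h k)).
  apply: measurable_funB => //; apply: measurable_funM => //.
  by under eq_fun do rewrite cE; exact: measurable_cos_dot1.
have c0 k : 0 <= 2 - 2 * cos (dot h k) by have := cos_le1 (dot h k); lra.
have c4 k : 2 - 2 * cos (dot h k) <= 4 by have := cos_geN1 (dot h k); lra.
have mv := measurable_vsq v2.
apply: (@fatou_bound _ _ _ _ (fun n z => pi2 * (trunc n u (z + h) - trunc n u z) ^+ 2)).
- by move=> n; apply: measurable_funM => //; apply: mD; exact: measurable_trunc.
- by move=> n z; rewrite mulr_ge0// sqr_ge0.
- move=> z; apply: cvg_near_cst; near=> n; congr (_ * (_ - _) ^+ 2); near: n; exact: trunc_cvg.
(* The factor 8 is the bound 4 on 2 - 2 cos times the factor 2 of [fsq_le]. *)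
move=> e e0; have [N HN] := uv (e / 8) (divr_gt0 e0 (ltr0n _ 8)).
exists N => n /HN {}HN.
have it := integrable_trunc n mu_ ufin; have tu := le_lt_trans (L2int_trunc n mu_) ufin.
have mt := measurable_trunc n mu_.
have itD : leb.-integrable setT (EFin \o (fun z => trunc n u (z + h) - trunc n u z)).
  have ish : leb.-integrable setT (EFin \o (fun z => trunc n u (z + h))).
    apply/integrableP; split; first by apply/measurable_EFinP; exact: measurable_fun_shift2.
    have /integrableP[_] := it; rewrite -(@int_shift2 _ (fun z => `|trunc n u z|) h)//.
    exact: measurableT_comp.
  by apply: eq_integrable (integrableB measurableT ish it).
have fD : (L2int (fun z => trunc n u (z + h) - trunc n u z)%R < +oo)%E.
  by apply: (le_lt_trans (L2int_diff_le h mt)); rewrite lte_mul_pinfty.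
rewrite intZ//; [|exact: mD|by move=> z; exact: sqr_ge0].
rewrite -/(L2int (fun z => trunc n u (z + h) - trunc n u z)) -(plancherel itD fD).
have md := measurable_fdist n u2 v2.
have mcv : measurable_fun setT (fun k => (2 - 2 * cos (dot h k)) * vsq v k) by exact: measurable_funM.
apply: (@le_trans _ _ (\int[leb]_k (2 * ((2 - 2 * cos (dot h k)) * vsq v k) + 8 * fdist n u v k)%:E)%E).
  apply: le_int.
  - by apply: measurable_fsq; exact: measurable_diff_shift2.
  - by apply: measurable_funD; exact: measurable_funM.
  - by move=> k; exact: fsq_ge0.
  move=> k; rewrite fsq_shift//; apply: (le_trans (ler_wpM2l (c0 k) (fsq_le n u v k))).
  rewrite mulrDr mulrCA lerD2l mulrA; apply: ler_wpM2r; first exact: vsq_ge0.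
  by have := c4 k; lra.
have w0 k : 0 <= (2 - 2 * cos (dot h k)) * vsq v k by rewrite mulr_ge0// vsq_ge0.
have d0 k : 0 <= fdist n u v k by exact: vsq_ge0.
rewrite intD; [|exact: measurable_funM|exact: measurable_funM|by move=> k; rewrite mulr_ge0|by move=> k; rewrite mulr_ge0].
rewrite !intZ//; apply: leeD => //.
rewrite (_ : e = 8 * (e / 8)); last by field.
by rewrite EFinM; apply: lee_pmul => //; exact: int_ge0.
Unshelve. all: by end_near. Qed.

Lemma vsqB_le n u v v' k : vsq (fun k => v k - v' k) k <= 2 * fdist n u v k + 2 * fdist n u v' k.
Proof.
rewrite /fdist /vsq !ReB !ImB; move: (complex.Re (fourier_box _ _ _)) (complex.Im (fourier_box _ _ _)) => a b.
move: (complex.Re (v k)) (complex.Im (v k)) (complex.Re (v' k)) (complex.Im (v' k)) => x y x' y'.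
have := sqr_ge0 (2 * a - x - x'); have := sqr_ge0 (2 * b - y - y'); nra.
Qed.

(** Needed because [is_Dxhalf] and [is_Dxmhalf_dy] each come with a transform of [u] of their own,
    which have to be identified. *)
Lemma fourier_unique u v v' : is_fourier u v -> is_fourier u v' -> {ae leb, forall k, v k = v' k}.
Proof.
move=> /is_fourierP[u2 v2 uv] /is_fourierP[_ v2' uv'].
have mB : measurable_fun setT (vsq (fun k => v k - v' k)).
  have [/inL2P[m1 _] /inL2P[m2 _]] := v2; have [/inL2P[m1' _] /inL2P[m2' _]] := v2'.
  apply: measurable_funD; apply: measurable_sqr.
  - by under eq_fun do rewrite ReB; exact: measurable_funB.
  - by under eq_fun do rewrite ImB; exact: measurable_funB.
have I0 : (\int[leb]_k (vsq (fun k => v k - v' k) k)%:E = 0)%E.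
  apply/eqP; rewrite eq_le int_ge0 ?andbT; last by move=> k; exact: vsq_ge0.
  apply/lee_addgt0Pr => e e0; rewrite add0e.
  have [N HN] := uv (e / 4) (divr_gt0 e0 (ltr0n _ 4)).
  have [N' HN'] := uv' (e / 4) (divr_gt0 e0 (ltr0n _ 4)).
  have {}HN := HN _ (leq_maxl N N'); have {}HN' := HN' _ (leq_maxr N N').
  set n := maxn N N' in HN HN'.
  have md := measurable_fdist n u2 v2; have md' := measurable_fdist n u2 v2'.
  have d0 x k : 0 <= fdist n u x k by exact: vsq_ge0.
  apply: (@le_trans _ _ (\int[leb]_k (2 * fdist n u v k + 2 * fdist n u v' k)%:E)%E).
    apply: le_int => //.
    - by apply: measurable_funD; exact: measurable_funM.
    - by move=> k; exact: vsq_ge0.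
    - by move=> k; exact: vsqB_le.
  rewrite intD; [|exact: measurable_funM|exact: measurable_funM|by move=> k; rewrite mulr_ge0|by move=> k; rewrite mulr_ge0].
  rewrite !intZ//.
  rewrite (_ : e = 2 * (e / 4) + 2 * (e / 4)); last by field.
  by rewrite (EFinD (2 * (e / 4))) (EFinM 2 (e / 4)); apply: leeD; apply: lee_pmul => //; exact: int_ge0.
have mE : measurable_fun setT (EFin \o vsq (fun k => v k - v' k)) by exact/measurable_EFinP.
have : (\int[leb]_(x in setT) `|(EFin \o vsq (fun k => v k - v' k)%R) x| = 0)%E.
  by under eq_integral do rewrite gee0_abs ?lee_fin ?vsq_ge0//.
case: (ae_eq_integral_abs leb measurableT mE) => h1 _ /h1.
apply: filterS => k /(_ I) /= [] /eqP; rewrite /vsq paddr_eq0 ?sqr_ge0// !sqrf_eq0 ReB ImB !subr_eq0.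
by case: (v k) (v' k) => a b [c d] /= /andP[/eqP -> /eqP ->].
Qed.

End fourier_L2.

(** * Difference quotients and the symbols *)

Section fractional.
Context {R : realType}.
Local Notation T := (measurableTypeR R * measurableTypeR R)%type.
Local Notation mu := (@lebesgue_measure R).
Implicit Types (e t x : R) (z k h : T) (g u w : T -> R) (v : T -> R[i]).

Lemma sin_le_id x : 0 <= x -> `|sin x| <= x.
Proof.
move=> x0; have [c _] := @MVT_segment R sin cos 0 x x0 (fun y _ => is_derive_sin y) (continuous_subspaceT (@continuous_sin R)).
by rewrite sin0 !subr0 => ->; rewrite normrM (ger0_norm x0) ler_piMl// cos_max.
Qed.

Lemma sin_sqr_le x : sin x ^+ 2 <= x ^+ 2.
Proof.
rewrite -[leLHS]real_normK ?num_real// -[leRHS]real_normK ?num_real//.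
rewrite lerXn2r ?nnegrE//; case: (leP 0 x) => x0.
  by rewrite (ger0_norm x0) sin_le_id.
by rewrite -normrN -sinN -[`|x|]normrN [`|- x|]ger0_norm ?sin_le_id// oppr_ge0 ltW.
Qed.

(** By the half-angle formula the left-hand side is 4 sin^2(x/2). *)
Lemma cos_ge_sqr x : 2 - 2 * cos x <= x ^+ 2.
Proof.
have := sin_sqr_le (x / 2); rewrite sin2cos2.
have := cos_mulr2n (x / 2); rewrite (_ : (x / 2) *+ 2 = x); last by rewrite -mulr_natr; field.
rewrite mulr2n => ->.
by rewrite (_ : (x / 2) ^+ 2 = x ^+ 2 / 4); [lra|field].
Qed.

(** The quotient is at most min(x^2, 4/t^2), and a Poisson kernel of width 2/|x| has the same
    profile. This reuses [int_pois] in place of an exact evaluation. At t = 0 the inverse is 0 by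
    convention. *)
Lemma kappa_le t x : (2 - 2 * cos (t * x)) * (t ^+ 2)^-1 <= 2 * `|x| * pois (2 / `|x|) t.
Proof.
have [->|x0] := eqVneq x 0; first by rewrite mulr0 cos0 normr0 !mulr0 mul0r mulr1 subrr mul0r.
have [->|t0] := eqVneq t 0.
  by rewrite mul0r cos0 mulr1 subrr mul0r mulr_ge0// pois_ge0// divr_ge0.
have ax : 0 < `|x| by rewrite normr_gt0.
have t2 : 0 < t ^+ 2 by rewrite exprn_even_gt0.
have e0 : 0 < 2 / `|x| by rewrite divr_gt0.
rewrite /pois ler_pdivrMr// [leRHS](_ : _ = (4 * (`|x| * (2 / `|x|))) * t ^+ 2 / ((2 / `|x|) ^+ 2 + t ^+ 2)); last by ring.
rewrite [_ * (2 / _)](_ : _ = 2); last by field; rewrite gt_eqF.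
rewrite [leRHS](_ : _ = 8 * t ^+ 2 / ((2 / `|x|) ^+ 2 + t ^+ 2)); last first.
  by ring.
rewrite ler_pdivlMr ?pois_den//.
set c := 2 - _; have c0 : 0 <= c by rewrite /c; have := cos_le1 (t * x); lra.
have c4 : c <= 4 by rewrite /c; have := cos_geN1 (t * x); lra.
have cs : c <= t ^+ 2 * x ^+ 2 by rewrite -exprMn; exact: cos_ge_sqr.
have : c * (2 / `|x|) ^+ 2 <= 4 * t ^+ 2.
  rewrite expr_div_n mulrA ler_pdivrMr ?exprn_gt0// real_normK ?num_real//; nra.
nra.
Qed.

Lemma measurable_ge0_inv d (X : measurableType d) (f : X -> R) : measurable_fun setT f ->
  (forall y, 0 <= f y) -> measurable_fun setT (fun y => (f y)^-1).
Proof.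
move=> mf f0; rewrite (_ : (fun y => _) = (fun y => f y `^ (-1))).
  exact: (measurableT_comp (measurable_powR _) mf).
by apply/funext => y; rewrite powR_inv1.
Qed.

Lemma measurable_inv_sqr : measurable_fun [set: R] (fun t => (t ^+ 2)^-1).
Proof. by apply: measurable_ge0_inv; [exact: exprn_measurable|move=> t; exact: sqr_ge0]. Qed.

Lemma measurable_kappa x : measurable_fun setT (fun t : R => (2 - 2 * cos (t * x)) * (t ^+ 2)^-1).
Proof.
apply: measurable_funM.
  apply: measurable_funB => //; apply: measurable_funM => //.
  by under eq_fun do rewrite mulrC; exact: measurable_cosM.
exact: measurable_inv_sqr.
Qed.

Lemma int_kappa x : (\int[mu]_t ((2 - 2 * cos (t * x)) * (t ^+ 2)^-1)%:E <= (4 * pi * `|x|)%:E)%E.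
Proof.
have mk := measurable_kappa x.
have [->|x0] := eqVneq x 0.
  by under eq_integral do rewrite mulr0 cos0 mulr1 subrr mul0r; rewrite integral0 normr0 mulr0.
have ax : 0 < `|x| by rewrite normr_gt0.
have e0 : 0 < 2 / `|x| by rewrite divr_gt0.
apply: (@le_trans _ _ (\int[mu]_t (2 * `|x| * pois (2 / `|x|) t)%:E)%E).
  apply: le_int => //.
  - by apply: measurable_funM => //; exact: measurable_pois.
  - by move=> t; rewrite mulr_ge0 ?invr_ge0 ?sqr_ge0//; have := cos_le1 (t * x); lra.
  - by move=> t; exact: kappa_le.
rewrite intZ//; [|exact: measurable_pois|by move=> t; apply/pois_ge0/ltW].
by rewrite int_pois// -EFinM lee_fin; lra.
Qed.

(** [H] will run along one of the axes and [om] is the matching frequency coordinate. After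
    [fourier_shift_le] at each t, Tonelli brings the integral in t inside, where [int_kappa]
    evaluates it up to a constant; 8 pi is 2 times 4 pi. *)
Lemma int_L2int_diff_le u v (H : R -> T) (om : T -> R) : is_fourier u v ->
  measurable_fun setT H -> measurable_fun setT om -> (forall t k, dot (H t) k = t * om k) ->
  (pi2%:E * \int[mu]_t ((t ^+ 2)^-1%:E * L2int (fun z => u (z + H t) - u z)%R) <=
   (8 * pi)%:E * \int[leb]_k (`|om k| * vsq v k)%:E)%E.
Proof.
move=> uv mH mom Hom; have [u2 v2 _] := is_fourierP uv; have [mu_ ufin] := inL2P u2.
have p0 : (0 : R) <= pi2 by rewrite ltW// pi2_gt0.
have minv := measurable_inv_sqr.
have i0 t : 0 <= (t ^+ 2)^-1 by rewrite invr_ge0 sqr_ge0.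
have mL : measurable_fun setT (fun t => L2int (fun z => u (z + H t) - u z)).
  exact: (measurableT_comp (measurable_L2int_diff mu_) mH).
have mv := measurable_vsq v2.
pose Q (w : R * T) : R := ((2 - 2 * cos (w.1 * om w.2)) * (w.1 ^+ 2)^-1) * vsq v w.2.
have mQ : measurable_fun [set: measurableTypeR R * T] Q.
  have m1 : measurable_fun [set: measurableTypeR R * T] fst by exact: measurable_fst.
  apply: measurable_funM; last exact: (measurableT_comp mv measurable_snd).
  apply: measurable_funM; last exact: (measurableT_comp minv m1).
  apply: measurable_funB => //; apply: measurable_funM => //.
  apply: (@measurableT_comp _ _ _ _ _ _ (cos : R -> R)).
    exact: continuous_measurable_fun (@continuous_cos R).
  by apply: measurable_funM => //; exact: (measurableT_comp mom measurable_snd).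
have k0 t k : 0 <= (2 - 2 * cos (t * om k)) * (t ^+ 2)^-1.
  by rewrite mulr_ge0//; have := cos_le1 (t * om k); lra.
have Q0 (w : R * T) : 0 <= Q w by rewrite mulr_ge0 ?vsq_ge0.
have mQE : measurable_fun [set: measurableTypeR R * T] (EFin \o Q) by exact/measurable_EFinP.
have QE0 (w : R * T) : (0 <= (EFin \o Q) w)%E by rewrite lee_fin.
have mQt t : measurable_fun setT (fun k => Q (t, k)) by exact: (measurableT_comp mQ (measurable_pair1 t)).
rewrite -ge0_integralZl//; last 2 first.
- by apply: emeasurable_funM => //; exact/measurable_EFinP.
- by move=> t _; apply: mule_ge0; [rewrite lee_fin|exact: L2int_ge0].
apply: (@le_trans _ _ (\int[mu]_t (2%:E * \int[leb]_k (Q (t, k))%:E))%E).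
  apply: ge0_le_integral => //.
  - by move=> t _; do 2 (apply: mule_ge0; first by rewrite lee_fin); exact: L2int_ge0.
  - by apply: emeasurable_funM => //; apply: emeasurable_funM => //; exact/measurable_EFinP.
  - apply: emeasurable_funM => //.
    exact: (@measurable_fun_fubini_tonelli_F _ _ _ _ _ leb (EFin \o Q)).
  move=> t _; rewrite muleCA; apply: (le_trans (lee_wpmul2l _ (fourier_shift_le (H t) uv))); first by rewrite lee_fin.
  rewrite muleCA -intZ//; last 2 first.
  - apply: measurable_funM => //; apply: measurable_funB => //; apply: measurable_funM => //.
    rewrite (_ : (fun k => _) = (fun k => cos (t * om k))); last by apply/funext => k; rewrite Hom.
    exact: (measurableT_comp (measurable_cosM t) mom).
  - by move=> k; rewrite mulr_ge0 ?vsq_ge0//; have := cos_le1 (dot (H t) k); lra.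
  rewrite le_eqVlt; apply/orP; left; apply/eqP; congr (_ * _)%E; apply: eq_integral => k _.
  by rewrite /Q /= Hom; congr (_%:E); ring.
rewrite ge0_integralZl//; last 2 first.
- exact: (@measurable_fun_fubini_tonelli_F _ _ _ _ _ leb (EFin \o Q)).
- by move=> t _; exact: int_ge0.
rewrite (@fubini_tonelli _ _ _ _ _ mu leb (EFin \o Q) mQE QE0) /=.
have mo : measurable_fun setT (fun k => `|om k| * vsq v k).
  by apply: measurable_funM => //; exact: measurableT_comp.
have o0 k : 0 <= `|om k| * vsq v k by rewrite mulr_ge0 ?vsq_ge0.
have -> : (8 * pi = 2 * (4 * pi) :> R) by ring.
rewrite EFinM -muleA; apply: lee_wpmul2l => //.
rewrite -intZ//; last by pos.
apply: ge0_le_integral => //.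
- by move=> k _; exact: int_ge0.
- exact: (@measurable_fun_fubini_tonelli_G _ _ _ _ _ mu (EFin \o Q)).
- by apply/measurable_EFinP; exact: measurable_funM.
move=> k _; rewrite /Q /=.
under eq_integral do rewrite mulrC.
rewrite intZ//; last 2 first.
- exact: measurable_kappa.
- exact: vsq_ge0.
apply: (le_trans (lee_wpmul2l _ (int_kappa (om k)))); first by rewrite lee_fin vsq_ge0.
by rewrite -EFinM lee_fin; lra.
Qed.

End fractional.

Section multipliers.
Context {R : realType}.
Local Notation T := (measurableTypeR R * measurableTypeR R)%type.
Implicit Types (s : R) (k : T) (u w : T -> R) (v : T -> R[i]).

Lemma powR_half_sqr (x : R) : 0 <= x -> (x `^ (1 / 2)) ^+ 2 = x.
Proof. by move=> x0; rewrite div1r powR12_sqrt// sqr_sqrtr. Qed.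

Lemma vsq_Dx v v' k : v' k = symb_Dx (1 / 2) k * v k -> vsq v' k = `|k.1| * vsq v k.
Proof.
rewrite /vsq => ->; rewrite /symb_Dx; case: (v k) => a b /=.
by rewrite !mul0r subr0 addr0 !exprMn powR_half_sqr// mulrDr.
Qed.

Lemma vsq_Dxm v v' k : v' k = symb_Dx (- (1 / 2)) k * symb_dy k * v k ->
  vsq v' k = `|k.1|^-1 * k.2 ^+ 2 * vsq v k.
Proof.
rewrite /vsq => ->; rewrite /symb_Dx /symb_dy; case: (v k) => a b /=.
have h : (`|k.1| `^ (- (1 / 2))) ^+ 2 = `|k.1|^-1 by rewrite powRN exprVn powR_half_sqr.
by rewrite -h; ring.
Qed.

(** On the line [k.1 = 0] the negative power in the symbol is a default value and gives no control
    of [k.2]. *)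
Lemma ae_fst_neq0 : {ae leb, forall k : T, k.1 != 0}.
Proof.
exists ([set 0] `*` setT); split.
- exact: measurableX.
- by rewrite /= /prodm product_measure1E//= lebesgue_measure_set1 mul0e.
- move=> k /= /negP; rewrite negbK => /eqP k0; split => //=.
Qed.

(** The vertical bound interpolates between the two symbols: |k.2| is at most the weighted
    arithmetic mean of |k.1| and k.2^2/|k.1|, for every weight [s]. One transform [v] has to serve
    both bounds, hence the appeal to [fourier_unique]. *)
Lemma multiplier_bounds u w w' : is_Dxhalf u w -> is_Dxmhalf_dy u w' ->
  exists v, [/\ is_fourier u v,
    (\int[leb]_k (`|k.1| * vsq v k)%:E <= 2%:E * (pi2%:E * L2int w))%E &
    forall s, 0 < s -> (\int[leb]_k (`|k.2| * vsq v k)%:E <=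
      s%:E * (pi2%:E * L2int w) + s^-1%:E * (pi2%:E * L2int w'))%E].
Proof.
move=> [v [vw [uv wvw aew]]] [v' [vw' [uv' wvw' aew']]].
have {}aew : {ae leb, forall k, vw k = symb_Dx (1 / 2) k * v k} := aew.
have {}aew' : {ae leb, forall k, vw' k = symb_Dx (- (1 / 2)) k * symb_dy k * v' k} := aew'.
have [_ v2 _] := is_fourierP uv; have mv := measurable_vsq v2.
have [_ vw2 _] := is_fourierP wvw; have mvw := measurable_vsq vw2.
have [_ vw2' _] := is_fourierP wvw'; have mvw' := measurable_vsq vw2'.
have m1 : measurable_fun setT (fun k => `|k.1| * vsq v k).
  by apply: measurable_funM => //; apply: measurableT_comp => //; exact: measurable_fst.
have m2 : measurable_fun setT (fun k => `|k.2| * vsq v k).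
  by apply: measurable_funM => //; apply: measurableT_comp => //; exact: measurable_snd.
have e1 : (\int[leb]_k (`|k.1| * vsq v k)%:E = \int[leb]_k (vsq vw k)%:E)%E.
  apply: ge0_ae_eq_integral => //; [exact/measurable_EFinP|exact/measurable_EFinP| | |].
  - by move=> k _; rewrite lee_fin mulr_ge0 ?vsq_ge0.
  - by move=> k _; rewrite lee_fin vsq_ge0.
  - by apply: filterS aew => k h _; rewrite (vsq_Dx h).
exists v; split => //; first by rewrite e1; exact: fourier_L2_le.
move=> s s0.
have msum : measurable_fun setT (fun k => s / 2 * (`|k.1| * vsq v k) + (2 * s)^-1 * vsq vw' k).
  by apply: measurable_funD; exact: measurable_funM.
have c1 : 0 <= s / 2 by pos.
have c2 : 0 <= (2 * s)^-1 by pos.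
have n1 k : 0 <= `|k.1| * vsq v k by rewrite mulr_ge0 ?vsq_ge0.
(* The halves in s/2 and 1/(2s) absorb the factor 2 of [fourier_L2_le]. *)
apply: (@le_trans _ _ (\int[leb]_k (s / 2 * (`|k.1| * vsq v k) + (2 * s)^-1 * vsq vw' k)%:E)%E).
  apply: ae_ge0_le_integral => //; [| exact/measurable_EFinP| |exact/measurable_EFinP|].
  - by move=> k _; rewrite lee_fin mulr_ge0 ?vsq_ge0.
  - by move=> k _; rewrite lee_fin addr_ge0// mulr_ge0// vsq_ge0.
  have := fourier_unique uv uv'; move: aew' ae_fst_neq0; apply: filterS3 => k h k0 vv' _.
  rewrite lee_fin; rewrite -vv' in h; rewrite (vsq_Dxm h) !mulrA -mulrDl; apply: ler_wpM2r; first exact: vsq_ge0.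
  have a0 : 0 < `|k.1| by rewrite normr_gt0.
  have b2 : k.2 ^+ 2 = `|k.2| ^+ 2 by rewrite real_normK ?num_real.
  rewrite -(mulrA _ k.2) -expr2 b2; move: `|k.1| `|k.2| a0 => a b a0.
  rewrite (_ : s / 2 * a + _ = ((s * a) ^+ 2 + b ^+ 2) / (2 * s * a)); last by field; rewrite !gt_eqF.
  by rewrite ler_pdivlMr; [have := sqr_ge0 (s * a - b); nra|pos].
rewrite intD//; [|exact: measurable_funM|exact: measurable_funM|by move=> k; rewrite mulr_ge0|by move=> k; rewrite mulr_ge0// vsq_ge0].
rewrite intZ// intZ//; last exact: vsq_ge0.
rewrite e1; apply: leeD.
  apply: (le_trans (lee_wpmul2l _ (fourier_L2_le wvw))); first by rewrite lee_fin.
  by rewrite muleA -EFinM divfK.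
apply: (le_trans (lee_wpmul2l _ (fourier_L2_le wvw'))); first by rewrite lee_fin.
by rewrite muleA -EFinM invfM mulrAC mulVf// mul1r.
Qed.

(** [s] stays free, to be matched later with the slope [m] of the cone; the common factor [pi2]
    cancels. *)
Lemma seminorm_bounds u w w' s : 0 < s -> is_Dxhalf u w -> is_Dxmhalf_dy u w' ->
  (\int[@lebesgue_measure R]_t ((t ^+ 2)^-1%:E * L2int (fun z => u (z + (t, 0)) - u z)%R) <=
    (16 * pi)%:E * L2int w)%E /\
  (\int[@lebesgue_measure R]_t ((t ^+ 2)^-1%:E * L2int (fun z => u (z + (0, t)) - u z)%R) <=
    (8 * pi)%:E * (s%:E * L2int w + s^-1%:E * L2int w'))%E.
Proof.
move=> s0 uw uw'; have [v [uv h1 h2]] := multiplier_bounds uw uw'.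
have p0 : (0 : R) < pi2 by exact: pi2_gt0.
have pf : (pi2%:E : \bar R) \is a fin_num by [].
split.
  rewrite -(lee_pmul2l pf) ?lte_fin//.
  apply: (le_trans (@int_L2int_diff_le _ u v (fun t => (t, 0)) (fun k => k.1) uv _ _ _)).
  - exact: (@measurable_pair2 _ _ (measurableTypeR R) (measurableTypeR R) 0).
  - exact: measurable_fst.
  - by move=> t k; rewrite /dot /= mul0r addr0.
  apply: (le_trans (lee_wpmul2l _ h1)); first by rewrite lee_fin; pos.
  rewrite [leRHS]muleCA (_ : (16 * pi)%:E = (8 * pi)%:E * 2%:E)%E; first by rewrite -!muleA.
  by rewrite -EFinM; congr (_%:E); ring.
rewrite -(lee_pmul2l pf) ?lte_fin//.
apply: (le_trans (@int_L2int_diff_le _ u v (fun t => (0, t)) (fun k => k.2) uv _ _ _)).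
- exact: (@measurable_pair1 _ _ (measurableTypeR R) (measurableTypeR R) 0).
- exact: measurable_snd.
- by move=> t k; rewrite /dot /= mul0r add0r.
apply: (le_trans (lee_wpmul2l _ (h2 s s0))); first by rewrite lee_fin; pos.
rewrite [leRHS]muleCA; apply: lee_wpmul2l; first by rewrite lee_fin; pos.
move: (L2int w) (L2int w') (L2int_ge0 w) (L2int_ge0 w') => a b a0 b0.
rewrite ge0_muleDr; last 2 first.
- by apply: mule_ge0 => //; rewrite lee_fin ltW.
- by apply: mule_ge0 => //; rewrite lee_fin invr_ge0 ltW.
by apply: leeD; rewrite muleCA.
Qed.

End multipliers.

(** * The anisotropic L^4 inequality *)

Section kernel.
Context {R : realType}.
Local Notation T := (measurableTypeR R * measurableTypeR R)%type.
Local Notation mu := (@lebesgue_measure R).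
Implicit Types (m r t : R) (z h : T) (f u : T -> R).

(** The increments for which [h.1] and [m * h.2] are comparable within a factor 2; it contains
    [r, 2r] x [r/m, 2r/m] for every r > 0. *)
Definition cone m : set T := [set h | 0 < h.1 /\ (h.1 <= 2 * (m * h.2) /\ m * h.2 <= 2 * h.1)].

(* Integrating the kernel over one variable leaves a multiple of [|h.1|^-2], resp. [|h.2|^-2], so
   that [h |-> L2int (f (z + h) - f z)] integrated against it is controlled by one-dimensional
   Gagliardo seminorms in each direction. *)
Definition ker m h : R := \1_(cone m) h * (`|h.1| ^+ 3)^-1.

Lemma ker_ge0 m h : 0 <= ker m h.
Proof. by rewrite /ker mulr_ge0// invr_ge0 exprn_ge0. Qed.

Lemma measurable_cone m : measurable (cone m).
Proof.
have m1 : measurable_fun setT (fun h : T => h.1) by exact: measurable_fst.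
have m2 : measurable_fun setT (fun h : T => h.2) by exact: measurable_snd.
have mc (a b : T -> R) : measurable_fun setT a -> measurable_fun setT b -> measurable [set h | a h <= b h].
  move=> ma mb; have := measurable_fun_ler ma mb; move=> /(_ measurableT [set true]).
  by rewrite setTI => /(_ I).
apply: measurableI.
  have := measurable_fun_ltr (@measurable_cst _ _ T _ setT (0 : R)) m1; move=> /(_ measurableT [set true]).
  by rewrite setTI => /(_ I).
by apply: measurableI; apply: mc => //; apply: measurable_funM => //; exact: measurable_funM.
Qed.

Lemma measurable_ker m : measurable_fun setT (ker m).
Proof.
apply: measurable_funM; first by apply: measurable_indic; exact: measurable_cone.
apply: measurable_ge0_inv; last by move=> h; rewrite exprn_ge0.
apply: measurable_funX; apply: measurableT_comp => //; exact: measurable_fst.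
Qed.

Lemma int_itv_cst (c a b : R) : 0 <= c -> a <= b ->
  (\int[mu]_t (c * \1_`[a, b]%classic t)%:E = (c * (b - a))%:E)%E.
Proof.
move=> c0 ab; rewrite intZ//.
rewrite EFinM; congr (_ * _)%E; transitivity (mu [set` `[a, b]%R]); first by rewrite integral_indic// setIT.
rewrite lebesgue_measure_itv/= lte_fin.
move: ab; rewrite le_eqVlt => /predU1P[->|ab]; first by rewrite ltxx subrr.
by rewrite ab.
Qed.

(** For x > 0 the section of the cone is [x/(2m), 2x/m], of length 3x/(2m), and the kernel equals
    x^-3 on it. *)
Lemma int_ker_snd m (x : R) : 0 < m ->
  (\int[mu]_y (ker m (x, y))%:E <= (3 / (2 * m) * (x ^+ 2)^-1)%:E)%E.
Proof.
move=> m0; have mk : measurable_fun setT (fun y : R => ker m (x, y)).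
  exact: (measurableT_comp (measurable_ker m) (measurable_pair1 x)).
have [x0|x0] := leP x 0.
  rewrite (_ : (\int[mu]_y _ = 0)%E); first by rewrite lee_fin; pos.
  apply: integral0_eq => y _; rewrite /ker indicE memNset ?mul0r//= => -[/=].
  by rewrite ltNge x0.
have x30 : 0 <= (x ^+ 3)^-1 by rewrite invr_ge0 exprn_ge0// ltW.
apply: (@le_trans _ _ (\int[mu]_y ((x ^+ 3)^-1 * \1_`[x / (2 * m), 2 * x / m]%classic y)%:E)%E).
  apply: le_int; [exact: mk| |by move=> ?; exact: ker_ge0|].
    by apply: measurable_funM => //; exact: measurable_indic.
  move=> y; rewrite /ker /= (gtr0_norm x0) mulrC; apply: ler_wpM2l => //.
  rewrite !indicE; have [|//] := boolP ((x, y) \in cone m).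
  rewrite inE => -[_ /= [xy yx]]; rewrite mem_set//= in_itv/=.
  by rewrite ler_pdivrMr ?ler_pdivlMr; [lra|pos|pos].
rewrite int_itv_cst// ?lee_fin.
  by rewrite le_eqVlt; apply/orP; left; apply/eqP; field; rewrite !gt_eqF.
by rewrite ler_pdivrMr; [rewrite (_ : _ * (2 * m) = 4 * x); [lra|field; rewrite gt_eqF]|pos].
Qed.

(** For y > 0 the section lies in [my/2, 2my], of length 3my/2, and the kernel is at most (my/2)^-3
    there. *)
Lemma int_ker_fst m (y : R) : 0 < m ->
  (\int[mu]_x (ker m (x, y))%:E <= (12 / m ^+ 2 * (y ^+ 2)^-1)%:E)%E.
Proof.
move=> m0; have mk : measurable_fun setT (fun x : R => ker m (x, y)).
  exact: (measurableT_comp (measurable_ker m) (measurable_pair2 y)).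
have [y0|y0] := leP y 0.
  rewrite (_ : (\int[mu]_x _ = 0)%E); first by rewrite lee_fin; pos.
  apply: integral0_eq => x _; rewrite /ker indicE memNset ?mul0r//= => -[/= x0 [xy _]].
  by have := mulr_ge0_le0 (ltW m0) y0; lra.
have my : 0 < m * y by pos.
have y30 : 0 <= ((m * y / 2) ^+ 3)^-1 by pos.
apply: (@le_trans _ _ (\int[mu]_x (((m * y / 2) ^+ 3)^-1 * \1_`[m * y / 2, 2 * (m * y)]%classic x)%:E)%E).
  apply: le_int; [exact: mk| |by move=> ?; exact: ker_ge0|].
    by apply: measurable_funM => //; exact: measurable_indic.
  move=> x; rewrite /ker /= mulrC !indicE.
  have [|_] := boolP ((x, y) \in cone m); last by rewrite mulr0 mulr_ge0.
  rewrite inE => -[/= x0 [xy yx]]; rewrite mem_set//=; last by rewrite in_itv/=; apply/andP; split; lra.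
  rewrite !mulr1 (gtr0_norm x0) lef_pV2 ?posrE ?exprn_gt0//; last by pos.
  by rewrite lerXn2r// ?nnegrE; [pos|lra|lra].
rewrite int_itv_cst// ?lee_fin; last by lra.
by rewrite le_eqVlt; apply/orP; left; apply/eqP; field; rewrite !gt_eqF.
Qed.

(** The increment is taken along a vertical and then a horizontal segment; translation invariance
    makes the second one start at the original point. *)
Lemma L2int_diff_split u h : measurable_fun setT u ->
  (L2int (fun z => u (z + h) - u z)%R <=
   2%:E * L2int (fun z => u (z + (h.1, 0)) - u z)%R + 2%:E * L2int (fun z => u (z + (0, h.2)) - u z)%R)%E.
Proof.
move=> mu_.
rewrite -(@L2int_shift _ (fun z => u (z + (h.1, 0)) - u z) (0, h.2)); last exact: measurable_diff_shift2.
rewrite (_ : (fun z => u (z + h) - u z) =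
  (fun z => (u (z + (0, h.2) + (h.1, 0)) - u (z + (0, h.2))) + (u (z + (0, h.2)) - u z))); last first.
  apply/funext => z; rewrite addrA subrK; congr (u _ - _).
  by case: z h => x y [a b]; rewrite -addrA; congr (_ + _);
    rewrite -[(0, b) + (a, 0)]/(0 + a, b + 0) add0r addr0.
apply: L2intD2; last exact: measurable_diff_shift2.
exact: (measurable_fun_shift2 (0, h.2) (measurable_diff_shift2 (h.1, 0) mu_)).
Qed.

End kernel.

Section kernel_integrals.
Context {R : realType}.
Local Notation T := (measurableTypeR R * measurableTypeR R)%type.
Local Notation mu := (@lebesgue_measure R).
Implicit Types (m r t : R) (z h : T) (f u : T -> R).

Lemma int_ker_fun_fst m (q : R -> \bar R) : 0 < m -> measurable_fun setT q -> (forall t, 0 <= q t)%E ->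
  (\int[leb]_h ((ker m h)%:E * q h.1) <= (3 / (2 * m))%:E * \int[mu]_t ((t ^+ 2)^-1%:E * q t))%E.
Proof.
move=> m0 mq q0.
have mk : measurable_fun setT (EFin \o ker m) by apply/measurable_EFinP; exact: measurable_ker.
have mi : measurable_fun setT (fun t : R => (t ^+ 2)^-1%:E) by apply/measurable_EFinP; exact: measurable_inv_sqr.
have mf : measurable_fun setT (fun h : T => (ker m h)%:E * q h.1)%E.
  by apply: emeasurable_funM => //; exact: (measurableT_comp mq measurable_fst).
have f0 (h : T) : (0 <= (ker m h)%:E * q h.1)%E by apply: mule_ge0 => //; rewrite lee_fin ker_ge0.
rewrite (leb_tonelli mf f0) -ge0_integralZl; last 4 first.
- exact: measurableT.
- exact: emeasurable_funM.
- by move=> t _; apply: mule_ge0 => //; rewrite lee_fin invr_ge0 sqr_ge0.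
- by rewrite lee_fin; pos.
apply: ge0_le_integral => //.
- by move=> x _; apply: integral_ge0 => y _; exact: f0.
- exact: (measurable_leb_int mf f0).
- by apply: emeasurable_funM => //; exact: emeasurable_funM.
move=> x _; rewrite /= ge0_integralZr//; last 2 first.
- exact: (measurableT_comp mk (measurable_pair1 x)).
- by move=> y _; rewrite lee_fin ker_ge0.
by rewrite muleA; apply: lee_wpmul2r => //; exact: int_ker_snd.
Qed.

Lemma int_ker_fun_snd m (q : R -> \bar R) : 0 < m -> measurable_fun setT q -> (forall t, 0 <= q t)%E ->
  (\int[leb]_h ((ker m h)%:E * q h.2) <= (12 / m ^+ 2)%:E * \int[mu]_t ((t ^+ 2)^-1%:E * q t))%E.
Proof.
move=> m0 mq q0.
have mk : measurable_fun setT (EFin \o ker m) by apply/measurable_EFinP; exact: measurable_ker.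
have mi : measurable_fun setT (fun t : R => (t ^+ 2)^-1%:E) by apply/measurable_EFinP; exact: measurable_inv_sqr.
have mf : measurable_fun setT (fun h : T => (ker m h)%:E * q h.2)%E.
  by apply: emeasurable_funM => //; exact: (measurableT_comp mq measurable_snd).
have f0 (h : T) : (0 <= (ker m h)%:E * q h.2)%E by apply: mule_ge0 => //; rewrite lee_fin ker_ge0.
rewrite (leb_tonelli' mf f0) -ge0_integralZl; last 4 first.
- exact: measurableT.
- exact: emeasurable_funM.
- by move=> t _; apply: mule_ge0 => //; rewrite lee_fin invr_ge0 sqr_ge0.
- by rewrite lee_fin; pos.
apply: ge0_le_integral => //.
- by move=> x _; apply: integral_ge0 => y _; exact: f0.
- exact: (measurable_leb_int' mf f0).
- by apply: emeasurable_funM => //; exact: emeasurable_funM.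
move=> y _; rewrite /= ge0_integralZr//; last 2 first.
- exact: (measurableT_comp mk (measurable_pair2 y)).
- by move=> x _; rewrite lee_fin ker_ge0.
by rewrite muleA; apply: lee_wpmul2r => //; exact: int_ker_fst.
Qed.

Lemma int_ker_L2int m u : 0 < m -> measurable_fun setT u ->
  (\int[leb]_h ((ker m h)%:E * L2int (fun z => u (z + h) - u z)%R) <=
   (3 / m)%:E * \int[mu]_t ((t ^+ 2)^-1%:E * L2int (fun z => u (z + (t, 0)) - u z)%R) +
   (24 / m ^+ 2)%:E * \int[mu]_t ((t ^+ 2)^-1%:E * L2int (fun z => u (z + (0, t)) - u z)%R))%E.
Proof.
move=> m0 mu_.
pose q1 t := L2int (fun z => u (z + (t, 0)) - u z).
pose q2 t := L2int (fun z => u (z + (0, t)) - u z).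
have q10 t : (0 <= q1 t)%E by exact: L2int_ge0.
have q20 t : (0 <= q2 t)%E by exact: L2int_ge0.
have mq1 : measurable_fun setT q1.
  exact: (measurableT_comp (measurable_L2int_diff mu_) (@measurable_pair2 _ _ (measurableTypeR R) (measurableTypeR R) 0)).
have mq2 : measurable_fun setT q2.
  exact: (measurableT_comp (measurable_L2int_diff mu_) (@measurable_pair1 _ _ (measurableTypeR R) (measurableTypeR R) 0)).
have mk : measurable_fun setT (EFin \o ker m) by apply/measurable_EFinP; exact: measurable_ker.
have mk1 : measurable_fun setT (fun h : T => (ker m h)%:E * q1 h.1)%E.
  by apply: emeasurable_funM => //; exact: (measurableT_comp mq1 measurable_fst).
have mk2 : measurable_fun setT (fun h : T => (ker m h)%:E * q2 h.2)%E.
  by apply: emeasurable_funM => //; exact: (measurableT_comp mq2 measurable_snd).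
have k10 (h : T) : (0 <= (ker m h)%:E * q1 h.1)%E by apply: mule_ge0 => //; rewrite lee_fin ker_ge0.
have k20 (h : T) : (0 <= (ker m h)%:E * q2 h.2)%E by apply: mule_ge0 => //; rewrite lee_fin ker_ge0.
apply: (@le_trans _ _ (\int[leb]_h (2%:E * ((ker m h)%:E * q1 h.1) + 2%:E * ((ker m h)%:E * q2 h.2)))%E).
  apply: ge0_le_integral => //.
  - by move=> h _; apply: mule_ge0; [rewrite lee_fin ker_ge0|exact: L2int_ge0].
  - by apply: emeasurable_funM => //; exact: measurable_L2int_diff.
  - by apply: emeasurable_funD; exact: emeasurable_funM.
  move=> h _; apply: (le_trans (lee_wpmul2l _ (L2int_diff_split h mu_))); first by rewrite lee_fin ker_ge0.
  by rewrite ge0_muleDr ?mule_ge0 ?q10 ?q20// !(muleCA _ 2%:E).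
rewrite ge0_integralD//; last 4 first.
- by move=> h _; apply: mule_ge0.
- exact: emeasurable_funM.
- by move=> h _; apply: mule_ge0.
- exact: emeasurable_funM.
rewrite !ge0_integralZl//.
apply: leeD.
  apply: (le_trans (lee_wpmul2l _ (int_ker_fun_fst m0 mq1 q10))) => //.
  rewrite muleA -EFinM (_ : 2 * (3 / (2 * m)) = 3 / m)//; by field; rewrite gt_eqF.
apply: (le_trans (lee_wpmul2l _ (int_ker_fun_snd m0 mq2 q20))) => //.
rewrite muleA -EFinM (_ : 2 * (12 / m ^+ 2) = 24 / m ^+ 2)//; by field; rewrite gt_eqF.
Qed.

End kernel_integrals.

(** * Pointwise averaging and the bound for bounded functions *)

Section averaging.
Context {R : realType}.
Local Notation T := (measurableTypeR R * measurableTypeR R)%type.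
Local Notation mu := (@lebesgue_measure R).
Implicit Types (m r t N J : R) (z h : T) (f u : T -> R).

Definition kerG m f z : \bar R := (\int[leb]_h (ker m h * (f (z + h) - f z) ^+ 2)%:E)%E.

Lemma measurable_kerG_fun m f : measurable_fun setT f ->
  measurable_fun setT (fun w : T * T => ker m w.2 * (f (w.1 + w.2) - f w.1) ^+ 2).
Proof.
move=> mf; apply: measurable_funM; first exact: (measurableT_comp (measurable_ker m) measurable_snd).
apply: measurable_funX; apply: measurable_funB; first exact: (measurableT_comp mf measurable_add2).
exact: (measurableT_comp mf measurable_fst).
Qed.

Lemma kerG_fun_ge0 m f (w : T * T) : 0 <= ker m w.2 * (f (w.1 + w.2) - f w.1) ^+ 2.
Proof. by rewrite mulr_ge0 ?ker_ge0 ?sqr_ge0. Qed.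

Lemma kerG_ge0 m f z : (0 <= kerG m f z)%E.
Proof. by apply: int_ge0 => h; exact: (kerG_fun_ge0 m f (z, h)). Qed.

Lemma measurable_kerG m f : measurable_fun setT f -> measurable_fun setT (kerG m f).
Proof.
move=> mf; apply: (@measurable_fun_fubini_tonelli_F _ _ _ _ _ leb (EFin \o (fun w : T * T => ker m w.2 * (f (w.1 + w.2) - f w.1) ^+ 2))).
  by apply/measurable_EFinP; exact: measurable_kerG_fun.
by move=> w; rewrite lee_fin kerG_fun_ge0.
Qed.

Lemma int_kerG m f : measurable_fun setT f ->
  (\int[leb]_z kerG m f z = \int[leb]_h ((ker m h)%:E * L2int (fun z => f (z + h) - f z)%R))%E.
Proof.
move=> mf; rewrite -(int_tonelli2 (measurable_kerG_fun m mf) (kerG_fun_ge0 m f)).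
rewrite (int_tonelli2' (measurable_kerG_fun m mf) (kerG_fun_ge0 m f)).
apply: eq_integral => h _; apply: (@intZ _ _ _ leb (ker m h) (fun z => (f (z + h) - f z) ^+ 2)).
- by apply: measurable_sqr; exact: measurable_diff_shift2.
- exact: ker_ge0.
- by move=> z; exact: sqr_ge0.
Qed.

Lemma int_box_indic (a b c d : R) : a <= b -> c <= d ->
  (\int[leb]_h (\1_`[a, b]%classic h.1 * \1_`[c, d]%classic h.2)%:E = ((b - a) * (d - c))%:E)%E.
Proof.
move=> ab cd; rewrite (@integral_prod _ _ _ _ _ mu mu (\1_`[a, b]%classic) (\1_`[c, d]%classic)); last 2 first.
- exact: integrable_indic_itv.
- exact: integrable_indic_itv.
rewrite EFinM; congr (_ * _)%E.
- by have := int_itv_cst ler01 ab; under eq_integral do rewrite mul1r; rewrite mul1r.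
- by have := int_itv_cst ler01 cd; under eq_integral do rewrite mul1r; rewrite mul1r.
Qed.

(* [a^4 <= 4 a^2 (b - a)^2 + 4 b^4] is averaged over [b = f (z + h)], with [h] in a rectangle
   of sides [r] and [r / m]; the choice of [r] makes the last term half of the left-hand side. *)
Lemma kerG_ptwise m f (X : R) z : 0 < m -> measurable_fun setT f -> 0 < X ->
  (\int[leb]_z (f z ^+ 4)%:E = X%:E)%E ->
  ((f z ^+ 4)%:E <= (64 * m * Num.sqrt (8 * m * X))%:E * kerG m f z)%E.
Proof.
move=> m0 mf X0 fX; set S := Num.sqrt _.
have S0 : 0 < S by rewrite sqrtr_gt0; pos.
have S2 : S ^+ 2 = 8 * m * X by rewrite sqr_sqrtr//; pos.
(* Treated apart because r is obtained by dividing by the square of the value. *)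
have [fz|fz] := eqVneq (f z) 0.
  by rewrite fz expr0n/=; apply: mule_ge0; [rewrite lee_fin; pos|exact: kerG_ge0].
set a := f z in fz *.
have a2 : 0 < a ^+ 2 by rewrite exprn_even_gt0.
(* The rectangle has area r^2/m, so the average of a^4 is a^4 r^2/m = S^2/m = 8X, twice the term 4X
   to be absorbed. *)
pose r := S / a ^+ 2; have r0 : 0 < r by rewrite /r; pos.
pose I h : R := \1_`[r, 2 * r]%classic h.1 * \1_`[r / m, 2 * r / m]%classic h.2.
have mI : measurable_fun setT I.
  by apply: (@measurable_prod_fun _ _ _ _ _ (\1_`[r, 2 * r]%classic) (\1_`[r / m, 2 * r / m]%classic)); exact: measurable_indic.
have mk : measurable_fun setT (fun h => ker m h * (f (z + h) - a) ^+ 2).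
  exact: (measurableT_comp (measurable_kerG_fun m mf) (measurable_pair1 z)).
have k0 h : 0 <= ker m h * (f (z + h) - a) ^+ 2 by rewrite mulr_ge0 ?ker_ge0 ?sqr_ge0.
have sE : (fun h => f (z + h)) = (fun h => f (h + z)) by apply/funext => h; rewrite addrC.
have m4 : measurable_fun setT (fun h => f (z + h) ^+ 4).
  by apply: measurable_funX; rewrite sE; exact: measurable_fun_shift2.
have c0 : 0 <= 32 * r ^+ 3 * a ^+ 2 by pos.
have f40 (x : R) : 0 <= x ^+ 4 by rewrite exprn_even_ge0.
have pt h : a ^+ 4 * I h <= 32 * r ^+ 3 * a ^+ 2 * (ker m h * (f (z + h) - a) ^+ 2) + 4 * f (z + h) ^+ 4.
  have rhs0 : 0 <= 32 * r ^+ 3 * a ^+ 2 * (ker m h * (f (z + h) - a) ^+ 2) + 4 * f (z + h) ^+ 4.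
    by rewrite addr_ge0// mulr_ge0.
  rewrite /I !indicE; have [|_] := boolP (h.1 \in _); last by rewrite mul0r mulr0.
  have [|_] := boolP (h.2 \in _); last by rewrite !mulr0.
  rewrite !inE/= !in_itv/= ler_pdivrMr// ler_pdivlMr// => /andP[h2 h2'] /andP[h1 h1'].
  have hk : ker m h = (h.1 ^+ 3)^-1.
    rewrite /ker indicE mem_set ?mul1r ?gtr0_norm//; [lra|]; split => /=; [lra|].
    by split; lra.
  (* On the rectangle [h.1 <= 2 * r]; this inserts the kernel and turns 4 into 32 r^3. *)
  have k1 : 1 <= 8 * r ^+ 3 * ker m h.
    rewrite hk ler_pdivlMr; last by apply: exprn_gt0; lra.
    rewrite mul1r (_ : 8 * r ^+ 3 = (2 * r) ^+ 3); last by ring.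
    by rewrite lerXn2r ?nnegrE//; lra.
  rewrite !mulr1; move: (f (z + h)) (ker m h) k1 (ker_ge0 m h) => b k k1 _.
  apply: (@le_trans _ _ (4 * a ^+ 2 * (b - a) ^+ 2 + 4 * b ^+ 4)).
    (* The difference of the two sides is the first square plus twice the second expression. *)
    have := sqr_ge0 (a ^+ 2 - 2 * b ^+ 2); have := mulr_ge0 (sqr_ge0 a) (sqr_ge0 (a - 2 * b)).
    nra.
  rewrite lerD2r (_ : 32 * _ * _ * _ = (4 * a ^+ 2 * (b - a) ^+ 2) * (8 * r ^+ 3 * k)); last by ring.
  by apply: ler_peMr => //; pos.
have int4 : (\int[leb]_h (f (z + h) ^+ 4)%:E = X%:E)%E.
  rewrite -fX -(int_shift2 z (measurable_funX 4 mf) (fun h => f40 (f h))).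
  by apply: eq_integral => h _; rewrite addrC.
have I0 h : 0 <= I h by rewrite mulr_ge0.
have : (\int[leb]_h (a ^+ 4 * I h)%:E <=
   \int[leb]_h (32 * r ^+ 3 * a ^+ 2 * (ker m h * (f (z + h) - a) ^+ 2) + 4 * f (z + h) ^+ 4)%:E)%E.
  apply: le_int.
  - exact: measurable_funM.
  - by apply: measurable_funD; exact: measurable_funM.
  - by move=> h; rewrite mulr_ge0.
  - exact: pt.
rewrite intZ// int_box_indic; [|lra|by rewrite ler_pM2r ?invr_gt0//; lra].
rewrite intD; [|exact: measurable_funM|exact: measurable_funM|by move=> h; exact: mulr_ge0|by move=> h; rewrite mulr_ge0].
rewrite intZ// intZ// int4 -/(kerG m f z).
have ra : r * a ^+ 2 = S by rewrite /r divfK// gt_eqF.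
have := kerG_ge0 m f z; case: (kerG m f z) => [G| |]//; last by move=> _ _; rewrite gt0_muley ?leey// lte_fin; pos.
rewrite -!EFinM -EFinD !lee_fin => G0 ineq.
have X4 : 4 * X = a ^+ 4 * r ^+ 2 / (2 * m).
  have -> : X = S ^+ 2 / (8 * m) by rewrite S2; field; rewrite gt_eqF.
  by rewrite -ra; field; rewrite gt_eqF.
have {}ineq : a ^+ 4 * r ^+ 2 / (2 * m) <= 32 * r ^+ 3 * a ^+ 2 * G.
  move: ineq; rewrite X4.
  rewrite (_ : a ^+ 4 * ((2 * r - r) * _) = a ^+ 4 * r ^+ 2 / (2 * m) + a ^+ 4 * r ^+ 2 / (2 * m)).
    by rewrite lerD2r.
  by field; rewrite gt_eqF.
have -> : 64 * m * S * G = 32 * r ^+ 3 * a ^+ 2 * G * ((2 * m) / r ^+ 2).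
  by rewrite -ra; field; rewrite gt_eqF.
rewrite -ler_pdivrMr; last by pos.
by rewrite invf_div mulrA.
Qed.

(** Integrating [kerG_ptwise] gives X <= 64 m S J with S^2 = 8 m X; squaring and cancelling one X
    yields the claim. The bound [N] enters only to make X finite, through f^4 <= N^2 f^2. *)
Lemma sobolev_bounded f N m J : measurable_fun setT f -> (forall z, `|f z| <= N) ->
  (L2int f < +oo)%E -> 0 < m -> 0 <= J ->
  (\int[leb]_h ((ker m h)%:E * L2int (fun z => f (z + h) - f z)%R) <= J%:E)%E ->
  (\int[leb]_z (f z ^+ 4)%:E <= (8 ^+ 5 * m ^+ 3 * J ^+ 2)%:E)%E.
Proof.
move=> mf fN ffin m0 J0; rewrite -int_kerG// => GJ.
have f40 z : 0 <= f z ^+ 4 by rewrite exprn_even_ge0.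
have mf4 : measurable_fun setT (fun z => f z ^+ 4) by exact: measurable_funX.
have f4 : (\int[leb]_z (f z ^+ 4)%:E \is a fin_num)%E.
  rewrite ge0_fin_numE; last exact: int_ge0.
  apply: (@le_lt_trans _ _ (\int[leb]_z (N ^+ 2 * f z ^+ 2)%:E)%E).
    apply: le_int => //; first by apply: measurable_funM => //; exact: measurable_sqr.
    move=> z; rewrite (_ : f z ^+ 4 = f z ^+ 2 * f z ^+ 2); last by ring.
    apply: ler_wpM2r; first exact: sqr_ge0.
    rewrite -[leLHS]real_normK ?num_real// lerXn2r ?nnegrE//.
    exact: le_trans (normr_ge0 _) (fN z).
  rewrite intZ ?sqr_ge0//; [|exact: measurable_sqr|by move=> z; exact: sqr_ge0].
  by rewrite lte_mul_pinfty// lee_fin sqr_ge0.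
pose X := fine (\int[leb]_z (f z ^+ 4)%:E)%E.
have fX : (\int[leb]_z (f z ^+ 4)%:E = X%:E)%E by rewrite /X fineK.
have : 0 <= X by rewrite /X fine_ge0// int_ge0.
rewrite le_eqVlt => /predU1P[X0|X0]; first by rewrite fX -X0 lee_fin; pos.
have pt z := kerG_ptwise z m0 mf X0 fX.
set S := Num.sqrt _ in pt.
have S0 : 0 < S by rewrite sqrtr_gt0; pos.
have S2 : S ^+ 2 = 8 * m * X by rewrite sqr_sqrtr//; pos.
have c0 : 0 <= 64 * m * S by pos.
have : (X%:E <= (64 * m * S)%:E * J%:E)%E.
  apply: (le_trans _ (lee_wpmul2l _ GJ)); last by rewrite lee_fin.
  rewrite -ge0_integralZl//; [|exact: measurable_kerG|by move=> z _; exact: kerG_ge0].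
  rewrite -fX; apply: ge0_le_integral => //.
  - by move=> z _; rewrite lee_fin.
  - exact/measurable_EFinP.
  - by apply: emeasurable_funM => //; exact: measurable_kerG.
rewrite fX -EFinM !lee_fin => XS.
have : X ^+ 2 <= (64 * m * S * J) ^+ 2 by rewrite lerXn2r ?nnegrE ?mulr_ge0// ltW.
rewrite (_ : (64 * m * S * J) ^+ 2 = 8 ^+ 4 * m ^+ 2 * J ^+ 2 * S ^+ 2); last by ring.
rewrite S2 (_ : _ * (8 * m * X) = X * (8 ^+ 5 * m ^+ 3 * J ^+ 2)); last by ring.
by rewrite expr2 ler_pM2l.
Qed.

End averaging.

Section L4.
Context {R : realType}.
Local Notation T := (measurableTypeR R * measurableTypeR R)%type.
Implicit Types (u w : T -> R) (a b m : R).

(** 8^5 comes from [sobolev_bounded]; 240 = 3 * 16 + 24 * 8 adds the horizontal and vertical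
    contributions to the coefficient of b^2. *)
Definition sobolev_const : R := 8 ^+ 5 * (240 * pi) ^+ 2.

Lemma sobolev_const_gt0 : 0 < sobolev_const.
Proof.
have n0 (n : nat) : 0 < n.+1%:R :> R by rewrite ltr0n.
have K0 : 0 < 240 * pi :> R := mulr_gt0 (n0 239) (pi_gt0 R).
exact: mulr_gt0 (exprn_gt0 5 (n0 7)) (exprn_gt0 2 K0).
Qed.

(** With [s] equal to [m] both directions are bounded by multiples of (b^2 + a^2/m^2)/m. The clamped
    functions satisfy the same kernel bound, since clamping shortens increments, and Fatou passes
    from them to [u]. *)
Lemma int4_le_scaled u w w' a b m : is_Dxhalf u w -> is_Dxmhalf_dy u w' -> 0 < m ->
  L2int w = (b ^+ 2)%:E -> L2int w' = (a ^+ 2)%:E ->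
  (\int[leb]_z (u z ^+ 4)%:E <= (sobolev_const * m * (b ^+ 2 + a ^+ 2 / m ^+ 2) ^+ 2)%:E)%E.
Proof.
move=> uw uw' m0 wb wa; have [J1 J2] := seminorm_bounds m0 uw uw'.
have [v [v' [/is_fourierP[/inL2P[mu_ ufin] _ _] _ _]]] := uw.
pose J := 240 * pi / m * (b ^+ 2 + a ^+ 2 / m ^+ 2).
have q0 : 0 < pi :> R := pi_gt0 R.
have n0 (n : nat) : 0 <= n%:R :> R by rewrite ler0n.
have J0 : 0 <= J.
  rewrite /J; apply: mulr_ge0.
    by apply: divr_ge0; [exact: mulr_ge0 (n0 240) (ltW q0)|exact: ltW].
  by apply: addr_ge0; [exact: sqr_ge0|exact: divr_ge0 (sqr_ge0 _) (sqr_ge0 _)].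
have -> : sobolev_const * m * (b ^+ 2 + a ^+ 2 / m ^+ 2) ^+ 2 = 8 ^+ 5 * m ^+ 3 * J ^+ 2.
  by rewrite /sobolev_const /J; field; rewrite gt_eqF.
have KJ : (\int[leb]_h ((ker m h)%:E * L2int (fun z => u (z + h) - u z)%R) <= J%:E)%E.
  apply: (le_trans (int_ker_L2int m0 mu_)).
  apply: (@le_trans _ _ ((3 / m)%:E * ((16 * pi)%:E * L2int w) + (24 / m ^+ 2)%:E * ((8 * pi)%:E * (m%:E * L2int w + m^-1%:E * L2int w')))%E).
    apply: leeD; apply: lee_wpmul2l => //; rewrite lee_fin.
      exact: divr_ge0 (n0 3) (ltW m0).
    exact: divr_ge0 (n0 24) (sqr_ge0 _).
  rewrite wb wa -[leLHS]/((3 / m * (16 * pi * b ^+ 2) + 24 / m ^+ 2 * (8 * pi * (m * b ^+ 2 + m^-1 * a ^+ 2)))%:E) lee_fin /J.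
  rewrite [leRHS](_ : _ = 3 / m * (16 * pi * b ^+ 2) + 24 / m ^+ 2 * (8 * pi * (m * b ^+ 2 + m^-1 * a ^+ 2)) + 48 * pi / m * a ^+ 2 / m ^+ 2).
    rewrite lerDl; apply: divr_ge0 (sqr_ge0 _); apply: mulr_ge0 (sqr_ge0 _).
    by apply: divr_ge0; [exact: mulr_ge0 (n0 48) (ltW q0)|exact: ltW].
  by field; rewrite gt_eqF.
apply: (@fatou_bound _ _ _ _ (fun n z => clamp n%:R (u z) ^+ 4)).
- by move=> n; apply: measurable_funX; exact: measurable_clamp.
- by move=> n z; rewrite exprn_even_ge0.
- by move=> z; apply: cvg_near_cst; apply: filterS (clamp_cvg (u z)) => n ->.
move=> e e0; exists 0%N => n _.
have mc : measurable_fun setT (fun z => clamp n%:R (u z)) by exact: measurable_clamp.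
have sq_le (x y : R) : `|x| <= `|y| -> x ^+ 2 <= y ^+ 2.
  by move=> xy; rewrite -[leLHS]real_normK ?num_real// -[leRHS]real_normK ?num_real// lerXn2r ?nnegrE.
apply: (@le_trans _ _ (8 ^+ 5 * m ^+ 3 * J ^+ 2)%:E); last by rewrite -EFinD lee_fin lerDl ltW.
apply: (@sobolev_bounded _ _ n%:R m J mc _ _ m0 J0).
- by move=> z; exact: clamp_le.
- apply: le_lt_trans ufin; apply: le_int; [exact: measurable_sqr|exact: measurable_sqr| |].
  + by move=> z; exact: sqr_ge0.
  + by move=> z; apply: sq_le; exact: clamp_norm.
- apply: le_trans KJ; apply: ge0_le_integral => //.
  + by move=> h _; apply: mule_ge0; [rewrite lee_fin ker_ge0|exact: L2int_ge0].
  + by apply: emeasurable_funM; [apply/measurable_EFinP; exact: measurable_ker|exact: measurable_L2int_diff].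
  + by apply: emeasurable_funM; [apply/measurable_EFinP; exact: measurable_ker|exact: measurable_L2int_diff].
  move=> h _; apply: lee_wpmul2l; first by rewrite lee_fin ker_ge0.
  apply: le_int.
  + by apply: measurable_sqr; exact: measurable_diff_shift2.
  + by apply: measurable_sqr; exact: measurable_diff_shift2.
  + by move=> z; exact: sqr_ge0.
  + by move=> z; apply: sq_le; exact: clamp_dist.
Qed.

(** At m = a/b the two terms in the bracket coincide, which produces the factor 4. If a or b is 0,
    the claim is that u^4 has integral 0, obtained from arbitrarily small bounds. *)
Lemma int4_le u w w' a b : is_Dxhalf u w -> is_Dxmhalf_dy u w' ->
  0 <= a -> 0 <= b -> L2int w = (b ^+ 2)%:E -> L2int w' = (a ^+ 2)%:E ->
  (\int[leb]_z (u z ^+ 4)%:E <= (4 * sobolev_const * (a * b ^+ 3))%:E)%E.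
Proof.
move=> uw uw' a0 b0 wb wa; have c0 := sobolev_const_gt0.
have H m (m0 : 0 < m) := int4_le_scaled uw uw' m0 wb wa.
move: sobolev_const c0 H => K c0 H.
have [a1|a1] := eqVneq a 0.
  apply/lee_addgt0Pr => e e0; rewrite a1 mul0r mulr0 add0e.
  (* With a = 0 the bound is K m b^4, so a small m is taken. *)
  have m0 : 0 < e / (K * b ^+ 4 + 1) by apply: divr_gt0 => //; rewrite ltr_wpDl//; pos; rewrite exprn_ge0.
  apply: (le_trans (H _ m0)); rewrite lee_fin a1 expr0n/= mul0r addr0 -exprM mulrAC.
  rewrite mulrA ler_pdivrMr; last by rewrite ltr_wpDl//; pos; rewrite exprn_ge0.
  by rewrite mulrC ler_wpM2l ?ltW// ltrDl.
have [b1|b1] := eqVneq b 0.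
  apply/lee_addgt0Pr => e e0; rewrite b1 expr0n/= !mulr0 add0e.
  (* With b = 0 the bound is K a^4/m^3, so m is taken large; the 1 ensures m <= m^3. *)
  pose m := 1 + K * a ^+ 4 / e.
  have m1 : 1 <= m by rewrite /m lerDl; pos; rewrite exprn_ge0.
  have m0 : 0 < m by lra.
  apply: (le_trans (H _ m0)); rewrite lee_fin b1 expr0n/= add0r.
  rewrite (_ : _ * _ = K * a ^+ 4 / m ^+ 3); last by field; rewrite gt_eqF.
  rewrite ler_pdivrMr; last by pos.
  have : K * a ^+ 4 <= e * m by rewrite -ler_pdivrMl// mulrC /m lerDr.
  have : m <= m ^+ 3 by rewrite -[leLHS]expr1 ler_weXn2l.
  move=> h1 h2; apply: (le_trans h2); rewrite ler_wpM2l//; exact: ltW.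
have a2 : 0 < a by rewrite lt0r a1.
have b2 : 0 < b by rewrite lt0r b1.
have m0 : 0 < a / b by exact: divr_gt0.
apply: (le_trans (H _ m0)); rewrite lee_fin le_eqVlt; apply/orP; left; apply/eqP.
by field; rewrite !gt_eqF.
Qed.

End L4.

(** * Interpolation *)

Section interpolation.
Context {R : realType}.
Local Notation T := (measurableTypeR R * measurableTypeR R)%type.
Implicit Types (u : T -> R) (n p X : R).

Lemma poweR_root (x : \bar R) (r : R) : (0 <= x)%E -> r != 0 -> ((x `^ r) `^ r^-1 = x)%E.
Proof. by move=> x0 r0; rewrite -poweRrM divff// poweRe1. Qed.

(** Hoelder for |u|^(p+2) = |u|^(2-p) |u|^(2p) with exponents 2/(2-p) and 2/p, which turn the
    factors into u^2 and u^4. *)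
Lemma normLp_interpolation u n X p : measurable_fun setT u -> 0 <= n -> 0 <= X -> 0 <= p <= 2 ->
  L2int u = (n ^+ 2)%:E -> (\int[leb]_z (u z ^+ 4)%:E <= X%:E)%E ->
  (normLp (p + 2) u `^ (p + 2) <= (n `^ (2 - p) * X `^ (p / 2))%:E)%E.
Proof.
move=> mu_ n0 X0 /andP[p0 p2] un uX.
have pw2 z : `|u z| `^ 2 = u z ^+ 2 by rewrite powR_mulrn// real_normK ?num_real.
have pw4 z : `|u z| `^ 4 = u z ^+ 4 by rewrite powR_mulrn// -normrX ger0_norm// exprn_even_ge0.
have p20 : p + 2 != 0 by rewrite gt_eqF//; lra.
rewrite /normLp poweR_Lnorm//.
have -> : (\int[leb2]_x (`|(EFin \o u) x| `^ (p + 2)) = \int[leb]_x (`|u x| `^ (p + 2))%:E)%E.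
  by apply: eq_integral => x _.
(* The end points p = 0 and p = 2, where one of the exponents would be infinite, are direct. *)
move: p0; rewrite le_eqVlt => /predU1P[<-|p0].
  rewrite mul0r powRr0 mulr1 add0r subr0 powR_mulrn// -un.
  by rewrite le_eqVlt; apply/orP; left; apply/eqP; apply: eq_integral => x _; rewrite pw2.
move: p2; rewrite le_eqVlt => /predU1P[->|p2].
  rewrite subrr powRr0 mul1r divff// powRr1//; apply: le_trans uX.
  rewrite le_eqVlt; apply/orP; left; apply/eqP; apply: eq_integral => x _.
  by rewrite (_ : 2 + 2 = 4) ?pw4//; ring.
have q0 : 0 < 2 - p by lra.
pose f z := `|u z| `^ (2 - p); pose g z := `|u z| `^ (2 * p).
have mpow r : measurable_fun setT (fun z => `|u z| `^ r).
  exact: (@measurableT_comp _ _ _ _ _ _ (fun x => x `^ r) _ (fun z => `|u z|) (measurable_realfun.measurable_powR r) (measurableT_comp _ mu_)).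
have P0 : 0 < 2 / (2 - p) by exact: divr_gt0.
have Q0 : 0 < 2 / p by exact: divr_gt0.
have PQ : (2 / (2 - p))^-1 + (2 / p)^-1 = 1 by field; rewrite !gt_eqF.
have := @hoelder _ _ _ leb f g _ _ (mpow _) (mpow _) P0 Q0 PQ.
rewrite Lnorm1.
have -> : (\int[leb]_x `|(EFin \o (f \* g)%R) x| = \int[leb]_x (`|u x| `^ (p + 2))%:E)%E.
  apply: eq_integral => x _ /=; rewrite ger0_norm; last exact: mulr_ge0 (powR_ge0 _ _) (powR_ge0 _ _).
  rewrite /f /g -powRD; first by congr (_ `^ _)%:E; ring.
  by apply/implyP => /eqP; lra.
move=> H; apply: (le_trans H); rewrite (EFinM (n `^ _)); apply: lee_pmul.
- exact: Lnorm_ge0.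
- exact: Lnorm_ge0.
- rewrite -[leLHS](@poweR_root _ (2 / (2 - p))) ?Lnorm_ge0 ?gt_eqF//.
  rewrite poweR_Lnorm ?gt_eqF// (_ : \int[leb]_x _ = L2int u)%E; last first.
    apply: eq_integral => x _ /=; rewrite ger0_norm ?powR_ge0// /f -powRrM mulrC divfK ?gt_eqF//.
    by rewrite pw2.
  rewrite un poweR_EFin -powR_mulrn// -powRrM lee_fin invf_div.
  by rewrite mulrC divfK.
- rewrite -[leLHS](@poweR_root _ (2 / p)) ?Lnorm_ge0 ?gt_eqF//.
  rewrite poweR_Lnorm ?gt_eqF// (_ : \int[leb]_x _ = \int[leb]_x (u x ^+ 4)%:E)%E; last first.
    apply: eq_integral => x _ /=; rewrite ger0_norm ?powR_ge0// /g -powRrM.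
    by rewrite (_ : 2 * p * _ = 4) ?pw4//; field; rewrite gt_eqF.
  rewrite invf_div -poweR_EFin; apply: gt0_ler_poweR => //.
  + by apply: divr_ge0 => //; exact: ltW.
  + by rewrite in_itv/= leey andbT; apply: int_ge0 => z; rewrite exprn_even_ge0.
  + by rewrite in_itv/= leey andbT lee_fin.
Qed.

End interpolation.

(** * Norms on the space Z *)

Section Zspace.
Context {R : realType}.
Local Notation T := (measurableTypeR R * measurableTypeR R)%type.
Implicit Types (u : T -> R).

Lemma normLp2_fin u : inLp 2 u ->
  exists n, [/\ 0 <= n, normLp 2 u = n%:E & L2int u = (n ^+ 2)%:E].
Proof.
move=> /inL2P[mu_ ufin]; have N0 : (0 <= normLp 2 u)%E by exact: Lnorm_ge0.
have : normLp 2 u \is a fin_num.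
  rewrite fin_numElt (lt_le_trans _ N0) ?ltNyr//=.
  by apply: (@lty_poweRy _ _ 2); rewrite ?pnatr_eq0// normLp2_sqr.
move=> /fineK Nf; exists (fine (normLp 2 u)); rewrite Nf; split => //; first exact: fine_ge0.
by rewrite -normLp2_sqr -Nf poweR_EFin powR_mulrn// fine_ge0.
Qed.

(** On [Zspace] the functions chosen by [xget] meet their specification and all norms are finite, so
    the theorem becomes an inequality between real numbers n, a, b. *)
Lemma Zspace_norms u : Zspace u -> exists n a b, [/\ measurable_fun setT u, 0 <= n, 0 <= a & 0 <= b] /\
  [/\ is_Dxhalf u (Dxhalf u), is_Dxmhalf_dy u (Dxmhalf_dy u),
      L2int u = (n ^+ 2)%:E, L2int (Dxmhalf_dy u) = (a ^+ 2)%:E & L2int (Dxhalf u) = (b ^+ 2)%:E] /\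
  [/\ normLp 2 u = n%:E, normLp 2 (Dxmhalf_dy u) = a%:E, normLp 2 (Dxhalf u) = b%:E &
      normZ u = (Num.sqrt (n ^+ 2 + b ^+ 2 + a ^+ 2))%:E].
Proof.
case=> u2 ew ew'.
have uw : is_Dxhalf u (Dxhalf u) by exact: (xgetPex (cst 0) ew).
have uw' : is_Dxmhalf_dy u (Dxmhalf_dy u) by exact: (xgetPex (cst 0) ew').
have w2 : inLp 2 (Dxhalf u) by have [? [? [_ /is_fourierP[]]]] := uw.
have w'2 : inLp 2 (Dxmhalf_dy u) by have [? [? [_ /is_fourierP[]]]] := uw'.
have [n [n0 nE nE2]] := normLp2_fin u2.
have [b [b0 bE bE2]] := normLp2_fin w2.
have [a [a0 aE aE2]] := normLp2_fin w'2.
exists n, a, b; split; first by split => //; have [] := inL2P u2.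
split => //; split => //; rewrite /normZ.
have [[m1 _] [m2 _] [m3 _]] := And3 (inL2P u2) (inL2P w2) (inL2P w'2).
transitivity ((L2int u + L2int (Dxhalf u) + L2int (Dxmhalf_dy u)) `^ (1 / 2))%E; last first.
  rewrite nE2 bE2 aE2 -[X in (X `^ _)%E]/((n ^+ 2 + b ^+ 2 + a ^+ 2)%:E) poweR_EFin div1r powR12_sqrt//.
  by rewrite !addr_ge0 ?sqr_ge0.
congr (_ `^ _)%E; rewrite /L2int -intD.
- rewrite -intD.
  + by apply: eq_integral => z _; rewrite !real_normK ?num_real.
  + by apply: measurable_funD; exact: measurable_sqr.
  + exact: measurable_sqr.
  + by move=> z; rewrite addr_ge0 ?sqr_ge0.
  + by move=> z; exact: sqr_ge0.
- exact: measurable_sqr.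
- exact: measurable_sqr.
- by move=> z; exact: sqr_ge0.
- by move=> z; exact: sqr_ge0.
Qed.

Lemma anisotropic_bound u w w' (p n a b : R) : 0 <= p <= 2 -> measurable_fun setT u ->
  is_Dxhalf u w -> is_Dxmhalf_dy u w' -> 0 <= n -> 0 <= a -> 0 <= b ->
  L2int u = (n ^+ 2)%:E -> L2int w' = (a ^+ 2)%:E -> L2int w = (b ^+ 2)%:E ->
  (normLp (p + 2) u `^ (p + 2) <=
   ((4 * sobolev_const) `^ (p / 2) * n `^ (2 - p) * a `^ (p / 2) * b `^ (3 * p / 2))%:E)%E.
Proof.
move=> p02 mu_ uw uw' n0 a0 b0 un wa wb.
have c0 : 0 <= 4 * sobolev_const :> R by apply: mulr_ge0; [rewrite ler0n|exact: ltW sobolev_const_gt0].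
have X0 : 0 <= a * b ^+ 3 by apply: mulr_ge0 => //; exact: exprn_ge0.
have := normLp_interpolation mu_ n0 (mulr_ge0 c0 X0) p02 un (int4_le uw uw' a0 b0 wb wa).
rewrite (powRM _ c0 X0) (powRM _ a0) ?exprn_ge0// -powR_mulrn// -powRrM.
rewrite (_ : 3%:R * (p / 2) = 3 * p / 2); last by rewrite mulrA.
by move=> H; apply: (le_trans H); rewrite lee_fin le_eqVlt; apply/orP; left; apply/eqP; ring.
Qed.

End Zspace.

Unset Implicit Arguments.

Theorem lemma2p1 (R : realType) (p : R) (p_ge0 : 0 <= p) (p_le2 : p <= 2) :
  (exists C : R, 0 < C /\
    forall phi : R * R -> R, Zspace phi ->
      (normLp (p + 2) phi `^ (p + 2) <=
       C%:E * normLp 2 phi `^ (2 - p)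
            * normLp 2 (Dxmhalf_dy phi) `^ (p / 2)
            * normLp 2 (Dxhalf phi) `^ (3 * p / 2))%E) /\
  (exists C : R, 0 < C /\
    forall phi : R * R -> R, Zspace phi ->
      inLp (p + 2) phi /\ (normLp (p + 2) phi <= C%:E * normZ phi)%E).
Proof.
have p02 : 0 <= p <= 2 by apply/andP.
have c0 : 0 < 4 * sobolev_const :> R by apply: mulr_gt0; [rewrite ltr0n|exact: sobolev_const_gt0].
set K := 4 * sobolev_const in c0.
have q0 : 0 < p + 2 by lra.
have q20 : p + 2 != 0 by rewrite gt_eqF.
have K0 : 0 < K `^ (p / 2) by exact: powR_gt0.
split.
  exists (K `^ (p / 2)); split => // phi /Zspace_norms[n [a [b]]].
  move=> [[mphi n0 a0 b0] [[uw uw' un wa wb] [-> -> -> _]]].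
  rewrite !poweR_EFin -!EFinM; exact: anisotropic_bound uw uw' _ _ _ un wa wb.
(* The (p+2)-th root of the constant of the first part. *)
exists ((K `^ (p / 2)) `^ (p + 2)^-1); split; first exact: powR_gt0.
move=> phi /Zspace_norms[n [a [b]]].
move=> [[mphi n0 a0 b0] [[uw uw' un wa wb] [_ _ _ ->]]].
set r := Num.sqrt _; have r0 : 0 <= r by exact: sqrtr_ge0.
have ler x : 0 <= x -> x ^+ 2 <= n ^+ 2 + b ^+ 2 + a ^+ 2 -> x <= r.
  by move=> x0 xs; rewrite -[x]ger0_norm// -sqrtr_sqr ler_wsqrtr.
have [n2 a2 b2] := And3 (sqr_ge0 n) (sqr_ge0 a) (sqr_ge0 b).
have nr : n <= r by apply: ler => //; lra.
have ar : a <= r by apply: ler => //; lra.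
have br : b <= r by apply: ler => //; lra.
have pw x e : 0 <= e -> 0 <= x -> x <= r -> x `^ e <= r `^ e.
  by move=> e0 x0 xr; apply: ge0_ler_powR.
have bound : (normLp (p + 2) phi `^ (p + 2) <= (K `^ (p / 2) * r `^ (p + 2))%:E)%E.
  apply: (le_trans (anisotropic_bound p02 mphi uw uw' n0 a0 b0 un wa wb)).
  (* The three exponents add up to p + 2, so each norm may be replaced by r, the norm in Z. *)
  rewrite lee_fin -!mulrA ler_pM2l// (_ : p + 2 = (2 - p) + (p / 2 + 3 * (p / 2))); last by field.
  rewrite [leRHS]powRD; last by apply/implyP => /eqP; lra.
  (* Splitting a power of r, which may be 0, needs a nonzero total exponent. *)
  have [/eqP p00|p00] := boolP (p == 0).
    by rewrite p00 !mul0r !mulr0 !addr0 !powRr0 !mulr1 subr0; apply: pw.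
  have pp : 0 < p by rewrite lt0r p00.
  rewrite [X in _ <= _ * X]powRD; last by apply/implyP => /eqP; lra.
  apply: ler_pM; rewrite ?mulr_ge0 ?powR_ge0//; first by apply: pw => //; lra.
  by apply: ler_pM; rewrite ?powR_ge0//; apply: pw => //; lra.
have N0 : (0 <= normLp (p + 2) phi)%E by exact: Lnorm_ge0.
split.
  rewrite /inLp inE; apply/andP; split; rewrite inE//=.
  apply: (lty_poweRy q20).
  exact: le_lt_trans bound (ltry _).
rewrite -(poweR_root N0 q20) -EFinM.
rewrite [X in _ * X](_ : r = (r `^ (p + 2)) `^ (p + 2)^-1); last by rewrite -powRrM divff// powRr1.
rewrite -powRM ?powR_ge0// -poweR_EFin; apply: gt0_ler_poweR => //.
- by rewrite invr_ge0 ltW.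
- by rewrite in_itv/= leey poweR_ge0.
- by rewrite in_itv/= leey andbT lee_fin mulr_ge0 ?powR_ge0.
Qed.
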